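(* Let $(L,A,B_0,V)$ be a finite-component datum that is componentwise regular, and let $B$ be a subgroup with $B_0\le B\le A$. Let $a\in A$ satisfy $a^2\in B$. If $$\mathcal S^*(R_L(V))^{L,B}\subset\mathcal S^*(R_L(V))^a,$$ then $$\mathcal S^*(Q_L(V))^{L,B}\subset\mathcal S^*(Q_L(V))^a.$$ Consequently every symmetric central quotient represented by the intermediate fixed-component group $B$ is regular.
   Context: All groups are complex algebraic; for distributions, complex varieties are regarded as real Nash manifolds, and $\mathcal S^*(X)$ is the space of Schwartz distributions on $X$. For a reductive group $L$ acting linearly on $V$: $Q_L(V)=V/V^L$ (identified with its canonical $L$-stable model), $\pi:Q_L(V)\to Q_L(V)/\!/L$ the categorical quotient, $\Gamma_L(V)=\pi^{-1}(\pi(0))$, $R_L(V)=Q_L(V)\setminus\Gamma_L(V)$. Finite-component datum. Let $\widetilde G=Z\times G_{\mathrm{ss}}$ with $Z$ a complex torus and $G_{\mathrm{ss}}$ simply connected semisimple, $\widetilde\theta$ an algebraic involution of $\widetilde G$, $\widetilde H=\widetilde G^{\widetilde\theta}$, $\mathfrak p$ the $(-1)$-eigenspace of $d\widetilde\theta$, $V=Q_{\widetilde H}(\mathfrak p)$. Put $L=\operatorname{Ad}(\widetilde H)|_V$, which is connected reductive with $V^L=0$. Let $$\widetilde A_{\widetilde\theta}=\{g\in\widetilde G:g^{-1}\widetilde\theta(g)\in Z(\widetilde G)\},\qquad J=\operatorname{Ad}(\widetilde A_{\widetilde\theta})|_V,\qquad A=J/L.$$ $J$ is reductive with identity component $L$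 and $A$ is finite abelian. $B_0\le A$ is the image of $\widetilde H$ in $A$ (the trivial subgroup). The datum is $(L,A,B_0,V)$. For $\lambda\in\widehat A$, $\mathcal S^*(X)^{L,\lambda}=\{T\in\mathcal S^*(X)^L:j_*T=\lambda(jL)T\ \forall j\in J\}$. The datum is componentwise regular if for every nontrivial $\lambda\in\widehat A$ with $\lambda|_{B_0}=1$: $\mathcal S^*(R_L(V))^{L,\lambda}=0\Rightarrow\mathcal S^*(Q_L(V))^{L,\lambda}=0$. For a subgroup $B\le A$, $\mathcal S^*(X)^{L,B}$ denotes the distributions invariant under $L$ and under the inverse image $J_B$ of $B$ in $J$. For $a\in A$, $\mathcal S^*(X)^a$ refers to invariance under a representative of $a$ in $J$ (independent of the representative on $L$-invariant distributions). Central quotients. For a finite $\widetilde\theta$-stable subgroup $F\subset Z(\widetilde G)$, put $G=\widetilde G/F$ with induced involution $\theta$, and $H=G^\theta$; the preimage of $H$ in $\widetilde G$ is $\widehat H_F=\{g\in\widetilde G:g^{-1}\widetilde\theta(g)\in F\}$, whose effective component image in $A$ is denoted $B_F$. The symmetric central quotient $(G,G^\theta,\theta)$ is represented by $B$ if $B_F=B$. Regularity. Let $(G,H,\theta)$ be a connected reductive complex symmetric pair, $H=G^\theta$, with $(-1)$-eigenspace $\mathfrak p$. An element $g\in G$ is admissible if: (i) $\operatorname{Ad}(g)$ commutes with $\theta$, equivalently $g^{-1}\theta(g)\in Z(G)$; (ii) $\operatorname{Ad}(g)|_{\mathfrak p}$ normalizes the $H$-action, its square belongs to the $H$-action, and it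 preserves every closed $H$-orbit in $\mathfrak p$. The pair is regular if for every admissible $g$: $\mathcal S^*(R_H(\mathfrak p))^H\subset\mathcal S^*(R_H(\mathfrak p))^{\operatorname{Ad}(g)}$ implies $\mathcal S^*(Q_H(\mathfrak p))^H\subset\mathcal S^*(Q_H(\mathfrak p))^{\operatorname{Ad}(g)}$. *)

(* Defs.v *)
From HB Require Import structures.
From mathcomp Require Import all_boot all_order all_algebra.
From mathcomp Require Import complex.
From mathcomp Require Import all_classical all_reals all_analysis.
Import Order.TTheory GRing.Theory Num.Theory.
Import numFieldNormedType.Exports.

Set Implicit Arguments.
Unset Strict Implicit.
Unset Printing Implicit Defensive.

Local Open Scope classical_set_scope.
Local Open Scope ring_scope.
Local Open Scope complex_scope.

(** The complex numbers are [R[i]] with [R : realType]. *)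

Inductive gen_alg (K : comNzRingType) (T : Type) (gens : set (T -> K)) :
    set (T -> K) :=
| gen_alg_gen f : gens f -> gen_alg gens f
| gen_alg_cst c : gen_alg gens (fun=> c)
| gen_alg_add f g : gen_alg gens f -> gen_alg gens g ->
    gen_alg gens (fun x => f x + g x)
| gen_alg_mul f g : gen_alg gens f -> gen_alg gens g ->
    gen_alg gens (fun x => f x * g x).

(** Linear algebraic groups are Zariski closed subgroups of [GL_n(C)]. *)
Section AlgebraicGroups.
Context {R : realType}.
Local Notation C := R[i].

Definition entry n (i j : 'I_n) (g : 'M[C]_n) : C := g i j.

(** [C[GL_n]], generated by the matrix entries and [1/det]. *)
Definition regular_GL n : set ('M[C]_n -> C) :=
  gen_alg [set f | (exists i j, f = entry i j) \/ f = fun g => (\det g)^-1].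

(** [C[G]]; such functions are only considered up to equality on [G]. *)
Definition regular_on n (G : set 'M[C]_n) (f : 'M[C]_n -> C) : Prop :=
  exists2 h, regular_GL h & forall g, G g -> f g = h g.

Definition zclosed_in n (G Y : set 'M[C]_n) : Prop :=
  exists2 E : set ('M[C]_n -> C), E `<=` regular_on G &
    Y = [set g | G g /\ forall f, E f -> f g = 0].

Definition GL n : set 'M[C]_n := [set g | g \in unitmx].

Definition is_subgroup n (G : set 'M[C]_n) : Prop :=
  [/\ G `<=` @GL n, G 1%:M, (forall g h, G g -> G h -> G (g *m h))
    & forall g, G g -> G (invmx g)].

Definition alg_group n (G : set 'M[C]_n) : Prop :=
  is_subgroup G /\ zclosed_in (@GL n) G.

Definition zconnected n (G : set 'M[C]_n) : Prop :=
  forall Y1 Y2, zclosed_in G Y1 -> zclosed_in G Y2 ->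
    Y1 `|` Y2 = G -> Y1 `&` Y2 = set0 -> Y1 = set0 \/ Y2 = set0.

(** A homomorphism is a total function of which only the values on the source
    group matter. *)
Definition alg_hom m n (G : set 'M[C]_m) (G' : set 'M[C]_n)
    (phi : 'M[C]_m -> 'M[C]_n) : Prop :=
  [/\ (forall g, G g -> G' (phi g)),
      (forall g h, G g -> G h -> phi (g *m h) = phi g *m phi h)
    & forall f, regular_on G' f -> regular_on G (f \o phi)].

Definition alg_iso m n (G : set 'M[C]_m) (G' : set 'M[C]_n)
    (phi : 'M[C]_m -> 'M[C]_n) : Prop :=
  alg_hom G G' phi /\
  exists psi, [/\ alg_hom G' G psi, (forall g, G g -> psi (phi g) = g)
                & forall h, G' h -> phi (psi h) = h].

Definition ker_on m n (G : set 'M[C]_m) (phi : 'M[C]_m -> 'M[C]_n) :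
  set 'M[C]_m := [set g | G g /\ phi g = 1%:M].

Definition diagonal_torus r : set 'M[C]_r :=
  [set g | g \in unitmx /\ is_diag_mx g].

Definition torus n (Z : set 'M[C]_n) : Prop :=
  alg_group Z /\ exists r phi, alg_iso (@diagonal_torus r) Z phi.

Definition subgroup_generated n (X : set 'M[C]_n) : set 'M[C]_n :=
  [set g | forall K, is_subgroup K -> X `<=` K -> K g].

Definition derived_subgroup n (G : set 'M[C]_n) : set 'M[C]_n :=
  subgroup_generated
    [set g *m h *m invmx g *m invmx h | g in G & h in G].

Definition solvable_group n (G : set 'M[C]_n) : Prop :=
  exists k, iter k (@derived_subgroup n) G = [set 1%:M].

Definition normal_in n (G K : set 'M[C]_n) : Prop :=
  K `<=` G /\ forall g k, G g -> K k -> K (g *m k *m invmx g).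

Definition semisimple n (G : set 'M[C]_n) : Prop :=
  [/\ alg_group G, zconnected G
    & forall K, alg_group K -> normal_in G K -> zconnected K ->
        solvable_group K -> K = [set 1%:M]].

(** Simple connectedness of a connected group: every isogeny from a connected
    group onto it is an isomorphism. *)
Definition simply_connected n (G : set 'M[C]_n) : Prop :=
  forall k (G' : set 'M[C]_k) (phi : 'M[C]_k -> 'M[C]_n),
    alg_group G' -> zconnected G' -> alg_hom G' G phi ->
    phi @` G' = G -> finite_set (ker_on G' phi) -> alg_iso G' G phi.

Definition prod_group m n (Z : set 'M[C]_m) (S : set 'M[C]_n) :
  set 'M[C]_(m + n) := [set block_mx z 0 0 s | z in Z & s in S].

Definition center n (G : set 'M[C]_n) : set 'M[C]_n :=
  [set z | G z /\ forall g, G g -> z *m g = g *m z].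

(** The identity is allowed as an involution. *)
Definition alg_involution n (G : set 'M[C]_n) (theta : 'M[C]_n -> 'M[C]_n) :
  Prop := alg_hom G G theta /\ forall g, G g -> theta (theta g) = g.

Definition fixed_group n (G : set 'M[C]_n) (theta : 'M[C]_n -> 'M[C]_n) :
  set 'M[C]_n := [set g | G g /\ theta g = g].

(** Point derivations of [C[G]] at the identity, that is, elements of the Lie
    algebra of [G]. *)
Definition point_derivation n (G : set 'M[C]_n)
    (delta : ('M[C]_n -> C) -> C) : Prop :=
  [/\ (forall f g, regular_on G f -> regular_on G g ->
         (forall x, G x -> f x = g x) -> delta f = delta g),
      (forall a f g, regular_on G f -> regular_on G g ->
         delta (fun x => a * f x + g x) = a * delta f + delta g)
    & (forall f g, regular_on G f -> regular_on G g ->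
         delta (fun x => f x * g x) =
         delta f * g 1%:M + f 1%:M * delta g)].

Definition linear_span (E : vectType C) (X : set E) : {vspace E} :=
  xget 0%VS [set U : {vspace E} | (forall x, X x -> x \in U) /\
    forall U' : {vspace E}, (forall x, X x -> x \in U') -> (U <= U')%VS].

(** The [(-1)]-eigenspace of [d theta] on the Lie algebra of [G]; a point
    derivation [delta] is identified with the matrix of its values on the
    coordinate functions, and [d theta] maps [delta] to
    [fun f => delta (f \o theta)]. The set of which the span is taken is
    already a linear subspace. *)
Definition minus_eigenspace n (G : set 'M[C]_n)
    (theta : 'M[C]_n -> 'M[C]_n) : {vspace 'M[C]_n} :=
  linear_span [set X : 'M[C]_n | exists delta,
    [/\ point_derivation G delta,
        (forall f, regular_on G f -> delta (f \o theta) = - delta f)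
      & forall i j, X i j = delta (entry i j)]].

Definition Ad n (g : 'M[C]_n) (X : 'M[C]_n) : 'M[C]_n := g *m X *m invmx g.

End AlgebraicGroups.

Section LinearActions.
Context {R : realType}.
Local Notation C := R[i].

(** Restriction of [f] to a subspace [U] that it preserves. *)
Definition restrict_to (E : vectType C) (U : {vspace E}) (f : E -> E) :
  subvs_of U -> subvs_of U := fun x => vsproj U (f (vsval x)).

Definition Ad_on n (U : {vspace 'M[C]_n}) (g : 'M[C]_n) :
  subvs_of U -> subvs_of U := restrict_to (Ad g).

(** The canonical stable model of [Q_L(U) = U / U^L] inside [U]: for reductive
    [L], the span of the [l u - u] is the only [L]-stable complement of
    [U^L]. *)
Definition Qspace (E : vectType C) (L : set (E -> E)) (U : {vspace E}) :
  {vspace E} :=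
  linear_span [set x | exists l u, [/\ L l, u \in U & x = l u - u]].

Definition coordfun (W : vectType C) (i : 'I_(\dim {:W})) (x : W) : C :=
  coord (vbasis {:W}) i x.

Definition polyfun (W : vectType C) : set (W -> C) :=
  gen_alg [set f | exists i, f = @coordfun W i].

Definition zclosed (W : vectType C) (Y : set W) : Prop :=
  exists2 E : set (W -> C), E `<=` @polyfun W &
    Y = [set x | forall f, E f -> f x = 0].

Definition invariants (W : vectType C) (L : set (W -> W)) : set (W -> C) :=
  [set f | polyfun f /\ forall l, L l -> f \o l = f].

(** The fibre of [W -> W // L = Spec C[W]^L] through the image of [0]: the image
    of [x] is the evaluation at [x] on [C[W]^L]. *)
Definition Gamma (W : vectType C) (L : set (W -> W)) : set W :=
  [set x | forall f, invariants L f -> f x = f 0].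

(** [R_L(W)], when [W = Q_L(W)]. *)
Definition Rset (W : vectType C) (L : set (W -> W)) : set W := ~` Gamma L.

Definition mul_set (T : Type) (X Y : set (T -> T)) : set (T -> T) :=
  [set f \o g | f in X & g in Y].

Definition left_coset (T : Type) (L : set (T -> T)) (j : T -> T) :
  set (T -> T) := mul_set [set j] L.

End LinearActions.

(** [X] is meant to be an open semialgebraic subset of [W], regarded as a real
    Nash manifold. The choice of a basis of [W] plays no role. *)
Section Schwartz.
Context {R : realType} {W : vectType R[i]}.
Local Notation C := R[i].
Implicit Types (X : set W) (f : W -> C).

Definition continuous_on X f : Prop :=
  forall x, X x -> forall e : C, 0 < e -> exists2 d : C, 0 < d &
    forall y, X y -> (forall i, `|coordfun i (y - x)| < d) -> `|f y - f x| < e.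

Definition real_derivable f (x v : W) : Prop :=
  derivable (fun t : R => complex.Re (f (x + t%:C *: v))) 0 1 /\
  derivable (fun t : R => complex.Im (f (x + t%:C *: v))) 0 1.

Definition real_derive (v : W) f : W -> C := fun x =>
  (derive1 (fun t : R => complex.Re (f (x + t%:C *: v))) 0) +i*
  (derive1 (fun t : R => complex.Im (f (x + t%:C *: v))) 0).

Definition smooth_on X f : Prop :=
  forall s : seq W, continuous_on X (foldr real_derive f s) /\
    forall x v, X x -> real_derivable (foldr real_derive f s) x v.

(** Semialgebraic subsets of [T], for the algebra of real polynomial functions
    generated by [gens]. *)
Inductive semialgebraic (T : Type) (gens : set (T -> R)) : set (set T) :=
| semialgebraic_pos u : gen_alg gens u -> semialgebraic gens [set x | 0 < u x]
| semialgebraic_setC A : semialgebraic gens A -> semialgebraic gens (~` A)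
| semialgebraic_setI A B : semialgebraic gens A -> semialgebraic gens B ->
    semialgebraic gens (A `&` B).

Definition graph_coords : set (W * R -> R) :=
  [set u | [\/ (exists i, u = fun p => complex.Re (coordfun i p.1)),
               (exists i, u = fun p => complex.Im (coordfun i p.1))
             | u = snd]].

Definition nash_on X (f : W -> R) : Prop :=
  smooth_on X (fun x => (f x)%:C) /\
  semialgebraic graph_coords [set p | X p.1 /\ p.2 = f p.1].

(** The algebra of Nash differential operators, generated by the Nash functions
    and the constant vector fields. *)
Inductive nash_diffop X : set ((W -> C) -> (W -> C)) :=
| nash_diffop_fun n : nash_on X n -> nash_diffop X (fun f x => (n x)%:C * f x)
| nash_diffop_field v : nash_diffop X (real_derive v)
| nash_diffop_add D E : nash_diffop X D -> nash_diffop X E ->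
    nash_diffop X (fun f x => D f x + E f x)
| nash_diffop_comp D E : nash_diffop X D -> nash_diffop X E ->
    nash_diffop X (D \o E).

(** Schwartz functions on [X], extended by zero outside [X]. *)
Definition schwartz X : set (W -> C) :=
  [set f | [/\ (forall x, ~ X x -> f x = 0), smooth_on X f
    & forall D, nash_diffop X D ->
        exists M : C, forall x, X x -> `|D f x| <= M]].

(** [S^*(X)]: linear functionals on Schwartz functions, continuous for the
    seminorms [sup_X |D f|]. Only the values on [schwartz X] matter. *)
Definition sdist X : set ((W -> C) -> C) :=
  [set T | (forall a f g, schwartz X f -> schwartz X g ->
              T (fun x => a * f x + g x) = a * T f + T g) /\
    exists (Ds : set ((W -> C) -> (W -> C))) (c : C),
      [/\ finite_set Ds, Ds `<=` nash_diffop X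
        & forall f M, schwartz X f -> 0 <= M ->
            (forall D x, Ds D -> X x -> `|D f x| <= M) -> `|T f| <= c * M]].

(** [j_* T = c T] on [X], where [(j_* T) f = T (f \o j)]. *)
Definition pushes_to X (j : W -> W) (c : C) (T : (W -> C) -> C) : Prop :=
  forall f, schwartz X f -> T (f \o j) = c * T f.

Definition sdist_inv X (K : set (W -> W)) : set ((W -> C) -> C) :=
  [set T | sdist X T /\ forall k, K k -> pushes_to X k 1 T].

Definition sdist_zero X (D : set ((W -> C) -> C)) : Prop :=
  forall T, D T -> forall f, schwartz X f -> T f = 0.

End Schwartz.

Section Regular.
Context {R : realType} {n : nat}.
Variables (G : set 'M[R[i]]_n) (theta : 'M[R[i]]_n -> 'M[R[i]]_n).

Let H := fixed_group G theta.
Let p := minus_eigenspace G theta.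
Let Hp : set (subvs_of p -> subvs_of p) := [set Ad_on g | g in H].

Definition preserves_closed_orbits (f : subvs_of p -> subvs_of p) : Prop :=
  forall x, let orbit := [set h x | h in Hp] in
    zclosed orbit -> f @` orbit = orbit.

Definition admissible (g : 'M[R[i]]_n) : Prop :=
  let gp : subvs_of p -> subvs_of p := Ad_on g in
  [/\ G g, center G (invmx g *m theta g),
      mul_set [set gp] Hp = mul_set Hp [set gp],
      Hp (gp \o gp) & preserves_closed_orbits gp].

Definition pair_Q : {vspace 'M[R[i]]_n} := Qspace [set Ad h | h in H] p.
Definition pair_HQ : set (subvs_of pair_Q -> subvs_of pair_Q) :=
  [set Ad_on h | h in H].

Definition regular_pair : Prop :=
  forall g, admissible g ->
    let X := Rset pair_HQ in
    sdist_inv X pair_HQ `<=` sdist_inv X [set Ad_on g] ->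
    sdist_inv setT pair_HQ `<=` sdist_inv setT [set Ad_on g].

End Regular.

Section Datum.
Context {R : realType} {n : nat}.
Variables (G : set 'M[R[i]]_n) (theta : 'M[R[i]]_n -> 'M[R[i]]_n).

Definition datum_V : {vspace 'M[R[i]]_n} := pair_Q G theta.
Local Notation V := datum_V.
Local Notation endoV := (subvs_of V -> subvs_of V).

Definition datum_L : set endoV := [set Ad_on h | h in fixed_group G theta].

Definition extended_fixed_group (F : set 'M[R[i]]_n) : set 'M[R[i]]_n :=
  [set g | G g /\ F (invmx g *m theta g)].

Definition datum_J : set endoV :=
  [set Ad_on g | g in extended_fixed_group (center G)].

(** [A = J / L], as the set of cosets [jL] with product [mul_set]. *)
Definition datum_A : set (set endoV) := [set left_coset datum_L j | j in datum_J].

Definition component_image (K : set 'M[R[i]]_n) : set (set endoV) :=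
  [set left_coset datum_L (Ad_on g) | g in K].

Definition datum_B0 : set (set endoV) :=
  component_image (fixed_group G theta).

Definition subgroup_of_A (B : set (set endoV)) : Prop :=
  [/\ B `<=` datum_A, B datum_L,
      (forall a b, B a -> B b -> B (mul_set a b))
    & forall a, B a -> exists2 b, B b & mul_set a b = datum_L].

Definition character_of_A (lam : set endoV -> R[i]) : Prop :=
  lam datum_L = 1 /\
  forall a b, datum_A a -> datum_A b -> lam (mul_set a b) = lam a * lam b.

Definition nontrivial_character (lam : set endoV -> R[i]) : Prop :=
  exists2 a, datum_A a & lam a != 1.

Definition sdist_char (X : set (subvs_of V)) (lam : set endoV -> R[i]) :
  set ((subvs_of V -> R[i]) -> R[i]) :=
  [set T | sdist_inv X datum_L T /\
    forall j, datum_J j -> pushes_to X j (lam (left_coset datum_L j)) T].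

(** Since [V^L = 0], [Q_L(V)] is the whole of [V]. *)
Definition componentwise_regular : Prop :=
  forall lam, character_of_A lam -> nontrivial_character lam ->
    (forall b, datum_B0 b -> lam b = 1) ->
    sdist_zero (Rset datum_L) (sdist_char (Rset datum_L) lam) ->
    sdist_zero setT (sdist_char setT lam).

Definition J_of (B : set (set endoV)) : set endoV :=
  [set j | datum_J j /\ B (left_coset datum_L j)].

Definition sdist_LB (X : set (subvs_of V)) (B : set (set endoV)) :
  set ((subvs_of V -> R[i]) -> R[i]) :=
  sdist_inv X datum_L `&` sdist_inv X (J_of B).

(** [S^*(X)^a]; for [L]-invariant distributions the choice of the
    representative [j] is immaterial. *)
Definition sdist_comp (X : set (subvs_of V)) (a : set endoV) :
  set ((subvs_of V -> R[i]) -> R[i]) :=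
  [set T | exists2 j, a j & sdist_inv X [set j] T].

(** [G'] with [theta'] and the projection [q] is the quotient of [(G, theta)] by
    the finite [theta]-stable central subgroup [F]. The condition on [f \o q]
    says that the regular functions on [G'] are exactly the [F]-invariant ones on [G]. *)
Definition central_quotient (F : set 'M[R[i]]_n) k (G' : set 'M[R[i]]_k)
    (theta' : 'M[R[i]]_k -> 'M[R[i]]_k) (q : 'M[R[i]]_n -> 'M[R[i]]_k) : Prop :=
  [/\ is_subgroup F, finite_set F, F `<=` center G
    & forall z, F z -> F (theta z)] /\
  [/\ alg_group G', alg_hom G G' q, q @` G = G', ker_on G q = F
    & forall f, regular_on G' f <-> regular_on G (f \o q)] /\
  forall g, G g -> theta' (q g) = q (theta g).

End Datum.

Arguments component_image {R n} G theta K.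
Arguments datum_L {R n} G theta _.
Arguments datum_J {R n} G theta _.
Arguments datum_A {R n} G theta _.
Arguments datum_B0 {R n} G theta _.
Arguments subgroup_of_A {R n} G theta B.
Arguments sdist_LB {R n} G theta X B.
Arguments sdist_comp {R n} G theta X a.

(* Main.v *)
Require Import Defs.
From HB Require Import structures.
From mathcomp Require Import all_boot all_order all_algebra.
From mathcomp Require Import complex perm.
From mathcomp Require Import all_classical all_reals all_analysis.
From mathcomp Require Import ring.
Import Order.TTheory GRing.Theory Num.Theory.
Import numFieldNormedType.Exports.

Set Implicit Arguments.
Unset Strict Implicit.
Unset Printing Implicit Defensive.

Local Open Scope classical_set_scope.
Local Open Scope ring_scope.

(** Let [d g = g^-1 theta g]. On the extended fixed group [d] is a homomorphism to
    the centre whose kernel is the fixed group, and [g g d(g)] is fixed; as the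
    centre acts trivially, [J / L] is an elementary abelian 2-group ([ext_sqr],
    [J_comm], [J_sqr]). It is finite, since the centre is the product of a torus,
    where every element has square roots but only finitely many, and of the
    finite centre of the semisimple factor ([finite_components]).

    First half. Suppose that [T] on [V] is invariant under [L] and under the
    components in [B] but is moved by the component [a]. Since components square
    into [L], one can project [T - a T] successively onto eigenspaces of all the
    components without killing it. The result is a nonzero distribution that
    transforms by a character [lam] with [lam a = -1] and [lam = 1] on [B]
    ([eigendistribution]). Componentwise regularity provides a nonzero
    distribution on [R_L(V)] with the same character. It is invariant under the
    components in [B], so by assumption under [a], where it changes sign: a
    contradiction ([component_regularity]).

    Second half. An admissible element of [G' = G / F] lifts to an element of the
    extended fixed group of [G], as only central elements of [G] become central in
    [G'] ([prod_central_lift]). So the first half applies once [Q] and [R] of the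
    pair [(G', H')] are identified with those of the datum ([regular_quotient]).
    The differential of [G -> G'] is bijective because the regular functions on
    [G] are étale over the invariants of [F] ([tangent_quotient_inj],
    [tangent_quotient_lift]). But [H'] is the image of a group that may have more
    components than the fixed group [H] of [G], which might change both [Q] and
    the null cone. The null cone does not change because there are finitely many
    components ([Gamma_components]). For [Q] one needs that the extended fixed
    group acts trivially on [p / V] ([Ad_ext_sub_V]). With [h + p] the
    decomposition of the Lie algebra of [G], a linear form on [p / V] kills
    [[h, p]], because the Lie algebra elements fixed by [theta] are tangent to the
    fixed group ([derivation_fixed_group], by integrating the vector field); hence,
    extended by zero to [h], it is invariant under the Lie algebra of [G], and
    so under [G], which acts through a connected group ([zconnected_constant], by
    Krull's intersection theorem). An extended fixed element preserves [p], on
    which the two forms agree. *)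

(** * Regular functions on matrix groups *)
Section GenAlg.
Context {K : comNzRingType} {T : Type}.
Implicit Types (gens : set (T -> K)) (f g : T -> K).

Lemma gen_alg_opp gens f : gen_alg gens f -> gen_alg gens (fun x => - f x).
Proof.
move=> hf; have := gen_alg_mul (gen_alg_cst gens (- 1)) hf.
by congr gen_alg; apply/funext => x; rewrite mulN1r.
Qed.

Lemma gen_alg_sum gens I (r : seq I) (F : I -> T -> K) :
  (forall i, gen_alg gens (F i)) -> gen_alg gens (fun x => \sum_(i <- r) F i x).
Proof.
move=> hF; elim: r => [|i r ih].
  by under [X in gen_alg _ X]funext do rewrite big_nil; exact: gen_alg_cst.
by under [X in gen_alg _ X]funext do rewrite big_cons; exact: gen_alg_add.
Qed.

Lemma gen_alg_prod gens I (r : seq I) (F : I -> T -> K) :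
  (forall i, gen_alg gens (F i)) -> gen_alg gens (fun x => \prod_(i <- r) F i x).
Proof.
move=> hF; elim: r => [|i r ih].
  by under [X in gen_alg _ X]funext do rewrite big_nil; exact: gen_alg_cst.
by under [X in gen_alg _ X]funext do rewrite big_cons; exact: gen_alg_mul.
Qed.

Lemma gen_alg_comp T' gens (gens' : set (T' -> K)) (u : T' -> T) :
  (forall f, gens f -> gen_alg gens' (f \o u)) ->
  forall f, gen_alg gens f -> gen_alg gens' (f \o u).
Proof.
move=> hu f; elim=> {f} [f /hu //|c|f g _ hf _ hg|f g _ hf _ hg].
- exact: gen_alg_cst.
- exact: gen_alg_add hf hg.
- exact: gen_alg_mul hf hg.
Qed.

End GenAlg.

Section RegularFunctions.
Context {R : realType}.
Local Notation C := R[i].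

Section FixedSize.
Context {n : nat}.
Implicit Types (G : set 'M[C]_n) (f : 'M[C]_n -> C).

Lemma regular_GL_entry i j : regular_GL (@entry R n i j).
Proof. by apply: gen_alg_gen; left; exists i, j. Qed.

Lemma regular_GL_invdet : regular_GL (fun g : 'M[C]_n => (\det g)^-1).
Proof. by apply: gen_alg_gen; right. Qed.

Lemma gen_alg_det (T : Type) (gens : set (T -> C)) k (A : T -> 'M[C]_k) :
  (forall i j, gen_alg gens (fun g => A g i j)) -> gen_alg gens (fun g => \det (A g)).
Proof.
move=> hA; rewrite /determinant.
apply: (gen_alg_sum _ (F := fun (s : 'S_k) g =>
  (-1) ^+ s * \prod_i A g i (s i))) => s.
apply: gen_alg_mul; first exact: gen_alg_cst.
by apply: (gen_alg_prod _ (F := fun i g => A g i (s i))) => i; exact: hA.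
Qed.

Lemma regular_GL_detid : regular_GL (fun g : 'M[C]_n => \det g).
Proof. by apply: gen_alg_det => i j; exact: regular_GL_entry. Qed.

Lemma regular_onE G f h : regular_GL h -> (forall g, G g -> f g = h g) ->
  regular_on G f.
Proof. by move=> hh e; exists h. Qed.

Lemma regular_on_GL G f : regular_GL f -> regular_on G f.
Proof. by move=> hf; exists f. Qed.

Lemma regular_on_ext G f g : (forall x, G x -> f x = g x) ->
  regular_on G g -> regular_on G f.
Proof. by move=> e [h hh eh]; exists h => // x Gx; rewrite e // eh. Qed.

Lemma regular_on_cst G c : regular_on G (fun=> c).
Proof. by apply: regular_on_GL; exact: gen_alg_cst. Qed.

Lemma regular_on_entry G i j : regular_on G (entry i j).
Proof. exact/regular_on_GL/regular_GL_entry. Qed.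

Lemma regular_on_add G f g : regular_on G f -> regular_on G g ->
  regular_on G (fun x => f x + g x).
Proof.
move=> [h hh eh] [k hk ek]; exists (fun x => h x + k x).
  exact: gen_alg_add.
by move=> x Gx; rewrite eh // ek.
Qed.

Lemma regular_on_mul G f g : regular_on G f -> regular_on G g ->
  regular_on G (fun x => f x * g x).
Proof.
move=> [h hh eh] [k hk ek]; exists (fun x => h x * k x).
  exact: gen_alg_mul.
by move=> x Gx; rewrite eh // ek.
Qed.

Lemma regular_on_scale G c f : regular_on G f -> regular_on G (fun x => c * f x).
Proof. by move=> hf; apply: regular_on_mul => //; exact: regular_on_cst. Qed.

Lemma regular_on_opp G f : regular_on G f -> regular_on G (fun x => - f x).
Proof.
move=> hf; apply: regular_on_ext (regular_on_scale (-1) hf) => x _.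
by rewrite mulN1r.
Qed.

Lemma regular_on_sub G f g : regular_on G f -> regular_on G g ->
  regular_on G (fun x => f x - g x).
Proof. by move=> hf hg; apply: regular_on_add => //; exact: regular_on_opp. Qed.

Lemma regular_on_sum G I (r : seq I) (F : I -> 'M[C]_n -> C) :
  (forall i, regular_on G (F i)) -> regular_on G (fun x => \sum_(i <- r) F i x).
Proof.
move=> hF; elim: r => [|i r ih].
  by under [X in regular_on _ X]funext do rewrite big_nil; exact: regular_on_cst.
by under [X in regular_on _ X]funext do rewrite big_cons; exact: regular_on_add.
Qed.

Lemma regular_on_inv G i j : G `<=` @GL R n ->
  regular_on G (fun g => invmx g i j).
Proof.
move=> GU; apply: (@regular_onE _ _
    (fun g => (\det g)^-1 * ((-1) ^+ (j + i) * \det (row' j (col' i g))))).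
  apply: gen_alg_mul; first exact: regular_GL_invdet.
  apply: gen_alg_mul; first exact: gen_alg_cst.
  apply: (gen_alg_det (A := fun g : 'M[C]_n => row' j (col' i g))) => k l.
  suff -> : (fun g : 'M[C]_n => row' j (col' i g) k l) =
            entry (lift j k) (lift i l) by exact: regular_GL_entry.
  by apply/funext => g; rewrite !mxE.
by move=> g /GU; rewrite /GL /= => gu; rewrite /invmx gu !mxE.
Qed.

(** The comultiplication of [C[GL_n]]. *)
Lemma regular_GL_mul f : regular_GL f -> exists (I : finType) (a b : I -> 'M[C]_n -> C),
  [/\ forall i, regular_GL (a i), forall i, regular_GL (b i)
    & forall g h, f (g *m h) = \sum_i a i g * b i h].
Proof.
elim=> {f} [f|c|f g _ [I [a [b [ha hb ef]]]] _ [J [a' [b' [ha' hb' eg]]]]|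
            f g _ [I [a [b [ha hb ef]]]] _ [J [a' [b' [ha' hb' eg]]]]].
- case=> [[i [j ->]]|->].
    exists 'I_n, (fun k => entry i k), (fun k => entry k j); split.
    + by move=> k; exact: regular_GL_entry.
    + by move=> k; exact: regular_GL_entry.
    + by move=> g h; rewrite /entry mxE.
  exists unit, (fun _ g => (\det g)^-1), (fun _ g => (\det g)^-1); split.
  + by move=> _; exact: regular_GL_invdet.
  + by move=> _; exact: regular_GL_invdet.
  + by move=> g h; rewrite det_mulmx invfM big_const card_unit /= addr0.
- exists unit, (fun _ _ => c), (fun _ _ => 1); split.
  + by move=> _; apply: gen_alg_cst.
  + by move=> _; apply: gen_alg_cst.
  + by move=> g h; rewrite big_const card_unit /= addr0 mulr1.
- exists (I + J)%type, (fun k => match k with inl i => a i | inr j => a' j end),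
    (fun k => match k with inl i => b i | inr j => b' j end); split.
  + by case.
  + by case.
  + by move=> x y; rewrite big_sumType /= ef eg.
- exists (I * J)%type, (fun k g => a k.1 g * a' k.2 g),
    (fun k g => b k.1 g * b' k.2 g); split.
  + by move=> k; exact: gen_alg_mul (ha _) (ha' _).
  + by move=> k; exact: gen_alg_mul (hb _) (hb' _).
  + move=> x y; rewrite ef eg big_distrlr /= pair_big /=.
    by apply: eq_bigr => -[i j] _ /=; rewrite mulrACA.
Qed.

End FixedSize.

(** [C[GL_n]] is generated by the entries and the inverse of the determinant. *)
Lemma regular_on_comp k n (G : set 'M[C]_k) (G' : set 'M[C]_n)
    (u : 'M[C]_k -> 'M[C]_n) f :
  (forall g, G g -> G' (u g)) ->
  (forall i j, regular_on G (fun g => u g i j)) ->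
  regular_on G (fun g => (\det (u g))^-1) ->
  regular_on G' f -> regular_on G (f \o u).
Proof.
move=> uG ue ud [h hh eh].
suff rhu : regular_on G (h \o u).
  by apply: (regular_on_ext _ rhu) => g /uG /eh.
rewrite /comp.
elim: hh => {eh h} [h|c|h h' _ rh _ rh'|h h' _ rh _ rh'].
- case=> [[i [j ->]]|->]; [exact: ue|exact: ud].
- exact: regular_on_cst.
- exact: regular_on_add.
- exact: regular_on_mul.
Qed.

Section Subgroup.
Context {n : nat} (G : set 'M[C]_n) (sG : is_subgroup G).
Implicit Types (f : 'M[C]_n -> C) (g h x : 'M[C]_n).

Lemma subgroup_unit g : G g -> g \in unitmx.
Proof. by case: sG => GU _ _ _ /GU. Qed.

Lemma subgroup1 : G 1%:M. Proof. by case: sG. Qed.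

Lemma subgroupM g h : G g -> G h -> G (g *m h).
Proof. by case: sG => _ _ + _; apply. Qed.

Lemma subgroupV g : G g -> G (invmx g).
Proof. by case: sG => _ _ _; apply. Qed.

Lemma regular_on_mull f g : G g -> regular_on G f ->
  regular_on G (fun h => f (g *m h)).
Proof.
move=> Gg; apply: regular_on_comp.
- by move=> h; exact: subgroupM.
- move=> i j; apply: regular_on_ext (_ : regular_on G
    (fun h => \sum_k g i k * h k j)) => [h _|]; first by rewrite mxE.
  by apply: regular_on_sum => k; apply: regular_on_scale; exact: regular_on_entry.
- apply: regular_on_ext (_ : regular_on G (fun h => (\det g)^-1 * (\det h)^-1)).
    by move=> h _; rewrite det_mulmx invfM.
  apply: regular_on_scale; apply: regular_on_GL; exact: regular_GL_invdet.
Qed.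

Lemma regular_on_mulr f g : G g -> regular_on G f ->
  regular_on G (fun h => f (h *m g)).
Proof.
move=> Gg; apply: regular_on_comp.
- by move=> h Gh; exact: subgroupM.
- move=> i j; apply: regular_on_ext (_ : regular_on G
    (fun h => \sum_k g k j * h i k)) => [h _|].
    by rewrite mxE; apply: eq_bigr => k _; rewrite mulrC.
  by apply: regular_on_sum => k; apply: regular_on_scale; exact: regular_on_entry.
- apply: regular_on_ext (_ : regular_on G (fun h => (\det g)^-1 * (\det h)^-1)).
    by move=> h _; rewrite det_mulmx invfM mulrC.
  apply: regular_on_scale; apply: regular_on_GL; exact: regular_GL_invdet.
Qed.

End Subgroup.

Section LinearSpan.
Context {E : vectType C}.
Implicit Types (X : set E) (U : {vspace E}).

(** A subspace of maximal dimension among those inside a linear subset is all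
    of this subset. *)
Lemma vspace_of_linear (P : set E) : P 0 ->
  (forall a x y, P x -> P y -> P (a *: x + y)) ->
  exists U : {vspace E}, forall x, x \in U <-> P x.
Proof.
move=> P0 Plin.
pose Q (d : nat) := `[< exists2 U : {vspace E}, \dim U = d & forall x, x \in U -> P x >].
have Q0 : exists d, Q d.
  exists 0%N; apply/asboolP; exists 0%VS; first exact: dimv0.
  by move=> x; rewrite memv0 => /eqP->.
have Qub d : Q d -> (d <= \dim {:E})%N.
  by move=> /asboolP[U <- _]; apply: dimvS; exact: subvf.
have [d /asboolP[U dU UP] dmax] := ex_maxnP Q0 Qub.
exists U => x; split; first exact: UP.
move=> Px; pose U' := (<[x]> + U)%VS.
have UU' : (U <= U')%VS by exact: addvSr.
have Qd : Q (\dim U').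
  apply/asboolP; exists U' => // y /memv_addP[x1 /vlineP[a ->] [x2 Ux2 ->]].
  by apply: Plin => //; exact: UP.
have /eqP -> : U == U' by rewrite eqEdim UU' dU dmax.
by apply: (subvP (addvSl _ _)); exact: memv_line.
Qed.

Lemma linear_spanP X : (forall x, X x -> x \in linear_span X) /\
  forall U, (forall x, X x -> x \in U) -> (linear_span X <= U)%VS.
Proof.
have [U [XU Umin]] : exists U : {vspace E}, (forall x, X x -> x \in U) /\
    forall U' : {vspace E}, (forall x, X x -> x \in U') -> (U <= U')%VS.
  have [||U HU] := @vspace_of_linear
      [set x | forall U' : {vspace E}, (forall x, X x -> x \in U') -> x \in U'].
  - by move=> U' _; exact: mem0v.
  - by move=> a x y hx hy U' XU'; rewrite memvD ?memvZ ?hx ?hy.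
  exists U; split; first by move=> x Xx; apply/HU => U'; exact.
  by move=> U' XU'; apply/subvP => x /HU; exact.
by rewrite /linear_span; case: xgetP => [y _ //|/(_ U)]; case.
Qed.

Lemma mem_linear_span X x : X x -> x \in linear_span X.
Proof. exact: (linear_spanP X).1. Qed.

Lemma linear_span_ind X (P : set E) : P 0 ->
  (forall a x y, P x -> P y -> P (a *: x + y)) -> X `<=` P ->
  forall x, x \in linear_span X -> P x.
Proof.
move=> P0 Plin XP x; have [U HU] := vspace_of_linear P0 Plin.
by move=> /(subvP ((linear_spanP X).2 U _)) /HU; apply => y /XP /HU.
Qed.

End LinearSpan.
End RegularFunctions.

(** * Noetherian rings and Krull's intersection theorem *)
Section Noetherian.

(** Phrased for a sequence of elements: the ideals generated by its initial
    segments do not all grow. *)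
Definition noetherian (A : comNzRingType) : Prop :=
  forall u : nat -> A, exists N (s : nat -> A), u N = \sum_(i < N) s i * u i.

Lemma noetherian_field (F : fieldType) : noetherian F.
Proof.
move=> u; have [u0|u0] := eqVneq (u 0%N) 0.
  by exists 0%N, (fun=> 0); rewrite u0 big_ord0.
by exists 1%N, (fun=> u 1%N / u 0%N); rewrite big_ord1 divfK.
Qed.

Section Hilbert.
Variables (A : comNzRingType) (noethA : noetherian A).

Definition in_ideal (l : seq {poly A}) (p : {poly A}) : Prop :=
  exists s : nat -> {poly A}, p = \sum_(i < size l) s i * l`_i.

Lemma in_ideal_add l p q : in_ideal l p -> in_ideal l q -> in_ideal l (p + q).
Proof.
move=> [s ->] [s' ->]; exists (fun i => s i + s' i).
by rewrite -big_split; apply: eq_bigr => i _; rewrite mulrDl.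
Qed.

Lemma in_ideal_mul l r p : in_ideal l p -> in_ideal l (r * p).
Proof.
move=> [s ->]; exists (fun i => r * s i).
by rewrite mulr_sumr; apply: eq_bigr => i _; rewrite mulrA.
Qed.

Lemma in_ideal0 l : in_ideal l 0.
Proof. by exists (fun=> 0); rewrite big1 // => i _; rewrite mul0r. Qed.

Lemma in_ideal_sum l n (F : 'I_n -> {poly A}) :
  (forall i, in_ideal l (F i)) -> in_ideal l (\sum_i F i).
Proof.
move=> hF; elim/big_ind: _ => //; first exact: in_ideal0.
exact: in_ideal_add.
Qed.

Lemma in_ideal_nth l i : (i < size l)%N -> in_ideal l l`_i.
Proof.
move=> il; exists (fun j => (j == i)%:R).
rewrite (bigD1 (Ordinal il)) //= eqxx mul1r big1 ?addr0 // => j /negbTE ji.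
by rewrite -val_eqE /= in ji; rewrite ji mul0r.
Qed.

Lemma in_ideal_sub l l' p :
  (forall i, (i < size l)%N -> in_ideal l' l`_i) -> in_ideal l p -> in_ideal l' p.
Proof.
by move=> ll' [s ->]; apply: in_ideal_sum => i; apply/in_ideal_mul/ll'.
Qed.

(** Hilbert's basis theorem: an ideal that is not finitely generated would
    contain a sequence of elements, each of least degree outside the ideal of
    the previous ones; their leading coefficients contradict the hypothesis. *)
Lemma noetherian_poly : noetherian {poly A}.
Proof.
move=> u; apply: contrapT => /forallNP hN.
pose I p := exists N, in_ideal (mkseq u N) p.
have Imono N N' p : (N <= N')%N -> in_ideal (mkseq u N) p ->
    in_ideal (mkseq u N') p.
  move=> NN'; apply: in_ideal_sub => i; rewrite size_mkseq => iN.
  have iN' : (i < N')%N by exact: leq_trans NN'.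
  rewrite nth_mkseq // -(nth_mkseq 0 u iN'); apply: in_ideal_nth.
  by rewrite size_mkseq.
have Iadd p q : I p -> I q -> I (p + q).
  move=> [N hp] [N' hq]; exists (maxn N N').
  by apply: in_ideal_add; [apply: Imono hp|apply: Imono hq];
    rewrite ?leq_maxl ?leq_maxr.
have Imul r p : I p -> I (r * p) by move=> [N hp]; exists N; exact: in_ideal_mul.
have Isum n (F : 'I_n -> {poly A}) : (forall i, I (F i)) -> I (\sum_i F i).
  move=> hF; elim/big_ind: _ => //; by [exists 0%N; exact: in_ideal0].
have Iu N : I (u N).
  exists N.+1; rewrite -[u N](nth_mkseq 0 u (ltnSn N)).
  by apply: in_ideal_nth; rewrite size_mkseq.
pose Q l p := I p /\ ~ in_ideal l p.
pose step l : {poly A} := xget 0 [set p | Q l p /\ forall q, Q l q -> (size p <= size q)%N].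
have stepP l : (forall i, (i < size l)%N -> I l`_i) ->
    Q l (step l) /\ forall q, Q l q -> (size (step l) <= size q)%N.
  move=> lI.
  have [N hNl] : exists N, forall i, (i < size l)%N -> in_ideal (mkseq u N) l`_i.
    elim/last_ind: l lI => [_|l p ih lI]; first by exists 0%N.
    have [i il|N hNp] := ih.
      have := lI i; rewrite size_rcons nth_rcons il; apply; exact: leqW.
    have [|N' hN'] := lI (size l); first by rewrite size_rcons.
    exists (maxn N N') => i; rewrite size_rcons ltnS leq_eqVlt => /orP[/eqP->|il].
      by apply: Imono hN'; exact: leq_maxr.
    by rewrite nth_rcons il; apply: Imono (hNp _ il); exact: leq_maxl.
  have ex : exists d, `[< exists2 p, Q l p & size p = d >].
    exists (size (u N)); apply/asboolP; exists (u N) => //; split => // ul.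
    have [s es] := in_ideal_sub hNl ul.
    apply: (hN N); exists s; rewrite es size_mkseq; apply: eq_bigr => i _.
    by rewrite nth_mkseq.
  case: (ex_minnP ex) => d /asboolP[p Qp pd] dmin.
  rewrite /step; case: xgetP => [q _ []//|/(_ p) []].
  split=> // q Qq; rewrite pd; apply: dmin; apply/asboolP; by exists q.
pose F k := iter k (fun l => rcons l (step l)) [::].
have sF k : size (F k) = k by elim: k => //= k ih; rewrite size_rcons ih.
pose f k : {poly A} := step (F k).
have nF k i : (i < k)%N -> (F k)`_i = f i.
  elim: k => // k ih; rewrite ltnS leq_eqVlt /= nth_rcons sF.
  by move=> /orP[/eqP ->|ik]; rewrite ?ltnn ?eqxx // ik ih.
have FI k : forall i, (i < size (F k))%N -> I (F k)`_i.
  elim: k => // k ih i; rewrite sF ltnS leq_eqVlt => /orP[/eqP->|ik].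
    by rewrite nF //; have [[]] := stepP _ ih.
  by rewrite nF 1?ltnW // -(nF k) //; apply: ih; rewrite sF.
have fP k := stepP _ (FI k).
have [N [s es]] := noethA (fun k => lead_coef (f k)).
(* Then [f N] minus a combination [g] of the previous [f i] has smaller degree,
   against the choice of [f N]. *)
have [[IfN nfN] minN] := fP N.
have fN0 : f N != 0.
  by apply/eqP => f0; apply: nfN; rewrite -/(f N) f0; exact: in_ideal0.
have sle (i : 'I_N) : (size (f i) <= size (f N))%N.
  apply: (fP i).2; split => // FiN; apply: nfN; apply: in_ideal_sub FiN => j.
  rewrite sF => ji; have jN : (j < N)%N := ltn_trans ji (ltn_ord i).
  by rewrite nF // -(nF N) //; apply: in_ideal_nth; rewrite sF.
have f0 i : f i != 0.
  by apply/eqP => f0; apply: (fP i).1.2; rewrite -/(f i) f0; exact: in_ideal0.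
pose g : {poly A} := \sum_(i < N) (s i *: 'X^(size (f N) - size (f i))) * f i.
have := minN (f N - g); rewrite -/(f N).
suff [Qg sg] : Q (F N) (f N - g) /\ (size (f N - g)%R < size (f N))%N.
  by move=> h; have := h Qg; rewrite leqNgt sg.
have gF : in_ideal (F N) g.
  apply: in_ideal_sum => i; apply: in_ideal_mul.
  by rewrite -(nF N) //; apply: in_ideal_nth; rewrite sF.
split; first split.
- apply: Iadd => //; rewrite -mulN1r; apply: (Imul); apply: (Isum) => i; apply: (Imul).
  by have [[]] := fP i.
- by move=> /in_ideal_add /(_ gF); rewrite subrK.
have sfN : (0 < size (f N))%N by rewrite size_poly_gt0.
rewrite -(prednK sfN) ltnS; apply/leq_sizeP => j hj.
rewrite coefB coef_sum.
have ec (i : 'I_N) : ((s i *: 'X^(size (f N) - size (f i))) * f i)`_j =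
    s i * (f i)`_(j - (size (f N) - size (f i))).
  rewrite -scalerAl coefZ coefXnM ifF //.
  apply/negbTE; rewrite -leqNgt (leq_trans _ hj) // -subn1 leq_sub2l //.
  by rewrite size_poly_gt0.
rewrite (eq_bigr _ (fun i _ => ec i)).
have [jlt|jge] := ltnP j (size (f N)).
  have ej : j = (size (f N)).-1.
    by apply/eqP; rewrite eqn_leq hj -ltnS prednK // jlt.
  have -> : (f N)`_j = lead_coef (f N) by rewrite ej lead_coefE.
  rewrite es; apply/eqP; rewrite subr_eq0; apply/eqP; apply: eq_bigr => i _.
  rewrite lead_coefE ej; congr (_ * _`_ _).
  have si : (0 < size (f i))%N by rewrite size_poly_gt0.
  by have := sle i; move: si sfN; case: (size (f i)) => // a; case: (size (f N)) => // b _ _;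
    rewrite ltnS subSS /= => ab; rewrite subKn.
rewrite nth_default // big1 ?subrr // => i _.
rewrite nth_default ?mulr0 //.
have := sle i; move: (size (f i)) (size (f N)) jge => a b bj ab.
by rewrite leq_subRL ?subnK // (leq_trans (leq_subr _ _)).
Qed.

End Hilbert.

(** A finitely generated algebra of functions is the image of a Noetherian ring,
    hence ascending chains of its ideals are stationary. *)
Lemma gen_alg_noetherian (K : fieldType) (T : Type) (l : seq (T -> K))
    (u : nat -> T -> K) :
  let gens := [set f | List.In f l] in
  (forall k, gen_alg gens (u k)) ->
  exists N (s : nat -> T -> K), (forall i, gen_alg gens (s i)) /\
    forall x, u N x = \sum_(i < N) s i x * u i x.
Proof.
move=> gens.
have [A [nA [phi [phig phic phiA]]]] : exists A : comNzRingType, noetherian A /\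
  exists phi : T -> {rmorphism A -> K},
   [/\ forall f, List.In f l -> exists a, forall x, phi x a = f x,
      forall c, exists a, forall x, phi x a = c
    & forall a, gen_alg gens (fun x => phi x a)].
  rewrite {}/gens; elim: l => [|y l [A [nA [phi [phig phic phiA]]]]].
    exists K; split; first exact: noetherian_field.
    exists (fun=> idfun : {rmorphism K -> K}); split=> // [c|a]; first by exists c.
    exact: gen_alg_cst.
  exists {poly A}; split; first exact: noetherian_poly.
  exists (fun x => (horner_eval (y x) \o map_poly (phi x)) :
     {rmorphism {poly A} -> K}).
  split.
  - move=> f /= [<-|/phig [a ha]].
      by exists 'X => x /=; rewrite map_polyX horner_evalE hornerX.
    exists a%:P => x; rewrite /= map_polyC horner_evalE hornerC; exact: ha.
  - move=> c; have [a ha] := phic c.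
    exists a%:P => x; rewrite /= map_polyC horner_evalE hornerC.
    exact: ha.
  - move=> p.
    have lift f : gen_alg [set f | List.In f l] f ->
        gen_alg [set f | List.In f (y :: l)] f.
      apply: (gen_alg_comp (u := id)) => g gl; apply: gen_alg_gen; by right.
    have -> : (fun x => (horner_eval (y x) \o map_poly (phi x)) p) =
        (fun x => \sum_(i < size p) phi x p`_i * y x ^+ i).
      apply/funext => x /=; rewrite horner_evalE horner_poly.
      by [].
    apply: gen_alg_sum => i; apply: gen_alg_mul; first exact/lift/phiA.
    elim: (val i) => [|k ih].
      by under [X in gen_alg _ X]funext do rewrite expr0; exact: gen_alg_cst.
    under [X in gen_alg _ X]funext do rewrite exprS.
    by apply: gen_alg_mul ih; apply: gen_alg_gen; left.
move=> hu.
have surj f : gen_alg gens f -> exists a, forall x, phi x a = f x.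
  elim=> {f} [f /phig//|//|f g _ [a ha] _ [b hb]|f g _ [a ha] _ [b hb]].
    by exists (a + b) => x; rewrite rmorphD ha hb.
  by exists (a * b) => x; rewrite rmorphM ha hb.
have [a ha] := choice (fun k => surj _ (hu k)).
have [N [s es]] := nA a.
exists N, (fun i x => phi x (s i)); split=> // x.
by rewrite -ha es rmorph_sum; apply: eq_bigr => i _; rewrite rmorphM ha.
Qed.

End Noetherian.

Section Krull.
Variables (K : numFieldType) (T : Type) (x0 : T) (l : seq (T -> K)).
Let gens := [set f | List.In f l].
Hypothesis gens0 : forall f, gens f -> f x0 = 0.

(** Powers of the maximal ideal of [x0] in the algebra generated by [l]. *)
Inductive max_pow : nat -> set (T -> K) :=
| max_pow0 f : gen_alg gens f -> max_pow 0 f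
| max_powS k f g : gen_alg gens f -> f x0 = 0 -> max_pow k g ->
    max_pow k.+1 (fun x => f x * g x)
| max_pow_add k f g : max_pow k f -> max_pow k g -> max_pow k (fun x => f x + g x).

Lemma poly_all_roots (p : {poly K}) : (forall t, p.[t] = 0) -> p = 0.
Proof.
move=> hp; apply/eqP; apply: contraT => p0.
have := max_poly_roots (rs := [seq i%:R : K | i <- iota 0 (size p)]) p0.
rewrite size_map size_iota ltnn; apply.
  by apply/allP => t _; rewrite rootE hp.
rewrite map_inj_uniq ?iota_uniq // => i j /eqP.
by rewrite eqr_nat => /eqP.
Qed.

(** Krull's intersection theorem, read off from the Rees algebra of the maximal
    ideal of [x0], which is Noetherian and contains all the [f * t ^+ k]. It is
    generated, as an algebra of functions on [T * K], by the [y] and the [y * t]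
    for [y] in [l]. *)
Lemma krull_intersection f : (forall k, max_pow k f) ->
  exists e, [/\ gen_alg gens e, e x0 = 0 & forall x, f x = e x * f x].
Proof.
move=> hf.
pose lR := [seq (fun p : T * K => y p.1) | y <- l] ++
           [seq (fun p : T * K => y p.1 * p.2) | y <- l].
pose gR := [set f | List.In f lR].
have liftR g : gen_alg gens g -> gen_alg gR (fun p : T * K => g p.1).
  apply: (gen_alg_comp (u := fst)) => y yl; apply: gen_alg_gen.
  by apply/List.in_app_iff; left; exact: (List.in_map (fun y p => y p.1)).
have liftRt g : gen_alg gens g -> gen_alg gR (fun p => (g p.1 - g x0) * p.2).
  elim=> {g} [y yl|c|g h _ hg _ hh|g h gg hg gh hh].
  - have -> : (fun p : T * K => (y p.1 - y x0) * p.2) = (fun p => y p.1 * p.2).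
      by apply/funext => p; rewrite gens0 // subr0.
    apply: gen_alg_gen; apply/List.in_app_iff; right.
    exact: (List.in_map (fun (y : T -> K) (p : T * K) => y p.1 * p.2)).
  - have -> : (fun p : T * K => (c - c) * p.2) = (fun=> 0).
      by apply/funext => p; rewrite subrr mul0r.
    exact: gen_alg_cst.
  - have := gen_alg_add hg hh; congr gen_alg; apply/funext => p; ring.
  - have := gen_alg_add (gen_alg_mul hg (liftR _ gh))
             (gen_alg_mul (gen_alg_cst _ (g x0)) hh).
    by congr gen_alg; apply/funext => p; ring.
have powR k g : max_pow k g -> gen_alg gR (fun p => g p.1 * p.2 ^+ k).
  elim=> {k g} [g hg|k a g ha a0 _ hg|k g h _ hg _ hh].
  - have := liftR _ hg; congr gen_alg; apply/funext => p.
    by rewrite expr0 mulr1.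
  - have := gen_alg_mul (liftRt _ ha) hg; congr gen_alg; apply/funext => p.
    by rewrite a0 subr0 exprS; ring.
  - have := gen_alg_add hg hh; congr gen_alg; apply/funext => p.
    by rewrite mulrDl.
(* The Noetherian property for the sequence [f * t ^+ k] expresses [f * t ^+ N] by
   the previous terms; comparing the coefficients of [t ^+ N] gives [e]. *)
have [N [s [sR es]]] := gen_alg_noetherian (fun k => powR k f (hf k)).
have coefR g : gen_alg gR g -> exists P : T -> {poly K},
   [/\ forall p, g p = (P p.1).[p.2], forall i, gen_alg gens (fun x => (P x)`_i)
     & forall i, (P x0)`_i.+1 = 0].
  elim=> {g} [g|c|g h _ [P [eP gP P0]] _ [Q [eQ gQ Q0]]|
                  g h _ [P [eP gP P0]] _ [Q [eQ gQ Q0]]].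
  - move=> /List.in_app_iff[] /List.in_map_iff [y [<- yl]].
    + exists (fun x => (y x)%:P); split=> [p|i|i].
      * by rewrite hornerC.
      * under [X in gen_alg _ X]funext do rewrite coefC.
        by case: (i == 0%N); [exact: gen_alg_gen|exact: gen_alg_cst].
      * by rewrite coefC.
    + exists (fun x => y x *: 'X); split=> [p|i|i].
      * by rewrite hornerZ hornerX.
      * under [X in gen_alg _ X]funext do rewrite coefZ.
        by apply: gen_alg_mul; [exact: gen_alg_gen|exact: gen_alg_cst].
      * by rewrite coefZ gens0 ?mul0r.
  - exists (fun=> c%:P); split=> [p|i|i]; rewrite ?hornerC ?coefC //.
    exact: gen_alg_cst.
  - exists (fun x => P x + Q x); split=> [p|i|i].
    + by rewrite hornerD eP eQ.
    + under [X in gen_alg _ X]funext do rewrite coefD.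
      exact: gen_alg_add.
    + by rewrite coefD P0 Q0 addr0.
  - exists (fun x => P x * Q x); split=> [p|i|i].
    + by rewrite hornerM eP eQ.
    + under [X in gen_alg _ X]funext do rewrite coefM.
      by apply: gen_alg_sum => j; exact: gen_alg_mul.
    + rewrite coefM big1 // => -[[|j] /= ij] _; last by rewrite P0 mul0r.
      by rewrite subn0 Q0 mulr0.
have [P hP] := choice (fun i => coefR _ (sR i)).
exists (fun x => \sum_(i < N) (P i x)`_(N - i)); split.
- by apply: gen_alg_sum => i; have [_ /(_ (N - i)%N)] := hP i.
- rewrite big1 // => i _; have [_ _] := hP i.
  by move=> /(_ (N - i.+1)%N); rewrite subnSK.
- move=> x.
  have : f x *: 'X^N - \sum_(i < N) P i x * (f x *: 'X^i) = 0.
    apply: poly_all_roots => t; rewrite hornerD hornerN hornerZ hornerXn horner_sum.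
    have := es (x, t) => /= ->; apply/eqP; rewrite subr_eq0; apply/eqP.
    apply: eq_bigr => i _; have [/(_ (x, t)) -> _ _] := hP i.
    by rewrite hornerM hornerZ hornerXn.
  move/(congr1 (fun p : {poly K} => p`_N)).
  rewrite coefB coef_sum coefZ coefXn eqxx mulr1 coef0 => /eqP.
  rewrite subr_eq0 => /eqP {1}->; rewrite mulr_suml; apply: eq_bigr => i _.
  by rewrite -scalerAr coefZ coefMXn ltnNge ltnW //= mulrC.
Qed.

End Krull.

(** * Functions without derivative on a connected group *)
Section PointDerivations.
Context {R : realType} {n : nat}.
Local Notation C := R[i].
Variables (G : set 'M[C]_n) (delta : ('M[C]_n -> C) -> C).
Hypothesis hd : point_derivation G delta.
Implicit Types (f h : 'M[C]_n -> C).

Lemma pd_ext f h : regular_on G h -> (forall x, G x -> f x = h x) ->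
  delta f = delta h.
Proof. by case: hd => e _ _ rh fh; apply: e => //; exact: regular_on_ext rh. Qed.

Lemma pd_cst c : delta (fun=> c) = 0.
Proof.
case: hd => _ lin leib.
have z0 : delta (fun=> 0) = 0.
  have := lin (-1) _ _ (regular_on_cst G 0) (regular_on_cst G 0).
  move=> e0; rewrite -[RHS](addNr (delta (fun=> 0))) -mulN1r -e0.
  by congr delta; apply/funext => x; rewrite mulr0 addr0.
have d1 : delta (fun=> 1) = 0.
  have := leib _ _ (regular_on_cst G 1) (regular_on_cst G 1).
  have -> : (fun _ : 'M[C]_n => 1 * 1 : C) = (fun=> 1).
    by apply/funext => x; rewrite mulr1.
  rewrite mulr1 mul1r => /eqP.
  by rewrite eq_sym -subr_eq0 addrK => /eqP.
have e := lin c _ _ (regular_on_cst G 1) (regular_on_cst G 0).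
rewrite -[RHS](addr0 0) -[X in X + _](mulr0 c) -[X in c * X]d1 -[X in _ + X]z0 -e.
by congr delta; apply/funext => x; rewrite mulr1 addr0.
Qed.

Lemma pd_add f h : regular_on G f -> regular_on G h ->
  delta (fun x => f x + h x) = delta f + delta h.
Proof.
case: hd => _ lin _ rf rh; rewrite -(mul1r (delta f)) -lin //.
by congr delta; apply/funext => x; rewrite mul1r.
Qed.

Lemma pd_scale c f : regular_on G f -> delta (fun x => c * f x) = c * delta f.
Proof.
case: hd => _ lin _ rf.
rewrite -[RHS]addr0 -(pd_cst 0) -lin //; last exact: regular_on_cst.
by congr delta; apply/funext => x; rewrite addr0.
Qed.

Lemma pd_opp f : regular_on G f -> delta (fun x => - f x) = - delta f.
Proof.
move=> rf; rewrite -mulN1r -pd_scale //.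
by congr delta; apply/funext => x; rewrite mulN1r.
Qed.

Lemma pd_sub f h : regular_on G f -> regular_on G h ->
  delta (fun x => f x - h x) = delta f - delta h.
Proof. by move=> rf rh; rewrite pd_add ?pd_opp //; exact: regular_on_opp. Qed.

Lemma pd_mul f h : regular_on G f -> regular_on G h ->
  delta (fun x => f x * h x) = delta f * h 1%:M + f 1%:M * delta h.
Proof. by case: hd => _ _; apply. Qed.

Lemma pd_sum I (r : seq I) (F : I -> 'M[C]_n -> C) :
  (forall i, regular_on G (F i)) ->
  delta (fun x => \sum_(i <- r) F i x) = \sum_(i <- r) delta (F i).
Proof.
move=> rF; elim: r => [|i r ih].
  by under [X in delta X]funext do rewrite big_nil; rewrite pd_cst big_nil.
under [X in delta X]funext do rewrite big_cons.
by rewrite pd_add ?ih ?big_cons //; exact: regular_on_sum.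
Qed.

Lemma pd_invdet : is_subgroup G ->
  delta (fun g => (\det g)^-1) = - delta (fun g => \det g).
Proof.
move=> sG; have : delta (fun y => \det y * (\det y)^-1) = 0.
  rewrite -(pd_cst 1); apply: pd_ext => [|y Gy]; first exact: regular_on_cst.
  have : y \in unitmx by exact: (subgroup_unit sG).
  by rewrite unitmxE unitfE => y0; rewrite divff.
rewrite pd_mul; [|exact/regular_on_GL/regular_GL_detid|exact/regular_on_GL/regular_GL_invdet].
by rewrite det1 invr1 mulr1 mul1r => /eqP; rewrite addrC addr_eq0 => /eqP.
Qed.

End PointDerivations.

Section MaxPow.
Context {K : numFieldType} {T : Type} {x0 : T} {l : seq (T -> K)}.
Local Notation gens := [set f | List.In f l].
Local Notation mpow := (max_pow x0 l).

Lemma max_pow_mull k f g : gen_alg gens f -> mpow k g ->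
  mpow k (fun x => f x * g x).
Proof.
move=> hf; elim=> {k g} [g hg|k a g ha a0 _ hg|k g h _ hg _ hh].
- by apply: max_pow0; exact: gen_alg_mul.
- have := max_powS ha a0 hg; congr max_pow; apply/funext => x; ring.
- have := max_pow_add hg hh; congr max_pow; apply/funext => x; ring.
Qed.

Lemma max_pow_scale k c g : mpow k g -> mpow k (fun x => c * g x).
Proof. by apply: max_pow_mull; exact: gen_alg_cst. Qed.

Lemma max_powM i j f g : mpow i f -> mpow j g ->
  mpow (i + j) (fun x => f x * g x).
Proof.
move=> + hg; elim=> {i f} [f hf|i a f ha a0 _ hf|i f h _ hf _ hh].
- exact: max_pow_mull.
- by have := max_powS ha a0 hf; congr max_pow; apply/funext => x; ring.
- by have := max_pow_add hf hh; congr max_pow; apply/funext => x; ring.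
Qed.

Lemma max_pow_zero k : mpow k (fun=> 0).
Proof.
elim: k => [|k ih]; first by apply: max_pow0; exact: gen_alg_cst.
have := max_powS (gen_alg_cst _ 0) erefl ih.
by congr max_pow; apply/funext => x; rewrite mul0r.
Qed.

Lemma max_pow_sum k n (F : 'I_n -> T -> K) : (forall i, mpow k (F i)) ->
  mpow k (fun x => \sum_i F i x).
Proof.
move=> hF; elim: (index_enum _) => [|i r ih].
  by under [X in mpow _ X]funext do rewrite big_nil; exact: max_pow_zero.
by under [X in mpow _ X]funext do rewrite big_cons; exact: max_pow_add.
Qed.

Lemma max_pow1 f : gen_alg gens f -> f x0 = 0 -> mpow 1 f.
Proof.
move=> hf f0; have := max_powS hf f0 (max_pow0 x0 (gen_alg_cst _ 1)).
by congr max_pow; apply/funext => x; rewrite mulr1.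
Qed.

Lemma max_pow_gen k f : mpow k f -> gen_alg gens f.
Proof.
by elim=> {k f} // [k f g hf _ _ hg|k f g _ hf _ hg];
  [exact: gen_alg_mul|exact: gen_alg_add].
Qed.

End MaxPow.

Section Rigidity.
Context {R : realType} {n : nat}.
Local Notation C := R[i].
Variables (G : set 'M[C]_n) (sG : is_subgroup G).

Let T := {x : 'M[C]_n | G x}.
Let t1 : T := exist _ 1%:M (subgroup1 sG).

(** Generators of the algebra of regular functions that vanish at [1]; the
    functions live on the type [T] of points of [G] because [max_pow] is about
    functions up to equality everywhere. *)
Definition coord_at_1 : seq (T -> C) :=
  [seq (fun t : T => entry p.1 p.2 (sval t) - entry p.1 p.2 1%:M)
     | p <- enum {: 'I_n * 'I_n}] ++ [:: fun t : T => (\det (sval t))^-1 - 1].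

Local Notation gens := [set f | List.In f coord_at_1].
Local Notation mpow := (max_pow t1 coord_at_1).

Lemma coord_at_1_vanish f : gens f -> f t1 = 0.
Proof.
move=> /List.in_app_iff[/List.in_map_iff[p [<- _]]|[<-|[]]]; first exact: subrr.
by rewrite /= det1 invr1 subrr.
Qed.

Lemma mem_In (U : eqType) (x : U) (s : seq U) : x \in s -> List.In x s.
Proof.
by elim: s => // y s ih; rewrite inE => /orP[/eqP->|/ih]; [left|right].
Qed.

Lemma gen_alg_regular f : regular_on G f -> gen_alg gens (f \o sval).
Proof.
move=> [h hh fh].
have -> : f \o sval = h \o sval :> (T -> C) by apply/funext => -[x Gx] /=; exact: fh.
elim: hh => {f h fh} [f|c|f h _ rf _ rh|f h _ rf _ rh].
- case=> [[i [j ->]]|->].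
    have := gen_alg_add (gen_alg_gen (_ : gens (fun t =>
      entry i j (sval t) - entry i j 1%:M))) (gen_alg_cst gens (entry i j 1%:M)).
    have hin : gens (fun t => entry i j (sval t) - entry i j 1%:M).
      apply/List.in_app_iff; left.
      apply: (List.in_map (fun p (t : T) =>
        entry p.1 p.2 (sval t) - entry p.1 p.2 1%:M) _ (i, j)).
      by apply: mem_In; rewrite mem_enum.
    by move=> /(_ hin); congr gen_alg; apply/funext => t /=; rewrite subrK.
  have hin : gens (fun t => (\det (sval t))^-1 - 1).
    by apply/List.in_app_iff; right; left.
  have := gen_alg_add (gen_alg_gen hin) (gen_alg_cst gens 1).
  by congr gen_alg; apply/funext => t /=; rewrite subrK.
- exact: gen_alg_cst.
- exact: gen_alg_add rf rh.
- exact: gen_alg_mul rf rh.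
Qed.

(** [regular_on] speaks of functions of all matrices. *)
Definition extend (g : T -> C) (x : 'M[C]_n) : C :=
  if pselect (G x) is left Gx then g (exist _ x Gx) else 0.

Lemma extendE g x (Gx : G x) : extend g x = g (exist _ x Gx).
Proof.
by rewrite /extend; case: pselect => // Gx'; congr (g (exist _ x _)); exact: Prop_irrelevance.
Qed.

Lemma extend_val g t : extend g (sval t) = g t.
Proof. by case: t => x Gx; rewrite extendE. Qed.

Lemma regular_extend g : gen_alg gens g -> regular_on G (extend g).
Proof.
elim=> {g} [f|c|f h _ rf _ rh|f h _ rf _ rh].
- move=> /List.in_app_iff[/List.in_map_iff[p [<- _]]|[<-|[]]].
    apply: regular_on_ext (_ : regular_on G
      (fun x => entry p.1 p.2 x - entry p.1 p.2 1%:M)) => [x Gx|].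
      by rewrite extendE.
    by apply: regular_on_sub; [exact: regular_on_entry|exact: regular_on_cst].
  apply: regular_on_ext (_ : regular_on G (fun x => (\det x)^-1 - 1)) => [x Gx|].
    by rewrite extendE.
  apply: regular_on_sub; last exact: regular_on_cst.
  exact/regular_on_GL/regular_GL_invdet.
- by apply: regular_on_ext (regular_on_cst G c) => x Gx; rewrite extendE.
- by apply: regular_on_ext (regular_on_add rf rh) => x Gx; rewrite !extendE.
- by apply: regular_on_ext (regular_on_mul rf rh) => x Gx; rewrite !extendE.
Qed.

Let r := size coord_at_1.
Let y (k : 'I_r) : T -> C := nth (fun=> 0) coord_at_1 k.
Let lincomb (c : 'rV[C]_r) (t : T) : C := \sum_k c 0 k * y k t.

Lemma coord_gen k : gens (y k).
Proof.
rewrite /y; have := ltn_ord k; rewrite {2}/r; move: (nat_of_ord k).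
elim: coord_at_1 => // a s ih [|i] /= h; first by left.
by right; exact: ih.
Qed.

Lemma coord_nth f : gens f -> exists k, f = y k.
Proof.
rewrite /y /r /=; elim: coord_at_1 => //= a s ih [<-|/ih[k ->]].
  by exists ord0.
by exists (lift ord0 k).
Qed.

Lemma lincombD a c d t : lincomb (a *: c + d) t = a * lincomb c t + lincomb d t.
Proof.
rewrite /lincomb mulr_sumr -big_split; apply: eq_bigr => k _ /=.
by rewrite !mxE mulrDl mulrA.
Qed.

(** [c] represents the differential at [1] of [f] in the chosen generators of the
    maximal ideal. *)
Let diff_coord (f : 'M[C]_n -> C) (c : 'rV[C]_r) : Prop :=
  mpow 2 (fun t => f (sval t) - f 1%:M - lincomb c t).

Lemma diff_coord_ext f h c : (forall x, G x -> f x = h x) -> diff_coord h c ->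
  diff_coord f c.
Proof.
move=> fh; congr max_pow; apply/funext => -[x Gx] /=; rewrite !fh //.
exact: subgroup1.
Qed.

Lemma diff_coordD a f h c d : diff_coord f c -> diff_coord h d ->
  diff_coord (fun x => a * f x + h x) (a *: c + d).
Proof.
move=> hf hh; have := max_pow_add (max_pow_scale a hf) hh; congr max_pow.
by apply/funext => t; rewrite lincombD; ring.
Qed.

Lemma diff_coordM f h c d : regular_on G f -> regular_on G h ->
  diff_coord f c -> diff_coord h d ->
  diff_coord (fun x => f x * h x) (h 1%:M *: c + f 1%:M *: d).
Proof.
move=> rf rh hf hh.
have m1 g : regular_on G g -> mpow 1 (fun t => g (sval t) - g 1%:M).
  move=> rg; apply: max_pow1; last exact: subrr.
  apply: (gen_alg_regular (f := fun x => g x - g 1%:M)).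
  by apply: regular_on_sub => //; exact: regular_on_cst.
have := max_pow_add (max_powM (m1 _ rf) (m1 _ rh))
  (max_pow_add (max_pow_scale (h 1%:M) hf) (max_pow_scale (f 1%:M) hh)).
congr max_pow; apply/funext => t /=; rewrite lincombD.
have -> : lincomb (f 1%:M *: d) t = f 1%:M * lincomb d t.
  by rewrite -[_ *: d]addr0 lincombD [X in _ + X]big1 ?addr0 // => k _; rewrite mxE mul0r.
by ring.
Qed.

Lemma diff_coord_ex f : regular_on G f -> exists c, diff_coord f c.
Proof.
move=> /gen_alg_regular fG.
suff [c hc] : exists c, mpow 2 (fun t => (f \o sval) t - (f \o sval) t1 - lincomb c t).
  by exists c.
have l0 t : lincomb 0 t = 0 by rewrite /lincomb big1 // => k _; rewrite mxE mul0r.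
elim: fG => {f} [f fg|c|f h _ [c hf] _ [d hh]|f h gf [c hf] gh [d hh]].
- have [k ek] := coord_nth fg; exists (delta_mx 0 k).
  have := @max_pow_zero _ _ t1 coord_at_1 2; congr max_pow; apply/funext => t.
  rewrite ek (coord_at_1_vanish (coord_gen k)) /lincomb (bigD1 k) //= mxE !eqxx mul1r.
  rewrite big1 ?addr0 ?subr0 ?subrr // => j /negbTE jk.
  by rewrite mxE jk andbF mul0r.
- exists 0; have := @max_pow_zero _ _ t1 coord_at_1 2; congr max_pow; apply/funext => t.
  by rewrite l0 !subrr.
- exists (1 *: c + d); have := max_pow_add hf hh; congr max_pow.
  by apply/funext => t; rewrite lincombD; ring.
- exists (h t1 *: c + (f t1 *: d + 0)).
  have m1 g : gen_alg gens g -> mpow 1 (fun t => g t - g t1).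
    move=> gg; apply: max_pow1; last exact: subrr.
    exact: gen_alg_add gg (gen_alg_cst _ _).
  have := max_pow_add (max_powM (m1 _ gf) (m1 _ gh))
    (max_pow_add (max_pow_scale (h t1) hf) (max_pow_scale (f t1) hh)).
  congr max_pow; apply/funext => t /=; rewrite !lincombD l0; ring.
Qed.

(** The [d k] are coordinates on the cotangent space [m / m ^ 2] at [1] with respect
    to the generators [y k] of the maximal ideal [m]. *)
Lemma dual_derivations : exists d : 'I_r -> ('M[C]_n -> C) -> C,
  (forall k, point_derivation G (d k)) /\
  forall f, regular_on G f ->
    mpow 2 (fun t => f (sval t) - f 1%:M - \sum_k y k t * d k f).
Proof.
have [||N HN] := @vspace_of_linear R 'rV[C]_r [set c | mpow 2 (lincomb c)].
- have := @max_pow_zero _ _ t1 coord_at_1 2; congr max_pow; apply/funext => t.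
  by rewrite /lincomb big1 // => k _; rewrite mxE mul0r.
- move=> a c d hc hd; have := max_pow_add (max_pow_scale a hc) hd.
  by congr max_pow; apply/funext => t; rewrite lincombD.
(* The generators may be dependent modulo the square of the maximal ideal: [P]
   normalizes coordinates by projecting along the relations [N]. *)
pose P c : 'rV[C]_r := c - projv N c.
have P0 c : mpow 2 (lincomb c) -> P c = 0.
  by move=> /HN hc; rewrite /P projv_id ?subrr.
have PD a c d : P (a *: c + d) = a *: P c + P d.
  by rewrite /P linearP /= scalerBr opprD addrACA.
have Plin c : mpow 2 (fun t => lincomb c t - lincomb (P c) t).
  have /HN := memv_proj N c; congr max_pow; apply/funext => t.
  have -> : lincomb (P c) t = lincomb ((- 1) *: projv N c + c) t.
    by rewrite /P scaleN1r addrC.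
  by rewrite lincombD; ring.
pose cf f := xget 0 [set c | diff_coord f c].
have cfP f c : diff_coord f c -> P (cf f) = P c.
  rewrite /cf; case: xgetP => [c' _ /= hc'|/(_ c)//] hc.
  apply/eqP; rewrite -subr_eq0; apply/eqP.
  have -> : P c' - P c = P ((-1) *: c + c') by rewrite PD scaleN1r addrC.
  apply: P0; have := max_pow_add hc (max_pow_scale (-1) hc').
  by congr max_pow; apply/funext => t; rewrite lincombD; ring.
exists (fun k f => P (cf f) 0 k); split=> [k|f rf]; last first.
  have [c hc] := diff_coord_ex rf; rewrite (cfP _ _ hc).
  have := max_pow_add hc (Plin c); congr max_pow; apply/funext => t /=.
  rewrite -addrA; congr (_ + _); rewrite addKr /lincomb; congr (- _).
  by apply: eq_bigr => j _; rewrite mulrC.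
split.
- move=> f h rf rh fh; have [c hc] := diff_coord_ex rh.
  by rewrite (cfP _ _ hc) (cfP _ _ (diff_coord_ext fh hc)).
- move=> a f h rf rh; have [c hc] := diff_coord_ex rf.
  have [d hd] := diff_coord_ex rh.
  by rewrite (cfP _ _ (diff_coordD a hc hd)) (cfP _ _ hc) (cfP _ _ hd) PD !mxE.
- move=> f h rf rh; have [c hc] := diff_coord_ex rf.
  have [d hd] := diff_coord_ex rh.
  rewrite (cfP _ _ (diff_coordM rf rh hc hd)) (cfP _ _ hc) (cfP _ _ hd).
  have -> : f 1%:M *: d = f 1%:M *: d + 0 by rewrite addr0.
  have z : P 0 = 0 by rewrite /P linear0 subr0.
  by rewrite !PD z !mxE; ring.
Qed.

(** If all invariant derivatives of [f] vanish then the Euler derivation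
    [\sum_k y_k D_k], which acts on [m ^ k / m ^ k.+1] as multiplication by [k],
    shows that [f - f 1] lies in all the powers of [m]; by Krull's theorem it
    vanishes in a neighbourhood of [1]. *)
Lemma locally_constant_at_1 f : regular_on G f ->
  (forall delta, point_derivation G delta ->
     forall x, G x -> delta (fun h => f (h *m x)) = 0) ->
  exists e, [/\ regular_on G e, e 1%:M = 0
    & forall x, G x -> f x - f 1%:M = e x * (f x - f 1%:M)].
Proof.
move=> rf df; have [d [pd d1]] := dual_derivations.
pose D k (g : T -> C) (t : T) := d k (fun h => extend g (h *m sval t)).
pose E g t := \sum_k y k t * D k g t.
have rext g (t : T) : gen_alg gens g -> regular_on G (fun h => extend g (h *m sval t)).
  by move=> gg; apply: regular_on_mulr; [exact: sG|exact: svalP|exact: regular_extend].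
have DM k g h t : gen_alg gens g -> gen_alg gens h ->
    D k (fun t => g t * h t) t = D k g t * h t + g t * D k h t.
  move=> gg gh; rewrite /D -{1}[in h t](extend_val h t) -{1}(extend_val g t).
  have := pd_mul (pd k) (rext g t gg) (rext h t gh); rewrite !mul1mx => <-.
  apply: (pd_ext (pd k)).
    by apply: regular_on_mul; exact: rext.
  move=> x Gx; have Gxt : G (x *m sval t) by apply: subgroupM => //; exact: svalP.
  by rewrite !extendE.
have DD k g h t : gen_alg gens g -> gen_alg gens h ->
    D k (fun t => g t + h t) t = D k g t + D k h t.
  move=> gg gh; rewrite /D -(pd_add (pd k) (rext g t gg) (rext h t gh)).
  apply: (pd_ext (pd k)).
    by apply: regular_on_add; exact: rext.
  move=> x Gx; have Gxt : G (x *m sval t) by apply: subgroupM => //; exact: svalP.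
  by rewrite !extendE.
have Dgen k g : gen_alg gens g -> gen_alg gens (D k g).
  move=> gg; have [h hh eh] := regular_extend gg.
  have [I [a [b [ra rb ab]]]] := regular_GL_mul hh.
  have -> : D k g = (fun t => \sum_i d k (a i) * (b i \o sval) t).
    apply/funext => t; rewrite /D.
    transitivity (d k (fun h => \sum_i b i (sval t) * a i h)).
      apply: (pd_ext (pd k)).
        by apply: regular_on_sum => i; apply: regular_on_scale; exact: regular_on_GL.
      move=> x Gx; have Gxt : G (x *m sval t) by apply: subgroupM => //; exact: svalP.
      by rewrite eh // ab; apply: eq_bigr => i _; rewrite mulrC.
    rewrite (pd_sum (pd k)); last first.
      by move=> i; apply: regular_on_scale; exact: regular_on_GL.
    by apply: eq_bigr => i _; rewrite (pd_scale (pd k)) 1?mulrC //; exact: regular_on_GL.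
  apply: gen_alg_sum => i; apply: gen_alg_mul; first exact: gen_alg_cst.
  by apply: gen_alg_regular; exact: regular_on_GL.
have E1 a : gen_alg gens a -> a t1 = 0 -> mpow 2 (fun t => E a t - a t).
  move=> ga a0.
  have h1 := max_pow_scale (-1) (d1 _ (regular_extend ga)).
  have h2 : mpow 2 (fun t => \sum_k y k t * (D k a t - D k a t1)).
    apply: max_pow_sum => k; apply: (@max_powM _ _ _ _ 1 1).
      by apply: max_pow1; [exact/gen_alg_gen/coord_gen|exact/coord_at_1_vanish/coord_gen].
    apply: max_pow1; last exact: subrr.
    by apply: gen_alg_add; [exact: Dgen|exact: gen_alg_cst].
  have := max_pow_add h1 h2; congr max_pow; apply/funext => t.
  rewrite extend_val (extendE _ (subgroup1 sG)) -/t1 a0 subr0 /E.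
  under [X in _ + X]eq_bigr do rewrite mulrBr.
  rewrite sumrB.
  have -> : \sum_k y k t * D k a t1 = \sum_k y k t * d k (extend a).
    apply: eq_bigr => k _; congr (_ * _); rewrite /D; congr (d k _).
    by apply/funext => h; rewrite mulmx1.
  by ring.
have Ek k g : mpow k g -> mpow k.+1 (fun t => E g t - k%:R * g t).
  elim=> {k g} [g gg|k a g ga a0 mg hg|k g h mg hg mh hh].
  - have := max_pow_sum (k := 1) (fun k : 'I_r => max_powM (max_pow1
      (gen_alg_gen (coord_gen k)) (coord_at_1_vanish (coord_gen k)))
      (max_pow0 t1 (Dgen k _ gg))).
    by congr max_pow; apply/funext => t; rewrite mul0r subr0.
  - have gg := max_pow_gen mg.
    have := max_pow_add (max_powM (E1 _ ga a0) mg) (max_powM (max_pow1 ga a0) hg).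
    congr max_pow; apply/funext => t.
    have -> : E (fun t => a t * g t) t = E a t * g t + a t * E g t.
      rewrite /E mulr_suml mulr_sumr -big_split /=; apply: eq_bigr => j _.
      by rewrite DM // mulrDr mulrA (mulrCA (a t)).
    by rewrite -[k.+1]addn1 natrD; ring.
  - have gg := max_pow_gen mg; have gh := max_pow_gen mh.
    have := max_pow_add hg hh; congr max_pow; apply/funext => t.
    have -> : E (fun t => g t + h t) t = E g t + E h t.
      rewrite /E -big_split /=; apply: eq_bigr => j _.
      by rewrite DD // mulrDr.
    by ring.
pose f0 := (fun x => f x - f 1%:M) \o sval : T -> C.
have gf0 : gen_alg gens f0.
  apply: (gen_alg_regular (f := fun x => f x - f 1%:M)).
  by apply: regular_on_sub => //; exact: regular_on_cst.
have Ef0 t : E f0 t = 0.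
  rewrite /E big1 // => k _; rewrite /D.
  have rft : regular_on G (fun h => f (h *m sval t)).
    by apply: regular_on_mulr => //; exact: svalP.
  have -> : d k (fun h => extend f0 (h *m sval t)) =
      d k (fun h => f (h *m sval t) - f 1%:M).
    apply: (pd_ext (pd k)).
      by apply: regular_on_sub => //; exact: regular_on_cst.
    move=> x Gx; have Gxt : G (x *m sval t) by apply: subgroupM => //; exact: svalP.
    by rewrite extendE.
  rewrite (pd_sub (pd k)) ?(pd_cst (pd k)) //; last exact: regular_on_cst.
  by rewrite df ?subr0 ?mulr0 //; exact: svalP.
have mf0 k : mpow k.+1 f0.
  elim: k => [|k ih]; first by apply: max_pow1; rewrite /f0 //= subrr.
  have := max_pow_scale (- k.+1%:R^-1) (Ek _ _ ih).
  congr max_pow; apply/funext => t; rewrite Ef0 sub0r mulrNN mulKf //.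
have [|e [ge e0 he]] := krull_intersection coord_at_1_vanish (f := f0).
  by case=> [|k]; [exact: max_pow0|exact: mf0].
exists (extend e); split; first exact: regular_extend.
  by rewrite (extendE _ (subgroup1 sG)).
move=> x Gx; rewrite extendE.
exact: (he (exist _ x Gx)).
Qed.

(** By [locally_constant_at_1], applied to translates of [f], the closed set where
    [f] takes the value [f 1] is also open. *)
Lemma zconnected_constant f : zconnected G -> regular_on G f ->
  (forall delta, point_derivation G delta ->
     forall x, G x -> delta (fun h => f (h *m x)) = 0) ->
  forall x, G x -> f x = f 1%:M.
Proof.
move=> cG rf df.
pose Y1 := [set x | G x /\ f x = f 1%:M].
have He x : exists e, G x -> [/\ regular_on G e, e 1%:M = 0
    & forall h, G h -> f (h *m x) - f x = e h * (f (h *m x) - f x)].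
  have [Gx|nGx] := pselect (G x); last by exists (fun=> 0) => /nGx.
  have [| |e [re e0 he]] := @locally_constant_at_1 (fun h => f (h *m x)).
  - exact: regular_on_mulr.
  - move=> delta hd z Gz; rewrite -(df _ hd (z *m x)); last exact: subgroupM.
    by congr delta; apply/funext => h; rewrite mulmxA.
  by exists e => _; split=> // h Gh; have := he h Gh; rewrite mul1mx.
have [e eP] := choice He.
pose eY x h := 1 - e x (h *m invmx x).
have reY x : G x -> regular_on G (eY x).
  move=> Gx; apply: regular_on_sub; first exact: regular_on_cst.
  by have [re _ _] := eP x Gx; apply: regular_on_mulr => //; exact: subgroupV.
pose Y2 := [set x | G x /\ forall g, [set eY z | z in Y1] g -> g x = 0].
have Y1E : Y1 = [set x | G x /\ forall g, [set (fun x => f x - f 1%:M)] g -> g x = 0].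
  apply/seteqP; split=> x [Gx].
    by move=> fx; split=> // g ->; rewrite fx subrr.
  by move=> /(_ _ erefl) /eqP; rewrite subr_eq0 => /eqP.
have notY2 x : Y1 x -> ~ Y2 x.
  move=> Yx [Gx /(_ (eY x))]; have [_ e0 _] := eP x Gx.
  rewrite /eY mulmxV ?(subgroup_unit sG) // e0 subr0 => h.
  by have /eqP := h (ex_intro2 _ _ x Yx erefl); rewrite oner_eq0.
have inY2 x : G x -> ~ Y1 x -> Y2 x.
  move=> Gx nY; split=> // _ [z [Gz fz] <-]; have [_ _ he] := eP z Gz.
  have Gh : G (x *m invmx z) by apply: subgroupM => //; exact: subgroupV.
  have := he _ Gh; rewrite mulmxKV ?(subgroup_unit sG) // fz => h.
  have fx : f x - f 1%:M != 0.
    by apply/eqP => /eqP; rewrite subr_eq0 => /eqP fx; apply: nY.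
  by apply: (mulIf fx); rewrite mul0r mulrBl mul1r -h subrr.
have [||||h x Gx|h x Gx] := cG Y1 Y2.
- exists [set (fun x => f x - f 1%:M)] => // g ->.
  by apply: regular_on_sub => //; exact: regular_on_cst.
- by exists [set eY z | z in Y1] => // _ [z [Gz _] <-]; exact: reY.
- apply/seteqP; split=> [x [[]|[]]//|x Gx].
  by have [Yx|/(inY2 _ Gx)] := pselect (Y1 x); [left|right].
- by apply/seteqP; split=> // x [/notY2].
- have : Y1 1%:M by split=> //; exact: subgroup1.
  by rewrite h.
- have [[]//|nY] := pselect (Y1 x).
  by have := inY2 _ Gx nY; rewrite h.
Qed.

End Rigidity.

(** * Linear differential equations with complex coefficients *)
Section ComplexDerivative.
Context {R : realType}.
Local Notation C := R[i].
Implicit Types (g h : R -> C) (a : nat -> C).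

Definition cderiv g (g' : R -> C) : Prop := forall s : R,
  is_derive s 1 (fun t => complex.Re (g t)) (complex.Re (g' s)) /\
  is_derive s 1 (fun t => complex.Im (g t)) (complex.Im (g' s)).

Lemma cReD (x y : C) : complex.Re (x + y) = complex.Re x + complex.Re y.
Proof. by case: x y => a b []. Qed.

Lemma cImD (x y : C) : complex.Im (x + y) = complex.Im x + complex.Im y.
Proof. by case: x y => a b []. Qed.

Lemma cReM (x y : C) : complex.Re (x * y) =
  complex.Re x * complex.Re y - complex.Im x * complex.Im y.
Proof. by case: x y => a b []. Qed.

Lemma cImM (x y : C) : complex.Im (x * y) =
  complex.Re x * complex.Im y + complex.Im x * complex.Re y.
Proof. by case: x y => a b []. Qed.

Lemma complexP (x y : C) : complex.Re x = complex.Re y ->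
  complex.Im x = complex.Im y -> x = y.
Proof. by case: x y => a b [c d] /= -> ->. Qed.

Lemma cderiv_cst c : cderiv (fun=> c) (fun=> 0).
Proof. by move=> s; split; exact: is_derive_cst. Qed.

Lemma cderiv_add g g' h h' : cderiv g g' -> cderiv h h' ->
  cderiv (fun s => g s + h s) (fun s => g' s + h' s).
Proof.
move=> dg dh s; have [dg1 dg2] := dg s; have [dh1 dh2] := dh s.
split.
- under [X in is_derive _ _ X]funext do rewrite cReD.
  by rewrite cReD; exact: is_deriveD.
- under [X in is_derive _ _ X]funext do rewrite cImD.
  by rewrite cImD; exact: is_deriveD.
Qed.

Lemma cderiv_mul g g' h h' : cderiv g g' -> cderiv h h' ->
  cderiv (fun s => g s * h s) (fun s => g' s * h s + g s * h' s).
Proof.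
move=> dg dh s; have [dg1 dg2] := dg s; have [dh1 dh2] := dh s.
split.
- under [X in is_derive _ _ X]funext do rewrite cReM.
  apply: (is_derive_eq (is_deriveB (is_deriveM dg1 dh1) (is_deriveM dg2 dh2))).
  by rewrite cReD !cReM /GRing.scale /=; ring.
- under [X in is_derive _ _ X]funext do rewrite cImM.
  apply: (is_derive_eq (is_deriveD (is_deriveM dg1 dh2) (is_deriveM dg2 dh1))).
  by rewrite cImD !cImM /GRing.scale /=; ring.
Qed.

Lemma cderiv_ext g g' h' : cderiv g g' -> (forall s, h' s = g' s) -> cderiv g h'.
Proof. by move=> dg e; have -> : h' = g' by exact/funext. Qed.

Lemma cderiv_scale c g g' : cderiv g g' -> cderiv (fun s => c * g s) (fun s => c * g' s).
Proof.
move=> /(cderiv_mul (cderiv_cst c)) /cderiv_ext; apply=> s.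
by rewrite mul0r add0r.
Qed.

Lemma cderiv0_cst g : cderiv g (fun=> 0) -> forall s t, g s = g t.
Proof.
move=> dg s t; apply: complexP.
- by apply: (@is_derive_0_is_cst _ (fun s => complex.Re (g s))) => u; have [] := dg u.
- by apply: (@is_derive_0_is_cst _ (fun s => complex.Im (g s))) => u; have [] := dg u.
Qed.

Lemma cderiv_unique g g1 g2 : cderiv g g1 -> cderiv g g2 -> forall s, g1 s = g2 s.
Proof.
move=> d1 d2 s; have [d1r d1i] := d1 s; have [d2r d2i] := d2 s.
apply: complexP.
- by rewrite -(@derive_val _ _ _ _ _ _ _ d1r) -(@derive_val _ _ _ _ _ _ _ d2r).
- by rewrite -(@derive_val _ _ _ _ _ _ _ d1i) -(@derive_val _ _ _ _ _ _ _ d2i).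
Qed.

(** Exponential generating functions of sequences of geometric growth. *)
Section RealSeries.
Implicit Types c d : nat -> R.

Definition geometric_bound c : Prop := exists M B : R, forall k, `|c k| <= M * B ^+ k.

Definition egf c (s : R) : R := limn (pseries (fun k => c k / k`!%:R) s).

Lemma geometric_bound_shift c : geometric_bound c -> geometric_bound (c \o succn).
Proof. by move=> [M [B h]]; exists (M * B), B => k /=; rewrite -mulrA -exprS. Qed.

Lemma egf_cvg c s : geometric_bound c -> cvgn (pseries (fun k => c k / k`!%:R) s).
Proof.
move=> [M [B h]]; apply: normed_cvg.
have : cvgn (series (M *: exp_coeff (`|B| * `|s|))).
  by apply: is_cvg_seriesZ; exact: is_cvg_series_exp_coeff.
apply: series_le_cvg => [n|n|n].
- exact: normr_ge0.
- have M0 : 0 <= M by have := h 0%N; rewrite expr0 mulr1; exact/le_trans/normr_ge0.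
  by apply: mulr_ge0 => //; apply: exp_coeff_ge0; exact: mulr_ge0.
- rewrite -[X in _ <= X]/(M * ((`|B| * `|s|) ^+ n / n`!%:R)) exprMn /=.
  rewrite !normrM normfV normr_nat normrX.
  rewrite -!mulrA (mulrC _^-1) [X in _ <= X]mulrA.
  apply: ler_wpM2r; first by rewrite divr_ge0 // exprn_ge0.
  have M0 : 0 <= M by have := h 0%N; rewrite expr0 mulr1; exact/le_trans/normr_ge0.
  by apply: (le_trans (h n)); apply: ler_wpM2l => //; rewrite -normrX ler_norm.
Qed.

Lemma egf_diffs c : pseries_diffs (fun k => c k / k`!%:R) =
  (fun k => (c \o succn) k / k`!%:R).
Proof.
apply/funext => k; rewrite /pseries_diffs /= factS natrM invfM.
by rewrite mulrCA (mulrA k.+1%:R) divff ?mul1r // pnatr_eq0.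
Qed.

Lemma is_derive_egf c (s : R) : geometric_bound c ->
  is_derive s (1 : R) (egf c) (egf (c \o succn) s).
Proof.
move=> gc; rewrite /egf -egf_diffs; apply: (@pseries_snd_diffs _ _ (`|s| + 1)).
- exact: egf_cvg.
- by rewrite egf_diffs; apply/egf_cvg/geometric_bound_shift.
- by rewrite !egf_diffs; apply/egf_cvg/geometric_bound_shift/geometric_bound_shift.
- by rewrite [ltRHS]ger0_norm ?ltrDl // addr_ge0.
Qed.

Lemma egfD c d s : geometric_bound c -> geometric_bound d ->
  egf (fun k => c k + d k) s = egf c s + egf d s.
Proof.
move=> gc gd; rewrite /egf -limD; [|exact: egf_cvg|exact: egf_cvg].
congr (limn _); apply/funext => n; rewrite fctE /pseries /series /= -big_split /=.
by apply: eq_bigr => k _; rewrite !mulrDl.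
Qed.

Lemma egfZ (r : R) c s : geometric_bound c -> egf (fun k => r * c k) s = r * egf c s.
Proof.
move=> gc; rewrite /egf.
rewrite -[RHS]/(r *: _) -limZl_tmp; last exact: egf_cvg.
congr (limn _); apply/funext => n; rewrite fctE /pseries /series /= scaler_sumr.
by apply: eq_bigr => k _; rewrite /GRing.scale /= !mulrA.
Qed.

Lemma egf0 c : egf c 0 = c 0%N.
Proof.
apply/cvg_lim => //; apply/cvgrPdist_lt => e e0; near=> n.
have n0 : (0 < n)%N by near: n; exists 1%N.
rewrite /pseries /series /= -(prednK n0) big_nat_recl // fact0 divr1 expr0 mulr1.
by rewrite big1 ?addr0 ?subrr ?normr0 // => i _; rewrite expr0n mulr0.
Unshelve. all: by end_near. Qed.

Lemma geometric_boundD c d : geometric_bound c -> geometric_bound d ->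
  geometric_bound (fun k => c k + d k).
Proof.
move=> [M [B hc]] [M' [B' hd]]; exists (`|M| + `|M'|), (`|B| + `|B'|) => k.
apply: (le_trans (ler_normD _ _)); rewrite mulrDl; apply: lerD.
- apply: (le_trans (hc k)); apply: (le_trans (ler_norm _)); rewrite normrM normrX.
  by apply: ler_wpM2l => //; apply: lerXn2r; rewrite ?nnegrE ?addr_ge0 // lerDl.
- apply: (le_trans (hd k)); apply: (le_trans (ler_norm _)); rewrite normrM normrX.
  by apply: ler_wpM2l => //; apply: lerXn2r; rewrite ?nnegrE ?addr_ge0 // lerDr.
Qed.

Lemma geometric_boundZ (r : R) c : geometric_bound c -> geometric_bound (fun k => r * c k).
Proof.
move=> [M [B hc]]; exists (`|r| * M), B => k.
by rewrite normrM -mulrA; exact: ler_wpM2l.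
Qed.

End RealSeries.

Definition geometric a : Prop :=
  geometric_bound (@complex.Re R \o a) /\ geometric_bound (@complex.Im R \o a).

Definition cegf a (s : R) : C :=
  Complex (egf (@complex.Re R \o a) s) (egf (@complex.Im R \o a) s).

Lemma cderiv_cegf a : geometric a -> cderiv (cegf a) (cegf (a \o succn)).
Proof. by move=> [gr gi] s; split; exact: is_derive_egf. Qed.

Lemma cegf0 a : cegf a 0 = a 0%N.
Proof. by apply: complexP; rewrite /= egf0. Qed.

Lemma geometricD a b : geometric a -> geometric b -> geometric (fun k => a k + b k).
Proof.
move=> [ar ai] [br bi]; split.
- have -> : @complex.Re R \o (fun k => a k + b k) =
      (fun k => (@complex.Re R \o a) k + (@complex.Re R \o b) k).
    by apply/funext => k /=; rewrite cReD.
  exact: geometric_boundD.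
- have -> : @complex.Im R \o (fun k => a k + b k) =
      (fun k => (@complex.Im R \o a) k + (@complex.Im R \o b) k).
    by apply/funext => k /=; rewrite cImD.
  exact: geometric_boundD.
Qed.

Lemma cegfD a b s : geometric a -> geometric b ->
  cegf (fun k => a k + b k) s = cegf a s + cegf b s.
Proof.
move=> [ar ai] [br bi]; apply: complexP; rewrite ?cReD ?cImD /= -egfD //;
by congr (egf _ s); apply/funext => k; rewrite /= ?cReD ?cImD.
Qed.

Lemma ReZ_seq (z : C) a : @complex.Re R \o (fun k => z * a k) =
  (fun k => complex.Re z * (@complex.Re R \o a) k + - complex.Im z * (@complex.Im R \o a) k).
Proof. by apply/funext => k /=; rewrite cReM mulNr. Qed.

Lemma ImZ_seq (z : C) a : @complex.Im R \o (fun k => z * a k) =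
  (fun k => complex.Re z * (@complex.Im R \o a) k + complex.Im z * (@complex.Re R \o a) k).
Proof. by apply/funext => k /=; rewrite cImM. Qed.

Lemma geometricZ z a : geometric a -> geometric (fun k => z * a k).
Proof.
move=> [ar ai]; split; rewrite ?ReZ_seq ?ImZ_seq;
by apply: geometric_boundD; exact: geometric_boundZ.
Qed.

Lemma cegfZ z a s : geometric a -> cegf (fun k => z * a k) s = z * cegf a s.
Proof.
move=> [ar ai]; apply: complexP; rewrite ?cReM ?cImM /= ?ReZ_seq ?ImZ_seq.
- rewrite (egfD _ (geometric_boundZ _ ar) (geometric_boundZ _ ai)) !egfZ //.
  by rewrite mulNr.
- by rewrite (egfD _ (geometric_boundZ _ ai) (geometric_boundZ _ ar)) !egfZ.
Qed.

Lemma geometric0 : geometric (fun=> 0).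
Proof. by split; exists 0, 0 => k; rewrite /= normr0 mul0r. Qed.

Lemma cegf_zero s : cegf (fun=> 0) s = 0.
Proof.
have -> : (fun=> 0) = (fun k : nat => 0 * (fun=> 0) k) :> (nat -> C).
  by apply/funext => k; rewrite mul0r.
by rewrite (cegfZ _ _ geometric0) mul0r.
Qed.

Lemma cegf_sum I (r : seq I) (F : I -> nat -> C) s : (forall i, geometric (F i)) ->
  geometric (fun k => \sum_(i <- r) F i k) /\
  cegf (fun k => \sum_(i <- r) F i k) s = \sum_(i <- r) cegf (F i) s.
Proof.
move=> gF; elim: r => [|i r [ihg ihe]].
  have -> : (fun k => \sum_(i <- [::]) F i k) = (fun=> 0).
    by apply/funext => k; rewrite big_nil.
  by rewrite big_nil cegf_zero; split=> //; exact: geometric0.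
have -> : (fun k => \sum_(j <- i :: r) F j k) =
    (fun k => F i k + \sum_(j <- r) F j k).
  by apply/funext => k; rewrite big_cons.
by rewrite big_cons cegfD // ihe; split=> //; exact: geometricD.
Qed.

Let norm1 (z : C) : R := `|complex.Re z| + `|complex.Im z|.

Let norm1D x y : norm1 (x + y) <= norm1 x + norm1 y.
Proof.
by rewrite /norm1 cReD cImD addrACA; apply: lerD; exact: ler_normD.
Qed.

Let norm1M x y : norm1 (x * y) <= norm1 x * norm1 y.
Proof.
rewrite /norm1 cReM cImM.
apply: (le_trans (lerD (ler_normB _ _) (ler_normD _ _))).
by rewrite !normrM le_eqVlt; apply/orP; left; apply/eqP; ring.
Qed.

Let norm1_ge0 x : 0 <= norm1 x. Proof. exact: addr_ge0. Qed.

Let geometric_norm1 a B : (forall k, norm1 (a k) <= B ^+ k) -> geometric a.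
Proof.
move=> h; split; exists 1, B => k; rewrite mul1r; apply: le_trans (h k).
- by rewrite lerDl.
- by rewrite lerDr.
Qed.

Let norm1_nat (b : bool) : norm1 b%:R <= 1.
Proof. by case: b; rewrite /norm1 /= ?normr1 ?normr0 ?addr0. Qed.

Definition cexp (c : C) : R -> C := cegf (fun k => c ^+ k).

Lemma cderiv_cexp c : cderiv (cexp c) (fun s => c * cexp c s).
Proof.
have gc : geometric (fun k => c ^+ k).
  apply: (geometric_norm1 (B := norm1 c)); elim=> [|k ih]; first exact: (norm1_nat true).
  by rewrite !exprS; apply: (le_trans (norm1M _ _)); exact: ler_wpM2l.
apply: (cderiv_ext (cderiv_cegf gc)) => s; rewrite /cexp -cegfZ //.
by congr (cegf _ s); apply/funext => k; rewrite /= exprS.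
Qed.

Lemma cexp0 c : cexp c 0 = 1. Proof. by rewrite /cexp cegf0 expr0. Qed.

Lemma cexpK c s : cexp c s * cexp (- c) s = 1.
Proof.
transitivity (cexp c 0 * cexp (- c) 0); last by rewrite !cexp0 mulr1.
apply: (@cderiv0_cst (fun s => cexp c s * cexp (- c) s)).
apply: (cderiv_ext (cderiv_mul (cderiv_cexp c) (cderiv_cexp (- c)))) => t.
by ring.
Qed.

Lemma linear_ode c g : cderiv g (fun s => c * g s) -> forall s, g s = g 0 * cexp c s.
Proof.
move=> dg s.
have : g s * cexp (- c) s = g 0 * cexp (- c) 0.
  apply: (@cderiv0_cst (fun s => g s * cexp (- c) s)).
  by apply: (cderiv_ext (cderiv_mul dg (cderiv_cexp (- c)))) => t; ring.
rewrite cexp0 mulr1 => <-; rewrite -mulrA (mulrC (cexp (- c) s)) cexpK.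
by rewrite mulr1.
Qed.

(** A jet whose members are linearly dependent and vanish at [0] is zero: by
    induction on a dependency, seen as a polynomial in the derivation, of which a
    linear factor is split off. *)
Lemma dependent_jet_zero (p : {poly C}) (u : nat -> R -> C) : p != 0 ->
  (forall k, cderiv (u k) (u k.+1)) -> (forall k, u k 0 = 0) ->
  (forall s, \sum_(k < size p) p`_k * u k s = 0) -> forall s, u 0%N s = 0.
Proof.
have [d] := ubnP (size p); elim: d p u => // d ih p u; rewrite ltnS => sp p0 du u0 pu s.
have [sp1|sp1] := leqP (size p) 1.
  have := pu s; have e : size p = 1%N by apply/eqP; rewrite eqn_leq sp1 size_poly_gt0.
  rewrite e big_ord1 /= => /eqP; rewrite mulf_eq0 => /orP[/eqP p00|/eqP //].
  by move: p0; rewrite -lead_coef_eq0 lead_coefE e /= p00 eqxx.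
have [z /factor_theorem[q eq]] : exists z, root p z.
  by apply/closed_rootP; rewrite gtn_eqF.
have q0 : q != 0 by apply/eqP => q0; move: p0; rewrite eq q0 mul0r eqxx.
have sq : size p = (size q).+1 by rewrite eq size_Mmonic ?monicXsubC // size_XsubC addn2.
pose v k (s : R) := u k.+1 s + - z * u k s.
have v0 : forall s, v 0%N s = 0.
  apply: (ih q) => //.
  - by rewrite -sq.
  - by move=> k; apply: cderiv_add => //; exact: cderiv_scale.
  - by move=> k; rewrite /v !u0 mulr0 addr0.
  - move=> t; rewrite -[RHS](pu t) sq.
    have ek k : p`_k = (if k is k'.+1 then q`_k' else 0) + - z * q`_k.
      rewrite eq mulrBr coefB coefMX -mulrC mul_polyC coefZ mulNr.
      by case: k.
    under [RHS]eq_bigr do rewrite ek mulrDl.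
    rewrite big_split /= big_ord_recl /= mul0r add0r [X in _ = _ + X]big_ord_recr /=.
    rewrite (nth_default _ (leqnn (size q))) mulr0 mul0r addr0 -big_split /=.
    by apply: eq_bigr => k _; rewrite /v /= /bump /= add1n; ring.
have du0 : cderiv (u 0%N) (fun s => z * u 0%N s).
  apply: (cderiv_ext (du 0%N)) => t; have := v0 t; rewrite /v mulNr => /eqP.
  by rewrite subr_eq0 => /eqP ->.
by rewrite (linear_ode du0) u0 mul0r.
Qed.

Section MatrixExponential.
Context {n : nat}.
Variable Y : 'M[C]_n.

Let mxpow k := iter k (fun A => A *m Y) 1%:M.

Let geometric_mxpow i j : geometric (fun k => mxpow k i j).
Proof.
pose B := \sum_i \sum_j norm1 (Y i j).
have colB j' : \sum_l norm1 (Y l j') <= B.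
  apply: ler_sum => l _; rewrite (bigD1 j') //= lerDl; apply: sumr_ge0 => m _.
  exact: norm1_ge0.
have norm1_sum (F : 'I_n -> C) : norm1 (\sum_l F l) <= \sum_l norm1 (F l).
  elim/big_ind2: _ => //; first by rewrite /norm1 /= normr0 addr0.
  by move=> x a y b xa yb; apply: (le_trans (norm1D _ _)); exact: lerD.
apply: (geometric_norm1 (B := B)) => k; elim: k j => [|k ih] j'.
  by rewrite /= mxE; exact: norm1_nat.
rewrite /= mxE; apply: (le_trans (norm1_sum _)).
rewrite exprSr; apply: le_trans (_ : \sum_l B ^+ k * norm1 (Y l j') <= _).
  by apply: ler_sum => l _; apply: (le_trans (norm1M _ _)); exact: ler_wpM2r.
rewrite -mulr_sumr; apply: ler_wpM2l => //.
by apply: exprn_ge0; apply: le_trans (colB j'); apply: sumr_ge0 => l _; exact: norm1_ge0.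
Qed.

Definition exp_mx (s : R) : 'M[C]_n := \matrix_(i, j) cegf (fun k => mxpow k i j) s.

Lemma exp_mx0 : exp_mx 0 = 1%:M.
Proof. by apply/matrixP => i j; rewrite mxE cegf0 /=. Qed.

Lemma cderiv_exp_mx i j :
  cderiv (fun s => exp_mx s i j) (fun s => (exp_mx s *m Y) i j).
Proof.
have -> : (fun s => exp_mx s i j) = cegf (fun k => mxpow k i j).
  by apply/funext => s; rewrite mxE.
apply: (cderiv_ext (cderiv_cegf (geometric_mxpow i j))) => s.
have -> : (fun k => mxpow k i j) \o succn = (fun k => \sum_l Y l j * mxpow k i l).
  by apply/funext => k; rewrite /= mxE; apply: eq_bigr => l _; rewrite mulrC.
have [_ ->] := cegf_sum (index_enum 'I_n) s
  (fun l => geometricZ (Y l j) (geometric_mxpow i l)).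
rewrite mxE; apply: eq_bigr => l _; rewrite cegfZ; last exact: geometric_mxpow.
by rewrite ?mxE mulrC.
Qed.

End MatrixExponential.
End ComplexDerivative.

(** * The flow of a point derivation *)
Section Flow.
Context {R : realType} {n : nat}.
Local Notation C := R[i].
Variables (G : set 'M[C]_n) (delta : ('M[C]_n -> C) -> C).
Hypotheses (sG : is_subgroup G) (hd : point_derivation G delta).
Implicit Types (h : 'M[C]_n -> C).

(** The left invariant vector field with value [delta] at [1]. *)
Definition flow_derive h : 'M[C]_n -> C := fun x => delta (fun y => h (x *m y)).

Local Notation D := flow_derive.

Lemma regular_on_translate h x : regular_GL h -> regular_on G (fun y => h (x *m y)).
Proof.
move=> rh; have [I [a [b [_ rb e]]]] := regular_GL_mul rh.
apply: (@regular_on_ext _ _ _ _ (fun y => \sum_i a i x * b i y)) => [y _|]; first exact: e.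
by apply: regular_on_sum => i; apply: regular_on_scale; exact: regular_on_GL.
Qed.

Lemma flow_derive_expand h (I : finType) (a b : I -> 'M[C]_n -> C) :
  (forall i, regular_GL (b i)) ->
  (forall x y, h (x *m y) = \sum_i a i x * b i y) ->
  forall x y, D h (x *m y) = \sum_i a i x * D (b i) y.
Proof.
move=> rb e x y; rewrite /flow_derive.
transitivity (delta (fun z => \sum_i a i x * b i (y *m z))).
  apply: (pd_ext hd) => [|z _]; last by rewrite -mulmxA e.
  by apply: regular_on_sum => i; apply/regular_on_scale/regular_on_translate.
rewrite (pd_sum hd); last by move=> i; apply/regular_on_scale/regular_on_translate.
by apply: eq_bigr => i _; rewrite (pd_scale hd) //; exact: regular_on_translate.
Qed.

Lemma regular_flow_derive h : regular_GL h -> regular_GL (D h).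
Proof.
move=> rh; have [I [a [b [ra rb e]]]] := regular_GL_mul rh.
have -> : D h = fun x => \sum_i D (b i) 1%:M * a i x.
  apply/funext => x; rewrite -[x in LHS]mulmx1 (flow_derive_expand rb e).
  by apply: eq_bigr => i _; rewrite mulrC.
by apply: gen_alg_sum => i; exact: gen_alg_mul (gen_alg_cst _ _) (ra i).
Qed.

Lemma flow_derive1 h : D h 1%:M = delta h.
Proof. by rewrite /flow_derive; congr delta; apply/funext => y; rewrite mul1mx. Qed.

Lemma flow_derive_add h k x : regular_GL h -> regular_GL k ->
  D (fun y => h y + k y) x = D h x + D k x.
Proof. by move=> rh rk; rewrite /flow_derive (pd_add hd) //; exact: regular_on_translate. Qed.

Lemma flow_derive_mul h k x : regular_GL h -> regular_GL k ->
  D (fun y => h y * k y) x = D h x * k x + h x * D k x.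
Proof.
move=> rh rk; rewrite /flow_derive (pd_mul hd) ?mulmx1 //;
exact: regular_on_translate.
Qed.

Lemma flow_derive_cst c x : D (fun=> c) x = 0.
Proof. by rewrite /flow_derive (pd_cst hd). Qed.

Let Y : 'M[C]_n := \matrix_(i, j) delta (entry i j).
Let gamma := exp_mx Y.

Let along h := cderiv (fun s => h (gamma s)) (fun s => D h (gamma s)).

Lemma flow_derive_entry i j x : D (entry i j) x = (x *m Y) i j.
Proof.
transitivity (delta (fun y => \sum_k x i k * entry k j y)).
  by rewrite /flow_derive; congr delta; apply/funext => y; rewrite /entry mxE.
rewrite (pd_sum hd); last by move=> k; apply/regular_on_scale/regular_on_entry.
rewrite mxE; apply: eq_bigr => k _; rewrite (pd_scale hd) ?mxE //.
exact: regular_on_entry.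
Qed.

Lemma along_gen_alg gens h : (forall f, gens f -> regular_GL f /\ along f) ->
  gen_alg gens h -> regular_GL h /\ along h.
Proof.
move=> hg; elim=> {h} [f /hg //|c|f h _ [rf df] _ [rh dh]|f h _ [rf df] _ [rh dh]].
- split; first exact: gen_alg_cst.
  by apply: (cderiv_ext (cderiv_cst c)) => s; rewrite flow_derive_cst.
- split; first exact: gen_alg_add.
  by apply: (cderiv_ext (cderiv_add df dh)) => s; rewrite flow_derive_add.
- split; first exact: gen_alg_mul.
  by apply: (cderiv_ext (cderiv_mul df dh)) => s; rewrite flow_derive_mul.
Qed.

Lemma along_entry i j : regular_GL (@entry R n i j) /\ along (entry i j).
Proof.
split; first exact: regular_GL_entry.
by apply: (cderiv_ext (cderiv_exp_mx Y i j)) => s; rewrite flow_derive_entry.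
Qed.

Lemma along_det : along (fun g => \det g).
Proof.
have [] // := @along_gen_alg [set f | exists i j, f = entry i j] (fun g => \det g).
  by move=> _ [i [j ->]]; exact: along_entry.
by apply: (gen_alg_det (A := id)) => i j; apply: gen_alg_gen; exists i, j.
Qed.

Lemma det_flow s : \det (gamma s) = cexp (delta (fun g => \det g)) s.
Proof.
have d0 : \det (gamma 0) = 1 by rewrite /gamma exp_mx0 det1.
rewrite (linear_ode (c := delta (fun g => \det g)) (g := fun s => \det (gamma s))).
  by rewrite d0 mul1r.
apply: (cderiv_ext along_det) => t; rewrite /flow_derive mulrC.
have -> : (fun y => \det (gamma t *m y)) = (fun y => \det (gamma t) * \det y).
  by apply/funext => y; rewrite det_mulmx.
by rewrite (pd_scale hd) //; exact/regular_on_GL/regular_GL_detid.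
Qed.

Lemma flow_unit s : @GL R n (gamma s).
Proof.
rewrite /GL /= unitmxE unitfE det_flow; apply/eqP => e0.
by have := cexpK (delta (fun g => \det g)) s; rewrite e0 mul0r => /eqP; rewrite eq_sym oner_eq0.
Qed.

Lemma along_regular h : regular_GL h -> along h.
Proof.
move=> rh; apply: (along_gen_alg _ rh).2 => f [[i [j ->]]|->]; first exact: along_entry.
split; first exact: regular_GL_invdet.
have rinv : regular_on G (fun g => (\det g)^-1).
  by apply: regular_on_GL; exact: regular_GL_invdet.
set c := delta (fun g => \det g).
have invc s : (\det (gamma s))^-1 = cexp (- c) s.
  rewrite det_flow -/c; have cK := cexpK c s.
  have c0 : cexp c s != 0.
    by apply/eqP => e0; move: cK; rewrite e0 mul0r => /eqP; rewrite eq_sym oner_eq0.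
  by apply: (mulfI c0); rewrite cK divff.
rewrite /along; have -> : (fun s => (\det (gamma s))^-1) = cexp (- c).
  by apply/funext => s; exact: invc.
apply: (cderiv_ext (cderiv_cexp _)) => s.
rewrite -invc /flow_derive.
transitivity (delta (fun y => (\det (gamma s))^-1 * (\det y)^-1)).
  by congr delta; apply/funext => y; rewrite det_mulmx invfM.
rewrite (pd_scale hd) // mulrC; congr (_ * _).
exact: (pd_invdet hd sG).
Qed.

(** All the derivatives of [h] along the vector field lie in the finite-dimensional
    space spanned by the [a_i] of the comultiplication. *)
Lemma flow_dependent h : regular_GL h -> exists p : {poly C}, p != 0 /\
  forall x, \sum_(k < size p) p`_k * iter k D h x = 0.
Proof.
move=> rh; have [I [a [b [ra rb e]]]] := regular_GL_mul rh.
have rD k f : regular_GL f -> regular_GL (iter k D f).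
  by move=> rf; elim: k => //= k ih; exact: regular_flow_derive.
have eD k x y : iter k D h (x *m y) = \sum_i a i x * iter k D (b i) y.
  elim: k x y => [|k ih] x y; first exact: e.
  by rewrite /= (flow_derive_expand _ ih) // => i; exact: rD.
pose r := #|I|.
pose M : 'M[C]_(r.+1, r) := \matrix_(k, i) iter k D (b (enum_val i)) 1%:M.
have : kermx M != 0.
  rewrite -mxrank_eq0 mxrank_ker subn_eq0 -ltnNge.
  by apply: leq_ltn_trans (rank_leq_col M) _.
move=> /rowV0Pn[c /sub_kermxP cM c0].
pose p : {poly C} := rVpoly c.
have sp : (size p <= r.+1)%N by exact: size_poly.
have pN (F : nat -> C) : \sum_(k < size p) p`_k * F k = \sum_(k < r.+1) c 0 k * F k.
  rewrite (big_ord_widen _ (fun k => p`_k * F k) sp) big_mkcond.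
  apply: eq_bigr => k _; rewrite -(coef_rVpoly_ord c k).
  by case: ltnP => // pk; rewrite nth_default ?mul0r.
exists p; split.
  by apply: contra c0 => /eqP p0; rewrite -[c]rVpolyK -/p p0 linear0.
move=> x; rewrite (pN (fun k => iter k D h x)).
transitivity (\sum_(k < r.+1) c 0 k * \sum_i a i x * iter k D (b i) 1%:M).
  by apply: eq_bigr => k _; rewrite -eD mulmx1.
under eq_bigr do rewrite mulr_sumr.
rewrite exchange_big /= big1 // => i _.
transitivity (a i x * (c *m M) 0 (enum_rank i)); last by rewrite cM mxE mulr0.
rewrite mxE mulr_sumr; apply: eq_bigr => k _.
by rewrite mxE enum_rankK mulrCA.
Qed.

Lemma flow_zero h : regular_GL h -> (forall k, iter k D h 1%:M = 0) ->
  forall s, h (gamma s) = 0.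
Proof.
move=> rh h0; have [p [p0 hp]] := flow_dependent rh.
have rD k : regular_GL (iter k D h).
  by elim: k => //= k; exact: regular_flow_derive.
apply: (dependent_jet_zero (u := fun k s => iter k D h (gamma s)) p0).
- by move=> k; exact: (along_regular (rD k)).
- by move=> k; rewrite /gamma exp_mx0.
- by move=> s; exact: hp.
Qed.

Lemma flow_derive_ext h k : (forall x, G x -> h x = k x) -> regular_GL k ->
  forall x, G x -> D h x = D k x.
Proof.
move=> hk rk x Gx; apply: (pd_ext hd); first exact: regular_on_translate.
by move=> y Gy; apply: hk; exact: subgroupM.
Qed.

(** An equation of [G] satisfies a linear differential equation along the flow, and
    all its derivatives vanish at [1]. *)
Lemma flow_closed s : zclosed_in (@GL R n) G -> G (gamma s).
Proof.
move=> [E rE GE]; rewrite GE; split; first exact: flow_unit.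
move=> f Ef; have [h rh fh] := rE f Ef; rewrite fh; last exact: flow_unit.
have rD k : regular_GL (iter k D h).
  by elim: k => //= k; exact: regular_flow_derive.
have hG k x : G x -> iter k D h x = 0.
  elim: k x => [|k ih] x Gx.
    by have := Gx; rewrite {1}GE => -[Ux /(_ f Ef)]; rewrite fh.
  rewrite /= (flow_derive_ext ih (gen_alg_cst _ 0) Gx).
  by rewrite flow_derive_cst.
by apply: flow_zero => // k; apply: hG; exact: subgroup1.
Qed.

(** A tangent vector fixed by an involution [theta] kills the functions that
    vanish on the fixed points: its flow consists of fixed points. *)
Lemma derivation_fixed_group theta : zclosed_in (@GL R n) G ->
  alg_involution G theta ->
  (forall f, regular_on G f -> delta (f \o theta) = delta f) ->
  forall f, regular_on G f -> (forall x, fixed_group G theta x -> f x = 0) ->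
  delta f = 0.
Proof.
move=> cG [[thG thM rth] thK] dth f rf f0.
have fixg s : theta (gamma s) = gamma s.
  apply/matrixP => i j.
  have [h rh eh] := rth _ (regular_on_entry G i j).
  apply/eqP; rewrite -subr_eq0; apply/eqP.
  have Gs := flow_closed s cG.
  transitivity (h (gamma s) + -1 * entry i j (gamma s)).
    by rewrite -eh // mulN1r.
  apply: (flow_zero (h := fun x => h x + -1 * entry i j x)) => [|k].
    apply: gen_alg_add => //; apply: gen_alg_mul; first exact: gen_alg_cst.
    exact: regular_GL_entry.
  have rD g l : regular_GL g -> regular_GL (iter l D g).
    by move=> rg; elim: l => //= l; exact: regular_flow_derive.
  have rent := @regular_GL_entry R n i j.
  have r2 : regular_GL (fun x => -1 * entry i j x : C).
    by apply: gen_alg_mul => //; exact: gen_alg_cst.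
  have lin x : iter k D (fun x => h x + -1 * entry i j x) x =
      iter k D h x - iter k D (entry i j) x.
    elim: k x => [|k ih] x; first by rewrite /= mulN1r.
    have -> : iter k.+1 D (fun x => h x + -1 * entry i j x) x =
        D (fun x => iter k D h x + -1 * iter k D (entry i j) x) x.
      by rewrite /=; congr (D _ x); apply/funext => y; rewrite ih mulN1r.
    rewrite flow_derive_add; [|exact: rD|].
      rewrite flow_derive_mul; [|exact: gen_alg_cst|exact: rD].
      by rewrite flow_derive_cst mul0r add0r mulN1r.
    by apply: gen_alg_mul; [exact: gen_alg_cst|exact: rD].
  rewrite lin; apply/eqP; rewrite subr_eq0; apply/eqP.
  have : forall l x, G x -> iter l D h x = iter l D (entry i j) (theta x).
    elim=> [|l ih] x Gx; first exact/esym/eh.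
    rewrite /= /flow_derive.
    have rl : regular_on G (fun y => iter l D (entry i j) (theta x *m y)).
      by apply: regular_on_translate; exact: rD.
    rewrite -(dth _ rl); apply: (pd_ext hd).
      have [_ _ rc] : alg_hom G G theta by [].
      exact: rc.
    by move=> y Gy; rewrite ih /= ?thM //; exact: subgroupM.
  move=> /(_ k 1%:M (subgroup1 sG)) ->; congr (iter k D _ _).
  have Gt1 := thG _ (subgroup1 sG).
  have t1u : theta 1%:M \in unitmx by exact: (subgroup_unit sG).
  have := thM _ _ (subgroup1 sG) (subgroup1 sG); rewrite mulmx1 => e.
  by rewrite -[RHS](mulVmx t1u) {3}e mulKmx.
have [h rh fh] := rf.
have : cderiv (fun s => h (gamma s)) (fun=> 0).
  have -> : (fun s => h (gamma s)) = (fun=> 0); last exact: cderiv_cst.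
  apply/funext => s; have Gs := flow_closed s cG.
  by rewrite -fh // f0.
move=> /(cderiv_unique (along_regular rh)) /(_ 0).
rewrite /gamma exp_mx0 flow_derive1 => <-.
by apply: (pd_ext hd) => //; exact: regular_on_GL.
Qed.

End Flow.

(** * Transport along linear isomorphisms *)
Section PolynomialPullback.
Context {R : realType} {W W' : vectType R[i]}.
Local Notation C := R[i].
Implicit Types (phi : W -> W').

Lemma coordfun_linear (phi : {linear W -> W'}) i x :
  coordfun i (phi x) =
  \sum_j coordfun j x * coordfun i (phi (tnth (vbasis {:W}) j)).
Proof.
rewrite /coordfun {1}[x](coord_vbasis (memvf x)) linear_sum linear_sum.
by apply: eq_bigr => j _; rewrite linearZ linearZ /= (tnth_nth 0).
Qed.

Lemma polyfun_comp (phi : {linear W -> W'}) f : polyfun f -> polyfun (f \o phi).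
Proof.
apply: gen_alg_comp => {}f [i ->].
have -> : @coordfun R W' i \o phi =
    fun x => \sum_j coordfun j x * coordfun i (phi (tnth (vbasis {:W}) j)).
  by apply/funext => x; exact: coordfun_linear.
apply: gen_alg_sum => j; apply: gen_alg_mul; last exact: gen_alg_cst.
by apply: gen_alg_gen; exists j.
Qed.

End PolynomialPullback.

Section SchwartzTransport.
Context {R : realType} {W W' : vectType R[i]}.
Local Notation C := R[i].
Variables (phi : {linear W -> W'}) (psi : {linear W' -> W}).
Hypotheses (phiK : cancel phi psi) (psiK : cancel psi phi).
Variables (X : set W) (X' : set W').
Hypothesis XX' : forall x, X x <-> X' (phi x).

Lemma real_derive_comp v (f : W' -> C) :
  real_derive v (f \o phi) = real_derive (phi v) f \o phi.
Proof.
apply/funext => x; rewrite /real_derive /=.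
by congr (_ +i* _)%C; congr (derive1 _ 0); apply/funext => t;
  rewrite linearD linearZ.
Qed.

Lemma foldr_real_derive_comp s (f : W' -> C) :
  foldr real_derive (f \o phi) s = foldr real_derive f (map phi s) \o phi.
Proof. by elim: s => //= v s ->; rewrite real_derive_comp. Qed.

Lemma real_derivable_comp (f : W' -> C) x v :
  real_derivable f (phi x) (phi v) -> real_derivable (f \o phi) x v.
Proof.
rewrite /real_derivable.
have e (t : R) : phi (x + t%:C%C *: v) = phi x + t%:C%C *: phi v.
  by rewrite linearD linearZ.
rewrite /comp; under [X in _ -> derivable X _ _ /\ _]funext do rewrite e.
by under [X in _ -> _ /\ derivable X _ _]funext do rewrite e.
Qed.

Lemma continuous_on_comp (f : W' -> C) : continuous_on X' f -> continuous_on X (f \o phi).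
Proof.
move=> cf x Xx e e0; have [d d0 hd] := cf (phi x) ((XX' x).1 Xx) e e0.
pose m i j := coordfun i (phi (tnth (vbasis {:W}) j)) : C.
pose M := 1 + \sum_i \sum_j `|m i j|.
have s0 i : 0 <= \sum_j `|m i j| by apply: sumr_ge0 => j _; exact: normr_ge0.
have M0 : 0 < M by rewrite ltr_wpDr // sumr_ge0.
exists (d / M) => [|y Xy hy]; first exact: divr_gt0.
apply: hd; first exact/XX'.
move=> i; rewrite -linearB coordfun_linear.
apply: (le_lt_trans (ler_norm_sum _ _ _)).
apply: (@le_lt_trans _ _ (d / M * \sum_j `|m i j|)).
  rewrite mulr_sumr; apply: ler_sum => j _; rewrite normrM.
  by apply: ler_wpM2r => //; exact/ltW/hy.
have lM : \sum_j `|m i j| < M.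
  rewrite /M (bigD1 i) //= addrCA ltrDl; apply: ltr_wpDr => //.
  by apply: sumr_ge0 => k _.
by rewrite mulrAC ltr_pdivrMr // ltr_pM2l.
Qed.

Lemma smooth_on_comp (f : W' -> C) : smooth_on X' f -> smooth_on X (f \o phi).
Proof.
move=> sf s; rewrite foldr_real_derive_comp; have [cs ds] := sf (map phi s).
split=> [|x v Xx]; first exact: continuous_on_comp.
by apply: real_derivable_comp; apply: ds; exact/XX'.
Qed.

Lemma semialgebraic_comp (T T' : Type) (gens : set (T -> R)) (gens' : set (T' -> R))
    (u : T -> T') : (forall f, gens' f -> gen_alg gens (f \o u)) ->
  forall A, semialgebraic gens' A -> semialgebraic gens (u @^-1` A).
Proof.
move=> hu A; elim=> {A} [f hf|A _ hA|A B _ hA _ hB].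
- by apply: (semialgebraic_pos (u := f \o u)); exact: gen_alg_comp hf.
- exact: semialgebraic_setC.
- exact: semialgebraic_setI.
Qed.

Lemma nash_on_comp (f : W' -> R) : nash_on X' f -> nash_on X (f \o phi).
Proof.
move=> [sf gf]; split; first exact: (smooth_on_comp sf).
have -> : [set p : W * R | X p.1 /\ p.2 = (f \o phi) p.1] =
    (fun p => (phi p.1, p.2)) @^-1` [set p | X' p.1 /\ p.2 = f p.1].
  by apply/seteqP; split=> p /= [/XX' h1 h2].
move: gf; apply: semialgebraic_comp => {f sf} f.
have re j : gen_alg (@graph_coords R W) (fun p => complex.Re (coordfun j p.1)).
  by apply: gen_alg_gen; apply: Or31; exists j.
have im j : gen_alg (@graph_coords R W) (fun p => complex.Im (coordfun j p.1)).
  by apply: gen_alg_gen; apply: Or32; exists j.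
case=> [[i ->]|[i ->]|->].
- set m := fun j => coordfun i (phi (tnth (vbasis {:W}) j)) : C.
  have -> : (fun p => complex.Re (coordfun i p.1)) \o (fun p : W * R => (phi p.1, p.2)) =
      fun p => \sum_j (complex.Re (coordfun j p.1) * complex.Re (m j)
        + - (complex.Im (coordfun j p.1) * complex.Im (m j))).
    apply/funext => p /=; rewrite coordfun_linear.
    elim/big_ind2: _ => // [a b c d <- <-|j _]; first by rewrite cReD.
    by rewrite cReM.
  apply: gen_alg_sum => j; apply: gen_alg_add; last apply: gen_alg_opp;
  by apply: gen_alg_mul => //; exact: gen_alg_cst.
- set m := fun j => coordfun i (phi (tnth (vbasis {:W}) j)) : C.
  have -> : (fun p => complex.Im (coordfun i p.1)) \o (fun p : W * R => (phi p.1, p.2)) =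
      fun p => \sum_j (complex.Re (coordfun j p.1) * complex.Im (m j)
        + complex.Im (coordfun j p.1) * complex.Re (m j)).
    apply/funext => p /=; rewrite coordfun_linear.
    elim/big_ind2: _ => // [a b c d <- <-|j _]; first by rewrite cImD.
    by rewrite cImM.
  apply: gen_alg_sum => j; apply: gen_alg_add;
  by apply: gen_alg_mul => //; exact: gen_alg_cst.
- by apply: gen_alg_gen; apply: Or33.
Qed.

Definition diffop_pullback (D : (W' -> C) -> (W' -> C)) : (W -> C) -> (W -> C) :=
  fun f => D (f \o psi) \o phi.

Lemma nash_diffop_pullback D : nash_diffop X' D -> nash_diffop X (diffop_pullback D).
Proof.
elim=> {D} [f nf|v|D E _ hD _ hE|D E _ hD _ hE].
- have -> : diffop_pullback (fun g x => (f x)%:C%C * g x) =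
      fun g x => ((f \o phi) x)%:C%C * g x.
    by apply/funext => g; apply/funext => x; rewrite /diffop_pullback /= phiK.
  exact/nash_diffop_fun/nash_on_comp.
- have -> : diffop_pullback (real_derive v) = real_derive (psi v).
    apply/funext => g; rewrite /diffop_pullback.
    rewrite -{1}(psiK v) -real_derive_comp; congr (real_derive _ _).
    by apply/funext => x /=; rewrite phiK.
  exact: nash_diffop_field.
- exact: nash_diffop_add hD hE.
- have -> : diffop_pullback (D \o E) = diffop_pullback D \o diffop_pullback E.
    apply/funext => g; rewrite /diffop_pullback /=; congr (D _ \o phi).
    by apply/funext => x /=; rewrite psiK.
  exact: nash_diffop_comp.
Qed.

End SchwartzTransport.

Section SchwartzTransport2.
Context {R : realType} {W W' : vectType R[i]}.
Local Notation C := R[i].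
Variables (phi : {linear W -> W'}) (psi : {linear W' -> W}).
Hypotheses (phiK : cancel phi psi) (psiK : cancel psi phi).
Variables (X : set W) (X' : set W').
Hypothesis XX' : forall x, X x <-> X' (phi x).

Let X'X y : X' y <-> X (psi y).
Proof. by rewrite XX' psiK. Qed.

Lemma schwartz_comp (f : W' -> C) : schwartz X' f -> schwartz X (f \o phi).
Proof.
move=> [f0 sf bf]; split.
- by move=> x nXx; apply: f0 => /XX'.
- exact: smooth_on_comp sf.
- move=> D nD; have [M hM] := bf _ (nash_diffop_pullback psiK phiK X'X nD).
  by exists M => x /XX' /hM; rewrite /diffop_pullback /= phiK.
Qed.

Lemma sdist_comp_linear (T : (W -> C) -> C) : sdist X T -> sdist X' (fun f => T (f \o phi)).
Proof.
move=> [Tlin [Ds [c [fD nD bT]]]]; split.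
  by move=> a f g sf sg; rewrite -Tlin //; exact: schwartz_comp.
exists (diffop_pullback psi phi @` Ds), c; split.
- exact: finite_image.
- by move=> _ [D /nD nXD <-]; exact: nash_diffop_pullback nXD.
- move=> f M sf M0 hM; apply: bT => //; first exact: schwartz_comp.
  move=> D x DD /XX' Xx; have := hM _ _ (ex_intro2 _ _ D DD erefl) Xx.
  by rewrite /diffop_pullback /= phiK.
Qed.

End SchwartzTransport2.

(** * Eigendistributions of a group of components *)
Section Components.
Context {R : realType}.
Local Notation C := R[i].

Lemma linear_pack (U V : lmodType C) (f : U -> V) : linear f ->
  exists phi : {linear U -> V}, phi = f :> (U -> V).
Proof.
by move=> lf; exists (HB.pack_for {linear U -> V} f (GRing.isLinear.Build C U V _ f lf)).
Qed.

Context {W : vectType C}.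
Implicit Types (j k l : W -> W) (X : set W) (T : (W -> C) -> C) (f : W -> C).

Definition zero_on X T : Prop := forall f, schwartz X f -> T f = 0.

Lemma sdist_combine X (c : C) T T' : sdist X T -> sdist X T' ->
  sdist X (fun f => T f + c * T' f).
Proof.
move=> [Tl [Ds [b [fD nD bT]]]] [Tl' [Ds' [b' [fD' nD' bT']]]]; split.
  by move=> a f g sf sg; rewrite Tl // Tl' //; ring.
exists (Ds `|` Ds'), (b + `|c| * b'); split.
- by rewrite finite_setU.
- by move=> D [/nD|/nD'].
- move=> f M sf M0 hM; rewrite mulrDl; apply: (le_trans (ler_normD _ _)).
  apply: lerD; first by apply: bT => // D x DD; apply: hM; left.
  rewrite normrM -mulrA; apply: ler_wpM2l => //.
  by apply: bT' => // D x DD; apply: hM; right.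
Qed.

Variables (L J : set (W -> W)).
Hypotheses (Lid : L id) (Lcomp : forall l l', L l -> L l' -> L (l \o l')) (LJ : L `<=` J)
  (Jlin : forall j, J j -> linear j)
  (Jcomp : forall j k, J j -> J k -> J (j \o k))
  (Jinv : forall j, J j -> exists j', [/\ J j', cancel j j' & cancel j' j])
  (Jcomm : forall j k, J j -> J k -> exists2 l, L l & j \o k = k \o j \o l)
  (Jsqr : forall j, J j -> L (j \o j)).

Lemma schwartz_compJ X j f : J j -> (forall x, X x <-> X (j x)) ->
  schwartz X f -> schwartz X (f \o j).
Proof.
move=> Jj Xj; have [j' [Jj' jK j'K]] := Jinv Jj.
have [phi ephi] := linear_pack (Jlin Jj); have [psi epsi] := linear_pack (Jlin Jj').
subst j j'.
exact: (schwartz_comp jK j'K Xj).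
Qed.

Lemma sdist_compJ X j T : J j -> (forall x, X x <-> X (j x)) ->
  sdist X T -> sdist X (fun f => T (f \o j)).
Proof.
move=> Jj Xj; have [j' [Jj' jK j'K]] := Jinv Jj.
have [phi ephi] := linear_pack (Jlin Jj); have [psi epsi] := linear_pack (Jlin Jj').
subst j j'.
exact: (sdist_comp_linear jK j'K Xj).
Qed.

Let S := [set: W].
Let schwartzJ j f : J j -> schwartz S f -> schwartz S (f \o j).
Proof. by move=> Jj; exact: schwartz_compJ. Qed.

Let symmetrize j (c : C) T : (W -> C) -> C := fun f => T f + c * T (f \o j).

Lemma symmetrize_inv j c T : J j -> sdist_inv S L T -> sdist_inv S L (symmetrize j c T).
Proof.
move=> Jj [sT LT]; split.
  by apply: sdist_combine => //; exact: sdist_compJ.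
move=> l Ll f sf; rewrite /symmetrize (LT l Ll f sf) mul1r mul1r.
have [l' Ll' e] := Jcomm (LJ Ll) Jj.
have sfj : schwartz S (f \o j) by exact: schwartzJ.
have -> : T ((f \o l) \o j) = T (((f \o j) \o l) \o l').
  by rewrite -[(f \o l) \o j]/(f \o (l \o j)) e.
by rewrite (LT l' Ll') ?(LT l Ll) ?mul1r //; apply: schwartzJ => //; exact: LJ.
Qed.

Lemma symmetrize_eigen j c T k e : J j -> J k -> sdist_inv S L T ->
  pushes_to S k e T -> pushes_to S k e (symmetrize j c T).
Proof.
move=> Jj Jk [sT LT] kT f sf; rewrite /symmetrize (kT f sf).
have [l Ll ekj] := Jcomm Jk Jj.
have sfj : schwartz S (f \o j) by exact: schwartzJ.
have -> : T ((f \o k) \o j) = T (((f \o j) \o k) \o l) by rewrite -[(f \o k) \o j]/(f \o (k \o j)) ekj.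
by rewrite (LT l Ll) ?(kT _ sfj); [ring|exact: schwartzJ].
Qed.

Lemma symmetrize_self j c T : J j -> c * c = 1 -> sdist_inv S L T ->
  pushes_to S j c (symmetrize j c T).
Proof.
move=> Jj cc [sT LT] f sf; rewrite /symmetrize.
have -> : T ((f \o j) \o j) = T f.
  by have := LT _ (Jsqr Jj) f sf; rewrite mul1r.
by rewrite mulrDr mulrA cc mul1r addrC.
Qed.

(** One component is treated after the other: of [T + T \o j] and [T - T \o j], on which
    [j] acts by a sign, at least one is nonzero, and it keeps the eigenvalues of
    the other components because they commute with [j] modulo [L]. *)
Lemma eigen_extend N (js : nat -> W -> W) T : (forall i, J (js i)) ->
  sdist_inv S L T -> ~ zero_on S T ->
  exists T', [/\ sdist_inv S L T', ~ zero_on S T',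
    forall i, (i < N)%N -> exists e, pushes_to S (js i) e T'
    & forall k e, J k -> pushes_to S k e T -> pushes_to S k e T'].
Proof.
move=> Jjs LT T0; elim: N => [|N [T' [LT' T'0 eT' kT']]]; first by exists T.
have sym c : c * c = 1 -> ~ zero_on S (symmetrize (js N) c T') ->
    exists T', [/\ sdist_inv S L T', ~ zero_on S T',
    forall i, (i < N.+1)%N -> exists e, pushes_to S (js i) e T'
    & forall k e, J k -> pushes_to S k e T -> pushes_to S k e T'].
  move=> cc nz; exists (symmetrize (js N) c T'); split=> //.
  - exact: symmetrize_inv.
  - move=> i; rewrite ltnS leq_eqVlt => /orP[/eqP ->|/eT'[e he]].
      by exists c; exact: symmetrize_self.
    by exists e; exact: symmetrize_eigen.
  - by move=> k e Jk /(kT' _ _ Jk) h; exact: symmetrize_eigen.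
have [z1|] := pselect (zero_on S (symmetrize (js N) 1 T')).
  apply: (sym (-1)); first by rewrite mulrNN mulr1.
  move=> z2; apply: T'0 => f sf; have := z1 f sf; have := z2 f sf.
  rewrite /symmetrize mul1r mulN1r => h1 h2.
  have : T' f *+ 2 = 0.
    by rewrite mulr2n -[RHS](addr0 0) -{1}h1 -h2 addrACA addNr addr0.
  by move=> /eqP; rewrite mulrn_eq0 => /orP[//|/eqP].
by apply: sym; rewrite mulr1.
Qed.

(** [eigen_extend] applies to the nonzero distribution [T - T \o j0], on which [j0]
    acts by [-1]; the eigenvalues of the result, which is not zero either, are
    well defined on the cosets of [L] and multiplicative. *)
Lemma eigendistribution N (js : nat -> W -> W) j0 T :
  (forall i, J (js i)) ->
  (forall j, J j -> exists2 i, (i < N)%N & exists2 l, L l & j = js i \o l) ->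
  J j0 -> sdist_inv S L T -> ~ pushes_to S j0 1 T ->
  exists (lam : set (W -> W) -> C) T', [/\ sdist_inv S L T', ~ zero_on S T',
    forall j, J j -> pushes_to S j (lam (left_coset L j)) T'
    & [/\ lam (left_coset L j0) = -1,
          forall k, J k -> pushes_to S k 1 T -> lam (left_coset L k) = 1,
          lam L = 1
        & forall j k, J j -> J k -> lam (mul_set (left_coset L j) (left_coset L k)) =
            lam (left_coset L j) * lam (left_coset L k)]].
Proof.
move=> Jjs cov Jj0 LT nT.
have LT0 := symmetrize_inv (-1) Jj0 LT.
have nT0 : ~ zero_on S (symmetrize j0 (-1) T).
  move=> z; apply: nT => f sf; have := z f sf.
  by rewrite /symmetrize mulN1r mul1r => /eqP; rewrite subr_eq0 => /eqP.
have [T' [LT' T'0 eT' kT']] := eigen_extend N Jjs LT0 nT0.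
have [f [sf f0]] : exists f, schwartz S f /\ T' f != 0.
  apply: contrapT => h; apply: T'0 => f sf; apply/eqP; apply: contraT => f0.
  by case: h; exists f.
have uniq j e e' : pushes_to S j e T' -> pushes_to S j e' T' -> e = e'.
  by move=> h h'; apply: (mulIf f0); rewrite -(h f sf) -(h' f sf).
have cosE j e l : J j -> L l -> pushes_to S j e T' -> pushes_to S (j \o l) e T'.
  move=> Jj Ll h g sg; have [_ LT'i] := LT'.
  rewrite -[g \o (j \o l)]/((g \o j) \o l) (LT'i l Ll) ?mul1r ?h //.
  exact: schwartzJ.
have cos_self j : left_coset L j j by exists j => //; exists id.
pose lam (c : set (W -> W)) : C :=
  xget 0 [set e | exists j, [/\ J j, c = left_coset L j & pushes_to S j e T']].
have lamP j e : J j -> pushes_to S j e T' -> lam (left_coset L j) = e.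
  move=> Jj hj; rewrite /lam; case: xgetP => [e' _ [k [Jk ejk hk]]|/(_ e)]; last first.
    by case; exists j.
  have : left_coset L k j by rewrite -ejk.
  by move=> [_ -> [l Ll ekj]]; apply: (uniq j) => //; rewrite -ekj; exact: cosE.
have eJ j : J j -> exists e, pushes_to S j e T'.
  move=> /cov[i iN [l Ll ->]]; have [e he] := eT' i iN.
  by exists e; exact: cosE.
have push j : J j -> pushes_to S j (lam (left_coset L j)) T'.
  by move=> Jj; have [e he] := eJ _ Jj; rewrite (lamP _ e).
have cosM j k : J j -> J k ->
    mul_set (left_coset L j) (left_coset L k) = left_coset L (j \o k).
  move=> Jj Jk; apply/seteqP; split=> g.
    move=> [_ [_ -> [l Ll <-]] [_ [_ -> [l' Ll' <-]] <-]].
    have [l2 Ll2 e] := Jcomm (LJ Ll) Jk.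
    exists (j \o k) => //; exists ((l \o l2) \o l'); first by do 2 apply: Lcomp => //.
    rewrite -[RHS]/(j \o ((l \o k) \o l')) e //.
  move=> [_ -> [l Ll <-]]; exists j; first exact: cos_self.
  by exists (k \o l) => //; exists k => //; exists l.
exists lam, T'; split=> //; split.
- by apply: lamP => //; apply: (kT' _ (-1) Jj0); apply: symmetrize_self; rewrite ?mulrNN ?mulr1.
- by move=> k Jk hk; apply: lamP => //; apply: kT' => //; exact: symmetrize_eigen.
- have -> : L = left_coset L id.
    by apply/seteqP; split=> [l Ll|_ [_ -> [l Ll <-]]] //; exists id => //; exists l.
  by apply: lamP; [exact: LJ|move=> g sg; rewrite mul1r].
- move=> j k Jj Jk; rewrite cosM //; apply: lamP; first exact: Jcomp.
  move=> g sg; have sgj : schwartz S (g \o j) by exact: schwartzJ.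
  by rewrite -[g \o (j \o k)]/((g \o j) \o k) (push k Jk) // (push j Jj) // mulrA (mulrC (lam _)).
Qed.

End Components.

(** * Involutions of groups and central defects *)
(** The laws of a group of matrices: products are associative everywhere, but
    inverses are inverses on [G] only. *)
Record involutive_group (T : Type) (mul : T -> T -> T) (one : T) (inv : T -> T)
    (G : set T) (theta : T -> T) : Prop := InvolutiveGroup {
  ig_mulA : forall x y z, mul x (mul y z) = mul (mul x y) z;
  ig_mul1 : forall x, mul one x = x;
  ig_mulone : forall x, mul x one = x;
  ig_one : G one;
  ig_mul : forall g h, G g -> G h -> G (mul g h);
  ig_inv : forall g, G g -> G (inv g);
  ig_mulV : forall g, G g -> mul (inv g) g = one;
  ig_mulVr : forall g, G g -> mul g (inv g) = one;
  ig_theta : forall g, G g -> G (theta g);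
  ig_thetaM : forall g h, G g -> G h -> theta (mul g h) = mul (theta g) (theta h);
  ig_thetaK : forall g, G g -> theta (theta g) = g }.

Section Involution.
Context {T : Type} {mul : T -> T -> T} {one : T} {inv : T -> T} {G : set T} {theta : T -> T}.
Local Infix "**" := mul (at level 40, left associativity).
Hypothesis I : involutive_group mul one inv G theta.
Let mulA := ig_mulA I.
Let mul1 := ig_mul1 I.
Let mulone := ig_mulone I.
Let G1 := ig_one I.
Let GM := ig_mul I.
Let GV := ig_inv I.
Let mulV := ig_mulV I.
Let mulVr := ig_mulVr I.
Let theta_in := ig_theta I.
Let thetaM := ig_thetaM I.
Let thetaK := ig_thetaK I.
Implicit Types g h z : T.

Let Z : set T := [set z | G z /\ forall g, G g -> z ** g = g ** z].
Let H : set T := [set g | G g /\ theta g = g].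
Let Ath : set T := [set g | G g /\ Z (inv g ** theta g)].

Lemma group_mulKV g h : G g -> g ** (inv g ** h) = h.
Proof. by move=> Gg; rewrite mulA mulVr // mul1. Qed.

Lemma group_mulK g h : G g -> inv g ** (g ** h) = h.
Proof. by move=> Gg; rewrite mulA mulV // mul1. Qed.

Lemma group_mulI g h k : G g -> g ** h = g ** k -> h = k.
Proof. by move=> Gg e; rewrite -(group_mulK h Gg) e group_mulK. Qed.

Lemma group_inv_unique g h : G g -> g ** h = one -> h = inv g.
Proof. by move=> Gg e; apply: (group_mulI Gg); rewrite e mulVr. Qed.

Lemma group_invK g : G g -> inv (inv g) = g.
Proof. by move=> Gg; apply/esym/group_inv_unique; [exact: GV|exact: mulV]. Qed.

Lemma group_invM g h : G g -> G h -> inv (g ** h) = inv h ** inv g.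
Proof.
move=> Gg Gh; apply/esym/group_inv_unique; first exact: GM.
by rewrite -mulA group_mulKV // mulVr.
Qed.

Lemma theta1 : theta one = one.
Proof.
by apply: (group_mulI (theta_in G1)); rewrite -thetaM // !mulone.
Qed.

Lemma thetaV g : G g -> theta (inv g) = inv (theta g).
Proof.
move=> Gg; apply: group_inv_unique; first exact: theta_in.
by rewrite -thetaM ?mulVr ?theta1 //; exact: GV.
Qed.

Lemma centerG z : Z z -> G z. Proof. by case. Qed.

Lemma center1 : Z one.
Proof. by split=> // g _; rewrite mul1 mulone. Qed.

Lemma centerM z w : Z z -> Z w -> Z (z ** w).
Proof.
move=> [Gz cz] [Gw cw]; split=> [|g Gg]; first exact: GM.
by rewrite -mulA cw // mulA cz // mulA.
Qed.

Lemma centerV z : Z z -> Z (inv z).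
Proof.
move=> [Gz cz]; split=> [|g Gg]; first exact: GV.
apply: (group_mulI Gz); rewrite group_mulKV // mulA cz // -mulA.
by rewrite mulVr // mulone.
Qed.

Lemma center_theta z : Z z -> Z (theta z).
Proof.
move=> [Gz cz]; split=> [|g Gg]; first exact: theta_in.
by rewrite -(thetaK Gg) -!thetaM ?cz //; exact: theta_in.
Qed.

Let defect g := inv g ** theta g.

Lemma defect_unique g d : G g -> theta g = g ** d -> defect g = d.
Proof. by move=> Gg e; rewrite /defect e group_mulK. Qed.

Lemma theta_defectE g : G g -> theta g = g ** (inv g ** theta g).
Proof. by move=> Gg; rewrite group_mulKV. Qed.

(** The defect [g^-1 theta g] is multiplicative because it is central. *)
Lemma ext_defectM g h : Ath g -> Ath h -> defect (g ** h) = defect g ** defect h.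
Proof.
move=> [Gg cg] [Gh ch]; apply: defect_unique; first exact: GM.
rewrite thetaM // (theta_defectE Gg) (theta_defectE Gh) -/(defect g) -/(defect h).
have [_ /(_ h Gh) e] : Z (defect g) := cg.
by move: (defect g) (defect h) e => d d' e; rewrite -mulA (mulA d) e !mulA.
Qed.

Lemma extM g h : Ath g -> Ath h -> Ath (g ** h).
Proof.
move=> Ag Ah; split; first by case: Ag Ah => Gg _ [Gh _]; exact: GM.
rewrite -/(defect _) ext_defectM //; apply: centerM; [exact: Ag.2|exact: Ah.2].
Qed.

Lemma fixed_ext h : H h -> Ath h.
Proof. by move=> [Gh th]; split=> //; rewrite th mulV //; exact: center1. Qed.

Lemma defect_fixed h : H h -> defect h = one.
Proof. by move=> [Gh th]; rewrite /defect th mulV. Qed.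

Lemma defect1_fixed g : G g -> defect g = one -> H g.
Proof.
by move=> Gg d1; split=> //; rewrite (theta_defectE Gg) -/(defect g) d1 mulone.
Qed.

Lemma ext_center z : Z z -> Ath z.
Proof.
move=> cz; split; first exact: centerG.
by apply: centerM; [exact: centerV|exact: center_theta].
Qed.

Lemma ext_defectV g : Ath g -> defect (inv g) = inv (defect g).
Proof.
move=> [Gg cg]; have Gd : G (defect g) := centerG cg.
apply: defect_unique; first exact: GV.
rewrite thetaV // (theta_defectE Gg) -/(defect g) group_invM //.
have [_ /(_ _ (GV Gg)) e] : Z (inv (defect g)) := centerV cg.
exact: e.
Qed.

Lemma extV g : Ath g -> Ath (inv g).
Proof.
move=> Ag; split; first by apply: GV; exact: Ag.1.
by rewrite -/(defect _) ext_defectV //; apply: centerV; exact: Ag.2.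
Qed.

Lemma ext1 : Ath one. Proof. exact/ext_center/center1. Qed.

Lemma fixedM g h : H g -> H h -> H (g ** h).
Proof. by move=> [Gg tg] [Gh th]; split; [exact: GM|rewrite thetaM // tg th]. Qed.

Lemma fixedV g : H g -> H (inv g).
Proof. by move=> [Gg tg]; split; [exact: GV|rewrite thetaV // tg]. Qed.

Lemma fixed1 : H one. Proof. by split=> //; exact: theta1. Qed.

Lemma theta_defect g : G g -> theta (defect g) = inv (defect g).
Proof.
move=> Gg; have Gt := theta_in Gg; have GgV := GV Gg.
by rewrite /defect thetaM // thetaV // thetaK // group_invM // group_invK.
Qed.

(** [theta] inverts the defect [d] of [g], so [d] has defect [d^-2], which cancels
    the defect of [g g]. As the centre acts trivially, the component group has
    exponent two. *)
Lemma ext_sqr g : Ath g -> H (g ** g ** (inv g ** theta g)).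
Proof.
move=> Ag; have [Gg cg] := Ag; rewrite -/(defect g) in cg *.
have Gd := centerG cg.
have Acg : Ath (defect g) by exact: ext_center.
apply: defect1_fixed; first by do 2 apply: GM => //.
rewrite (ext_defectM (extM Ag Ag) Acg) (ext_defectM Ag Ag).
have -> : defect (defect g) = inv (defect g) ** inv (defect g).
  by apply: defect_unique; rewrite // theta_defect // group_mulKV.
by rewrite mulA -(mulA (defect g)) mulVr // mulone mulVr.
Qed.

Lemma ext_conj_fixed g h : Ath g -> H h -> H (g ** h ** inv g).
Proof.
move=> Ag Hh; have Ah := fixed_ext Hh; have AV := extV Ag.
apply: defect1_fixed; first exact: (extM (extM Ag Ah) AV).1.
rewrite (ext_defectM (extM Ag Ah) AV) ext_defectM // (defect_fixed Hh) mulone.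
by rewrite ext_defectV // mulVr //; exact: centerG Ag.2.
Qed.

Lemma ext_comm_fixed g h : Ath g -> Ath h -> H (inv (h ** g) ** (g ** h)).
Proof.
move=> Ag Ah; have Ahg := extM Ah Ag; have Agh := extM Ag Ah.
have AV := extV Ahg.
apply: defect1_fixed; first exact: (extM AV Agh).1.
rewrite (ext_defectM AV Agh) ext_defectV // !ext_defectM //.
have [_ /(_ _ (centerG Ah.2)) e] : Z (defect g) := Ag.2.
rewrite e mulV //; apply: GM; [exact: centerG Ah.2|exact: centerG Ag.2].
Qed.

Lemma defect_eq_fixed g h : Ath g -> Ath h ->
  inv g ** theta g = inv h ** theta h -> H (inv g ** h).
Proof.
move=> Ag Ah; rewrite -/(defect g) -/(defect h) => e; have AV := extV Ag.
apply: defect1_fixed; first exact: (extM AV Ah).1.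
by rewrite ext_defectM // ext_defectV // e mulV //; exact: centerG Ah.2.
Qed.

End Involution.

(** * The symmetric pair and its extended fixed group *)
Section SymmetricPair.
Context {R : realType} {n : nat}.
Local Notation C := R[i].
Variables (G : set 'M[C]_n) (theta : 'M[C]_n -> 'M[C]_n).
Hypotheses (aG : alg_group G) (inv : alg_involution G theta).
Implicit Types (g h z : 'M[C]_n) (f : 'M[C]_n -> C).

Let sG : is_subgroup G. Proof. by case: aG. Qed.
Let uG g : G g -> g \in unitmx. Proof. exact: subgroup_unit. Qed.

Lemma mx_involutive : involutive_group (@mulmx C n n n) 1%:M invmx G theta.
Proof.
case: inv => -[ti tM _] tK; split=> //.
- by move=> x y z; rewrite mulmxA.
- by move=> x; rewrite mul1mx.
- by move=> x; rewrite mulmx1.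
- exact: subgroup1.
- exact: subgroupM.
- exact: subgroupV.
- by move=> g /uG; exact: mulVmx.
- by move=> g /uG; exact: mulmxV.
Qed.

Let I := mx_involutive.

Lemma regular_theta f : regular_on G f -> regular_on G (f \o theta).
Proof. by case: inv => -[_ _ h] _; exact: h. Qed.

Local Notation H := (fixed_group G theta).
Local Notation Ath := (extended_fixed_group G theta (Defs.center G)).

Let extG g : Ath g -> G g. Proof. by case. Qed.
Let fixG g : H g -> G g. Proof. by case. Qed.

(** ** The adjoint action on tangent vectors *)
Definition tangent (X : 'M[C]_n) : Prop := exists2 delta,
  point_derivation G delta & forall i j, X i j = delta (entry i j).

Definition anti_tangent (X : 'M[C]_n) : Prop := exists delta,
  [/\ point_derivation G delta,
      (forall f, regular_on G f -> delta (f \o theta) = - delta f)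
    & forall i j, X i j = delta (entry i j)].

Local Notation p := (minus_eigenspace G theta).

Lemma pd_combine a d e : point_derivation G d -> point_derivation G e ->
  point_derivation G (fun f => a * d f + e f).
Proof.
move=> hd he; split.
- by move=> f h rf rh fh; rewrite (pd_ext hd rh fh) (pd_ext he rh fh).
- move=> b f h rf rh.
  by case: hd => _ -> // _; case: he => _ -> // _; ring.
- by move=> f h rf rh; rewrite (pd_mul hd) // (pd_mul he) //; ring.
Qed.

Lemma pd_zero : point_derivation G (fun=> 0).
Proof. by split=> *; rewrite ?mulr0 ?mul0r ?addr0. Qed.

Lemma mem_p X : X \in p <-> anti_tangent X.
Proof.
split; last exact: mem_linear_span.
apply: linear_span_ind => //.
- exists (fun=> 0); split=> [|f _|i j]; [exact: pd_zero|by rewrite oppr0|by rewrite mxE].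
- move=> a x y [d [hd td dx]] [e [he te ex]].
  exists (fun f => a * d f + e f); split.
  + exact: pd_combine.
  + by move=> f rf; rewrite td // te //; ring.
  + by move=> i j; rewrite !mxE dx ex.
Qed.

Lemma anti_tangent_tangent X : anti_tangent X -> tangent X.
Proof. by move=> [d [hd _ dx]]; exists d. Qed.

Lemma Ad_linear g : linear (@Ad R n g).
Proof.
by move=> a x y; rewrite /Ad mulmxDr mulmxDl -scalemxAr -scalemxAl.
Qed.

Lemma AdM g h X : G g -> G h -> Ad (g *m h) X = Ad g (Ad h X).
Proof. by move=> Gg Gh; rewrite /Ad (group_invM I Gg Gh) !mulmxA. Qed.

Lemma Ad1 X : @Ad R n 1%:M X = X.
Proof. by rewrite /Ad invmx1 mulmx1 mul1mx. Qed.

Let conj g (y : 'M[C]_n) := g *m y *m invmx g.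

Lemma conj_in g y : G g -> G y -> G (conj g y).
Proof.
by move=> Gg Gy; apply: subgroupM => //; [exact: subgroupM|exact: subgroupV].
Qed.

Lemma regular_conj g f : G g -> regular_on G f -> regular_on G (f \o conj g).
Proof.
move=> Gg rf; have GV := subgroupV sG Gg.
have r1 := regular_on_mulr sG GV rf.
exact: (regular_on_mull sG Gg r1).
Qed.

Lemma pd_conj g d : G g -> point_derivation G d ->
  point_derivation G (fun f => d (f \o conj g)).
Proof.
move=> Gg hd; split.
- move=> f h rf rh fh; apply: (pd_ext hd); first exact: regular_conj.
  by move=> y Gy; apply: fh; exact: conj_in.
- move=> a f h rf rh; case: hd => _ lin _.
  by rewrite -lin //; exact: regular_conj.
- move=> f h rf rh.
  have := pd_mul hd (regular_conj Gg rf) (regular_conj Gg rh).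
  by rewrite /= /conj mulmx1 (mulmxV (uG Gg)).
Qed.

Lemma Ad_entry g d (X : 'M[C]_n) : G g -> point_derivation G d ->
  (forall i j, X i j = d (entry i j)) ->
  forall i j, Ad g X i j = d (entry i j \o conj g).
Proof.
move=> Gg hd dX i j.
transitivity (d (fun y => \sum_k \sum_l g i l * invmx g k j * entry l k y)).
  rewrite (pd_sum hd); last first.
    move=> k; apply: regular_on_sum => l; apply: regular_on_scale.
    exact: regular_on_entry.
  rewrite /Ad mxE; apply: eq_bigr => k _.
  rewrite (pd_sum hd) ?mxE; last first.
    by move=> l; apply: regular_on_scale; exact: regular_on_entry.
  rewrite mulr_suml; apply: eq_bigr => l _.
  by rewrite (pd_scale hd) ?dX 1?mulrAC //; exact: regular_on_entry.
congr d; apply/funext => y; rewrite /= /conj /entry mxE; apply: eq_bigr => k _.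
by rewrite mxE mulr_suml; apply: eq_bigr => l _; rewrite mulrAC.
Qed.

Lemma tangent_Ad g X : G g -> tangent X -> tangent (Ad g X).
Proof.
move=> Gg [d hd dX]; exists (fun f => d (f \o conj g)); first exact: pd_conj.
exact: Ad_entry.
Qed.

Lemma Ad_center z X : Defs.center G z -> tangent X -> Ad z X = X.
Proof.
move=> [Gz cz] [d hd dX].
apply/matrixP => i j; rewrite (Ad_entry Gz hd dX) dX.
apply: (pd_ext hd); first exact: regular_on_entry.
by move=> y Gy; rewrite /= /conj (cz y Gy) -mulmxA (mulmxV (uG Gz)) mulmx1.
Qed.

Lemma Ad_p g X : Ath g -> X \in p -> Ad g X \in p.
Proof.
move=> Ag; have [Gg cg] := Ag.
rewrite !mem_p => -[d [hd td dX]]; exists (fun f => d (f \o conj g)); split.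
- exact: pd_conj.
- move=> f rf; rewrite -td; last exact: regular_conj.
  apply: (pd_ext hd); first exact/regular_theta/regular_conj.
  move=> y Gy; rewrite /= /conj; congr f; have GV := subgroupV sG Gg.
  have Gty := ig_theta I Gy; have Gd := centerG cg.
  rewrite (ig_thetaM I (subgroupM sG Gg Gy) GV) (ig_thetaM I Gg Gy) (thetaV I Gg).
  rewrite (theta_defectE I Gg) (group_invM I Gg Gd).
  have [_ /(_ _ Gty)] := cg; have := mulmxV (uG Gd).
  move: (invmx g *m theta g) (theta y) => e y' eV ey.
  by rewrite -(mulmxA g e) ey !mulmxA -(mulmxA _ e) eV mulmx1.
- exact: Ad_entry.
Qed.

Local Notation V := (datum_V G theta).

Lemma V_sub_p : (V <= p)%VS.
Proof.
apply: (linear_spanP _).2 => x [_ [u [[h Hh <-] pu ->]]].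
by rewrite memvB ?Ad_p //; exact: (fixed_ext I).
Qed.

Lemma Ad_V g X : Ath g -> X \in V -> Ad g X \in V.
Proof.
move=> Ag; apply: (@linear_span_ind R _ _ (fun X => Ad g X \in V)).
- by rewrite /Ad mulmx0 mul0mx mem0v.
- by move=> a x y hx hy; rewrite Ad_linear memvD ?memvZ.
move=> _ [_ [u [[h Hh <-] pu ->]]].
have [Gg _] := Ag; have [Gh _] := Hh; have GV := subgroupV sG Gg.
have -> : Ad g (Ad h u - u) = Ad (g *m h *m invmx g) (Ad g u) - Ad g u.
  rewrite -(AdM _ (conj_in Gg Gh) Gg) -mulmxA (mulVmx (uG Gg)) mulmx1 AdM //.
  by rewrite (addrC _ (- u)) -scaleN1r Ad_linear scaleN1r addrC.
apply: mem_linear_span; exists (Ad (g *m h *m invmx g)), (Ad g u); split=> //.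
  by exists (g *m h *m invmx g) => //; exact: (ext_conj_fixed I Ag Hh).
exact: Ad_p.
Qed.

Local Notation L := (datum_L G theta).
Local Notation J := (datum_J G theta).

Lemma Ad_on_linear (U : {vspace 'M[C]_n}) g : linear (@Ad_on R n U g).
Proof. by move=> a x y; rewrite /Ad_on /restrict_to !linearP Ad_linear linearP. Qed.

Lemma Ad_on_val g (x : subvs_of V) : Ath g -> vsval (Ad_on g x) = Ad g (vsval x).
Proof. by move=> Ag; rewrite /Ad_on /restrict_to vsprojK //; exact/Ad_V/subvsP. Qed.

Lemma Ad_onM g h : Ath g -> Ath h ->
  @Ad_on R n V (g *m h) = Ad_on g \o Ad_on h.
Proof.
move=> Ag Ah; apply/funext => x; apply: val_inj => /=.
rewrite (Ad_on_val _ (extM I Ag Ah)) (Ad_on_val _ Ag) (Ad_on_val _ Ah).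
by rewrite (AdM _ (extG Ag) (extG Ah)).
Qed.

Lemma Ad_on1 : @Ad_on R n V 1%:M = id.
Proof.
apply/funext => x; apply: val_inj; rewrite /= Ad_on_val ?Ad1 //.
exact: (ext1 I).
Qed.

Lemma Ad_on_center g z : Ath g -> Defs.center G z -> @Ad_on R n V (g *m z) = Ad_on g.
Proof.
move=> Ag cz; have Az : Ath z := ext_center I cz.
rewrite (Ad_onM Ag Az).
apply/funext => x; congr (Ad_on g _); apply: val_inj.
rewrite /= (Ad_on_val _ Az) Ad_center //.
by apply/anti_tangent_tangent/mem_p/(subvP V_sub_p)/subvsP.
Qed.

Lemma L_id : L id. Proof. by exists 1%:M; [exact: (fixed1 I)|exact: Ad_on1]. Qed.

Lemma L_comp l l' : L l -> L l' -> L (l \o l').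
Proof.
move=> [h Hh <-] [h' Hh' <-]; exists (h *m h'); first exact: (fixedM I).
by apply: Ad_onM; exact: (fixed_ext I).
Qed.

Lemma L_inv l : L l -> exists2 l', L l' & l \o l' = id.
Proof.
move=> [h Hh <-]; exists (Ad_on (invmx h)); first by exists (invmx h) => //; exact: (fixedV I).
rewrite -(Ad_onM (fixed_ext I Hh) (fixed_ext I (fixedV I Hh))).
by rewrite (mulmxV (uG (fixG Hh))) Ad_on1.
Qed.

Lemma coset_L j l : L l -> left_coset L (j \o l) = left_coset L j.
Proof.
move=> Ll; apply/seteqP; split=> k [_ -> [l' Ll' <-]].
  by exists j => //; exists (l \o l') => //; exact: L_comp.
have [m Lm e] := L_inv Ll; exists (j \o l) => //; exists (m \o l'); first exact: L_comp.
by rewrite -[LHS]/(j \o ((l \o m) \o l')) e.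
Qed.

Lemma L_sub_J : L `<=` J.
Proof. by move=> _ [h Hh <-]; exists h => //; exact: (fixed_ext I). Qed.

Lemma J_linear j : J j -> linear j.
Proof. by move=> [g _ <-]; exact: Ad_on_linear. Qed.

Lemma J_comp j k : J j -> J k -> J (j \o k).
Proof.
move=> [g Ag <-] [h Ah <-]; exists (g *m h); first exact: (extM I Ag Ah).
exact: Ad_onM.
Qed.

Lemma J_inv j : J j -> exists j', [/\ J j', cancel j j' & cancel j' j].
Proof.
move=> [g Ag <-]; have AV : Ath (invmx g) := extV I Ag; have ug := uG (extG Ag).
exists (Ad_on (invmx g)); split; first by exists (invmx g).
- move=> x; rewrite -[LHS]/((Ad_on _ \o Ad_on _) x) -(Ad_onM AV Ag) (mulVmx ug).
  by rewrite Ad_on1.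
- move=> x; rewrite -[LHS]/((Ad_on _ \o Ad_on _) x) -(Ad_onM Ag AV) (mulmxV ug).
  by rewrite Ad_on1.
Qed.

Lemma J_comm j k : J j -> J k -> exists2 l, L l & j \o k = k \o j \o l.
Proof.
move=> [g Ag <-] [h Ah <-]; have Hc := ext_comm_fixed I Ag Ah.
have Ahg := extM I Ah Ag.
exists (Ad_on (invmx (h *m g) *m (g *m h))); first by eexists; [exact: Hc|].
rewrite -(Ad_onM Ag Ah) -(Ad_onM Ah Ag) -(Ad_onM Ahg (fixed_ext I Hc)).
by rewrite (group_mulKV I _ (extG Ahg)).
Qed.

Lemma J_normal j l : J j -> L l -> exists2 l', L l' & j \o l = l' \o j.
Proof.
move=> [g Ag <-] [h Hh <-]; have Hc := ext_conj_fixed I Ag Hh.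
exists (Ad_on (g *m h *m invmx g)); first by eexists; [exact: Hc|].
rewrite -(Ad_onM Ag (fixed_ext I Hh)) -(Ad_onM (fixed_ext I Hc) Ag).
by rewrite (mulmxKV (uG (extG Ag))).
Qed.

Lemma J_sqr j : J j -> L (j \o j).
Proof.
move=> [g Ag <-]; exists (g *m g *m (invmx g *m theta g)); first exact: (ext_sqr I).
rewrite (Ad_on_center (extM I Ag Ag)); last exact: Ag.2.
exact: Ad_onM.
Qed.

End SymmetricPair.

(** * Finiteness of the centre of a semisimple group *)
Section ClosedSubsets.
Context {R : realType} {n : nat}.
Local Notation C := R[i].
Implicit Types (G K Y : set 'M[C]_n).

(** The descending chain condition on closed subsets, in terms of functions. *)
Lemma no_infinite_descent G (f : nat -> 'M[C]_n -> C) (x : nat -> 'M[C]_n) :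
  is_subgroup G -> (forall k, regular_on G (f k)) -> (forall k, G (x k)) ->
  (forall k, f k (x k) != 0) -> (forall i k, (i < k)%N -> f i (x k) = 0) -> False.
Proof.
move=> sG rf Gx fx0 fx.
have [N [s [_ /(_ (exist _ _ (Gx N))) /= e]]] :=
  gen_alg_noetherian (fun k => gen_alg_regular (rf k)).
have /eqP := fx0 N; apply; rewrite e big1 // => i _.
by rewrite fx ?mulr0.
Qed.

Lemma zclosed_in_sub G Y : zclosed_in G Y -> Y `<=` G.
Proof. by move=> [E _ ->] x []. Qed.

Lemma zclosed_in_trans G K Y : zclosed_in G K -> zclosed_in K Y -> zclosed_in G Y.
Proof.
move=> cK [E rE ->]; have KG := zclosed_in_sub cK; case: cK => [F rF eK].
exists (F `|` [set h | regular_GL h /\ exists2 f, E f & forall g, K g -> f g = h g]).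
  by move=> h [/rF//|[rh _]]; exact: regular_on_GL.
apply/seteqP; split=> x.
  move=> [Kx Ex]; split; first exact: KG.
  move=> f [Ff|[rf [g Eg gf]]]; last by rewrite -gf // Ex.
  by move: Kx; rewrite eK => -[_]; apply.
move=> [Gx hx]; have Kx : K x by rewrite eK; split=> // f Ff; apply: hx; left.
split=> // f Ef; have [h rh fh] := rE f Ef; rewrite fh //; apply: hx; right.
by split=> //; exists f.
Qed.

Lemma zclosed_inI G K Y : zclosed_in G K -> zclosed_in G Y -> zclosed_in G (K `&` Y).
Proof.
move=> [E rE ->] [F rF ->]; exists (E `|` F); first by move=> f [/rE|/rF].
apply/seteqP; split=> x.
  by move=> [[Gx Ex] [_ Fx]]; split=> // f [/Ex|/Fx].
by move=> [Gx h]; split; split=> // f hf; apply: h; [left|right].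
Qed.

Lemma zclosed_inU G K Y : zclosed_in G K -> zclosed_in G Y -> zclosed_in G (K `|` Y).
Proof.
move=> [E rE ->] [F rF ->].
exists [set h | exists f g, [/\ E f, F g & h = fun x => f x * g x]].
  by move=> _ [f [g [/rE rf /rF rg ->]]]; exact: regular_on_mul.
apply/seteqP; split=> x.
  move=> [[Gx h]|[Gx h]]; split=> // _ [f [g [Ef Fg ->]]].
    by rewrite (h _ Ef) mul0r.
  by rewrite (h _ Fg) mulr0.
move=> [Gx h]; have [Ex|/existsNP[f /not_implyP[Ef fx]]] :=
  pselect (forall f, E f -> f x = 0); first by left.
right; split=> // g Fg; have : f x * g x = 0.
  by apply: (h (fun x => f x * g x)); exists f, g.
by move=> /eqP; rewrite mulf_eq0 => /orP[/eqP //|/eqP].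
Qed.

Lemma zclosed_in_preim G (u : 'M[C]_n -> 'M[C]_n) Y :
  (forall f, regular_on G f -> regular_on G (f \o u)) -> (forall g, G g -> G (u g)) ->
  zclosed_in G Y -> zclosed_in G [set g | G g /\ Y (u g)].
Proof.
move=> ru Gu [E rE ->]; exists [set f \o u | f in E].
  by move=> _ [f /rE rf <-]; exact: ru.
apply/seteqP; split=> x.
  by move=> [Gx [_ h]]; split=> // _ [f Ef <-]; exact: h.
move=> [Gx h]; split=> //; split; first exact: Gu.
by move=> f Ef; apply: (h (f \o u)); exists f.
Qed.

Lemma zclosed_in_refl G : zclosed_in G G.
Proof.
exists set0 => //; apply/seteqP; split=> x; last by case.
by move=> Gx; split.
Qed.

Lemma regular_inv G f : is_subgroup G -> regular_on G f ->
  regular_on G (f \o (fun g => invmx g)).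
Proof.
move=> sG; have [GU _ _ GV] := sG; apply: regular_on_comp => // [i j|].
  exact: regular_on_inv.
apply: (@regular_on_ext _ _ _ _ (fun g => \det g)) => [g /GU|].
  by rewrite /GL /= => ug; rewrite det_inv invrK.
exact/regular_on_GL/regular_GL_detid.
Qed.

Section IdentityComponent.
Variable (G : set 'M[C]_n) (sG : is_subgroup G).

Let clopen K := [/\ zclosed_in G K, zclosed_in G (G `\` K) & K 1%:M].

(** A minimal open and closed subset containing [1] exists by the descending chain
    condition; it is the least one, so translations by its elements preserve it. *)
Lemma identity_component : exists K, [/\ is_subgroup K, clopen K & zconnected K].
Proof.
have [K cK minK] : exists2 K, clopen K &
    forall K', clopen K' -> K' `<=` K -> K' = K.
  apply: contrapT => nomin.
  have next K : exists K', clopen K -> [/\ clopen K', K' `<=` K & K' <> K].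
    have [cK|ncK] := pselect (clopen K); last by exists K.
    apply: contrapT => h; apply: nomin; exists K => // K' cK' K'K.
    by apply: contrapT => ne; apply: h; exists K'.
  have [nx nxP] := choice next.
  pose K k := iter k nx G.
  have cK k : clopen (K k).
    elim: k => [|k /nxP[]//]; split; [exact: zclosed_in_refl| |exact: subgroup1].
    rewrite setDv; exists [set fun=> 1].
      by move=> _ ->; exact: regular_on_cst.
    apply/seteqP; split=> // x [_ /(_ _ erefl)] /eqP.
    by rewrite oner_eq0.
  have Kmono i k : (i <= k)%N -> K k `<=` K i.
    elim: k => [|k ih]; first by rewrite leqn0 => /eqP ->.
    rewrite leq_eqVlt => /orP[/eqP -> //|/ih].
    by apply: subset_trans; have [] := nxP _ (cK k).
  have sep k : exists p : 'M[C]_n * ('M[C]_n -> C),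
      [/\ K k p.1, regular_on G p.2, p.2 p.1 != 0 & forall y, K k.+1 y -> p.2 y = 0].
    have [_ sub ne] := nxP _ (cK k).
    have [x [Kx nKx]] : exists x, K k x /\ ~ K k.+1 x.
      apply: contrapT => h; apply: ne; apply/seteqP; split=> // x Kx.
      by apply: contrapT => nKx; apply: h; exists x.
    have [[E rE eK] _ _] := cK k.+1.
    have [f Ef fx] : exists2 f, E f & f x <> 0.
      apply: contrapT => h; apply: nKx; rewrite eK; split.
        by have [/zclosed_in_sub KG _ _] := cK k; exact: KG.
      by move=> f Ef; apply: contrapT => fx; apply: h; exists f.
    exists (x, f); split=> //=; [exact: rE|exact/eqP|].
    move=> y Ky; have : K k.+1 y by exact: Ky.
    by rewrite eK => -[_]; apply.
  have [xf xfP] := choice sep.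
  apply: (@no_infinite_descent G (fun k => (xf k).2) (fun k => (xf k).1)) => //.
  - by move=> k; have [] := xfP k.
  - move=> k; have [Kx _ _ _] := xfP k; have [/zclosed_in_sub KG _ _] := cK k.
    exact: KG.
  - by move=> k; have [] := xfP k.
  - move=> i k ik; have [_ _ _ h] := xfP i; apply: h.
    by have [Kx _ _ _] := xfP k; exact: Kmono Kx.
have least K' : clopen K' -> K `<=` K'.
  move=> [c1 c2 c3]; have [k1 k2 k3] := cK.
  rewrite -(minK (K `&` K')); first exact: subIsetr.
  - split=> //; first exact: zclosed_inI.
    by rewrite setDIr; exact: zclosed_inU.
  - exact: subIsetl.
have KG : K `<=` G by have [/zclosed_in_sub] := cK.
have Keq u : (forall f, regular_on G f -> regular_on G (f \o u)) ->
    (forall x, G x -> G (u x)) -> K (u 1%:M) ->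
    clopen [set x | G x /\ K (u x)].
  move=> ru Gu Ku; have [c1 c2 c3] := cK; split.
  - exact: zclosed_in_preim.
  - have := zclosed_in_preim ru Gu c2; congr (zclosed_in G); apply/seteqP; split=> x.
      by move=> [Gx [_ nK]]; split=> // -[].
    by move=> [Gx h]; do 2 split=> //; [exact: Gu|move=> Kx; apply: h].
  - by split=> //; exact: subgroup1.
have KM x y : K x -> K y -> K (x *m y).
  move=> Kx Ky; have Gx := KG _ Kx.
  have : clopen [set y | G y /\ K (x *m y)].
    apply: (Keq (fun y => x *m y)) => [f rf|z Gz|]; last by rewrite mulmx1.
    - exact: (regular_on_mull sG Gx rf).
    - exact: subgroupM.
  by move=> /least /(_ y Ky)[].
have KV x : K x -> K (invmx x).
  move=> Kx; have : clopen [set y | G y /\ K (invmx y)].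
    apply: (Keq (fun y => invmx y)) => [f rf|z Gz|].
    - exact: regular_inv.
    - exact: subgroupV.
    - by rewrite invmx1; have [] := cK.
  by move=> /least /(_ x Kx)[].
exists K; split=> //.
  split=> //; [|by have [] := cK].
  by move=> x /KG; have [GU _ _ _] := sG; exact: GU.
have [c1 c2 c3] := cK.
have half Y1 Y2 : zclosed_in K Y1 -> zclosed_in K Y2 -> Y1 `|` Y2 = K ->
    Y1 `&` Y2 = set0 -> Y1 1%:M -> Y2 = set0.
  move=> z1 z2 eU eI Y11; have KY1 : K `<=` Y1.
    apply: least; split=> //; first exact: zclosed_in_trans z1.
    have -> : G `\` Y1 = Y2 `|` (G `\` K).
      apply/seteqP; split=> x.
        move=> [Gx nY1]; have [Kx|nKx] := pselect (K x); last by right.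
        by move: Kx; rewrite -eU => -[|Y2x]; [|left].
      move=> [Y2x|[Gx nKx]]; last by split=> // Y1x; apply: nKx; rewrite -eU; left.
      have Kx : K x by rewrite -eU; right.
      split; first exact: KG.
      by move=> Y1x; have : (Y1 `&` Y2) x by []; rewrite eI.
    by apply: zclosed_inU => //; exact: zclosed_in_trans z2.
  apply/seteqP; split=> // x Y2x; have : (Y1 `&` Y2) x.
    by split=> //; apply: KY1; rewrite -eU; right.
  by rewrite eI.
move=> Y1 Y2 z1 z2 eU eI; have : (Y1 `|` Y2) 1%:M by rewrite eU.
case=> [h|h]; [right; exact: half h|left; apply: (half Y2 Y1) => //].
- by rewrite setUC.
- by rewrite setIC.
Qed.

(** Removing infinitely many points one by one, by translates of a function that
    isolates [1], would be an infinite descent. *)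
Lemma finite_discrete : zclosed_in G (G `\ 1%:M) -> finite_set G.
Proof.
move=> [E rE e1]; apply: contrapT => infG.
have fresh (l : seq 'M[C]_n) : exists y, G y /\ y \notin l.
  apply: contrapT => h; apply: infG; apply: sub_finite_set (finite_seq l) => y Gy /=.
  by apply: contraT => yl; case: h; exists y.
have [nx nxP] := choice fresh.
pose F k := iter k (fun l => rcons l (nx l)) [::].
pose x k := nx (F k).
have Gx k : G (x k) by exact: (nxP _).1.
have xF i k : (i < k)%N -> x i \in F k.
  elim: k => // k ih; rewrite ltnS leq_eqVlt /= mem_rcons inE.
  by move=> /orP[/eqP ->|/ih ->]; rewrite ?eqxx ?orbT.
have [g Eg g1] : exists2 g, E g & g 1%:M != 0.
  apply: contrapT => h; suff [_] : (G `\ 1%:M) 1%:M by apply.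
  rewrite e1; split; first exact: subgroup1.
  by move=> f Ef; apply/eqP; apply: contraT => f1; case: h; exists f.
have g0 y : G y -> y <> 1%:M -> g y = 0.
  by move=> Gy ny; have : (G `\ 1%:M) y by []; rewrite e1 => -[_]; apply.
have ux k := subgroup_unit sG (Gx k).
apply: (@no_infinite_descent G (fun k y => g (invmx (x k) *m y)) x) => //.
- by move=> k; apply: regular_on_mull => //; [exact: subgroupV|exact: rE].
- by move=> k; rewrite (mulVmx (ux k)).
- move=> i k ik; apply: g0; first by apply: subgroupM => //; exact: subgroupV.
  move=> e; have ei : x i = x k by rewrite -[RHS](mulKVmx (ux i)) e mulmx1.
  by have := (nxP (F k)).2; rewrite -/(x k) -ei xF.
Qed.

End IdentityComponent.

Lemma subgroup_center G : is_subgroup G -> is_subgroup (Defs.center G).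
Proof.
move=> sG; have cG x : Defs.center G x -> G x by case.
split.
- by move=> x [/(subgroup_unit sG)].
- by split=> [|g _]; [exact: subgroup1|rewrite mulmx1 mul1mx].
- move=> x y [Gx hx] [Gy hy]; split=> [|g Gg]; first exact: subgroupM.
  by rewrite -mulmxA (hy g Gg) mulmxA (hx g Gg) mulmxA.
- move=> x [Gx hx]; have ux := subgroup_unit sG Gx.
  split=> [|g Gg]; first exact: subgroupV.
  by rewrite -[LHS](mulmxK ux) -(mulmxA _ g) -(hx g Gg) (mulKmx ux).
Qed.

Lemma zclosed_center G : is_subgroup G -> zclosed_in G (Defs.center G).
Proof.
move=> sG; exists [set f | exists g i j, G g /\ f = fun x => (x *m g) i j - (g *m x) i j].
  move=> _ [g [i [j [Gg ->]]]].
  apply: regular_on_sub; [apply: (regular_on_mulr sG Gg (f := entry i j))|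
    apply: (regular_on_mull sG Gg (f := entry i j))]; exact: regular_on_entry.
apply/seteqP; split=> x [Gx h]; split=> //.
  by move=> _ [g [i [j [Gg ->]]]]; rewrite h // subrr.
move=> g Gg; apply/matrixP => i j; apply/eqP; rewrite -subr_eq0; apply/eqP.
by apply: (h (fun x => (x *m g) i j - (g *m x) i j)); exists g, i, j.
Qed.

Lemma subgroup_trivial : @is_subgroup R n [set 1%:M].
Proof.
split=> //.
- by move=> _ ->; rewrite /GL /= unitmx1.
- by move=> _ _ -> ->; rewrite /= mulmx1.
- by move=> _ ->; rewrite /= invmx1.
Qed.

(** The identity component of the centre is a connected solvable normal subgroup,
    hence trivial, so the centre is discrete. *)
Lemma semisimple_center_finite G : semisimple G -> finite_set (Defs.center G).
Proof.
move=> [[sG cG] _ ss]; have sC := subgroup_center sG.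
have [K [sK [c1 c2 K1] zK]] := identity_component sC.
have KC : K `<=` Defs.center G := zclosed_in_sub c1.
have K0 : K = [set 1%:M].
  apply: ss => //.
  - split=> //; apply: zclosed_in_trans cG _.
    exact: zclosed_in_trans (zclosed_center sG) c1.
  - split=> [x /KC[]//|g k Gg Kk]; have [_ hk] := KC _ Kk.
    by rewrite -(hk g Gg) -mulmxA (mulmxV (subgroup_unit sG Gg)) mulmx1.
  - exists 1%N; apply/seteqP; split=> x /=.
      move=> Kx; apply: (Kx [set 1%:M]); first exact: subgroup_trivial.
      move=> _ [g Kg [h Kh <-]] /=.
      have [Gg hg] := KC _ Kg; have [Gh _] := KC _ Kh.
      rewrite (hg h Gh) -(mulmxA h) (mulmxV (subgroup_unit sG Gg)) mulmx1.
      exact: (mulmxV (subgroup_unit sG Gh)).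
    by move=> -> K' [_ K'1 _ _].
by apply: (finite_discrete sC); rewrite -K0.
Qed.

End ClosedSubsets.

(** * Tori, products and the finiteness of the component group *)
Section Torus.
Context {R : realType} {m : nat}.
Local Notation C := R[i].
Variables (Z : set 'M[C]_m) (tZ : torus Z).

Let sZ : is_subgroup Z. Proof. by case: tZ => -[]. Qed.

Let diag_unit r (d : 'rV[C]_r) : diagonal_torus (diag_mx d) <-> diag_mx d \in unitmx.
Proof. by split=> [[]//|u]; split=> //; exact: diag_mx_is_diag. Qed.

Lemma torus_comm z w : Z z -> Z w -> z *m w = w *m z.
Proof.
have [_ [r [phi [[_ hM _] [psi [[pD _ _] pK pK']]]]]] := tZ.
move=> Zz Zw; have Dz := pD z Zz; have Dw := pD w Zw.
rewrite -(pK' z Zz) -(pK' w Zw) -!hM //; congr phi.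
have [_ /diag_mxP[d ->]] := Dz; have [_ /diag_mxP[e ->]] := Dw.
by rewrite !mulmx_diag; congr diag_mx; apply/rowP => j; rewrite !mxE mulrC.
Qed.

Lemma torus_sqrt z : Z z -> exists2 w, Z w & w *m w = z.
Proof.
have [_ [r [phi [[hZ hM _] [psi [[pD _ _] pK pK']]]]]] := tZ.
move=> Zz; have [uz /diag_mxP[d ed]] := pD z Zz.
pose e := \row_j sqrtC (d 0 j).
have ee : diag_mx e *m diag_mx e = diag_mx d.
  by rewrite mulmx_diag; congr diag_mx; apply/rowP => j; rewrite !mxE -expr2 sqrtCK.
have De : diagonal_torus (diag_mx e).
  by apply/diag_unit; move: uz; rewrite ed -ee unitmx_mul => /andP[].
exists (phi (diag_mx e)); first exact: hZ.
by rewrite -hM // ee -ed pK'.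
Qed.

Lemma torus_sqrt_finite w : finite_set [set z | Z z /\ z *m z = w].
Proof.
have [_ [r [phi [[hZ hM _] [psi [[pD pM _] pK pK']]]]]] := tZ.
pose d (b : {ffun 'I_r -> bool}) : 'M[C]_r :=
  diag_mx (\row_j ((-1) ^+ b j * sqrtC (psi w j j))).
apply: (@sub_finite_set _ _ ((phi \o d) @` [set: {ffun 'I_r -> bool}])); last first.
  exact/finite_image/finite_finset.
move=> z [Zz zz]; have [uz /diag_mxP[e ee]] := pD z Zz.
pose b := [ffun j => e 0 j != sqrtC (psi w j j)].
exists b => //=; rewrite -[RHS](pK' z Zz); congr phi; rewrite ee /d; congr diag_mx.
apply/rowP => j; rewrite mxE ffunE.
have e2 : e 0 j ^+ 2 = sqrtC (psi w j j) ^+ 2.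
  by rewrite sqrtCK -zz pM // ee mulmx_diag mxE eqxx mulr1n mxE expr2.
have [-> |ne] := eqVneq (e 0 j); first by rewrite expr0 mul1r.
move/eqP: e2; rewrite eqf_sqr (negbTE ne) /= => /eqP ->.
by rewrite expr1 mulN1r.
Qed.

End Torus.

Section Product.
Context {R : realType} {m n : nat}.
Local Notation C := R[i].
Variables (Z : set 'M[C]_m) (S : set 'M[C]_n).
Hypotheses (aZ : alg_group Z) (aS : alg_group S).
Local Notation G := (prod_group Z S).
Local Notation blk z s := (block_mx z 0 0 s).

Let sZ : is_subgroup Z. Proof. by case: aZ. Qed.
Let sS : is_subgroup S. Proof. by case: aS. Qed.

Lemma blkM (z z' : 'M[C]_m) (s s' : 'M[C]_n) :
  blk z s *m blk z' s' = blk (z *m z') (s *m s').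
Proof. by rewrite mulmx_block !mulmx0 !mul0mx !addr0 add0r. Qed.

Lemma blk1 : blk 1%:M 1%:M = 1%:M :> 'M[C]_(m + n).
Proof. by rewrite -scalar_mx_block. Qed.

Lemma blk_inj (z z' : 'M[C]_m) (s s' : 'M[C]_n) :
  blk z s = blk z' s' -> z = z' /\ s = s'.
Proof. by move=> /eq_block_mx[-> _ _ ->]. Qed.

Lemma blk_unit (z : 'M[C]_m) (s : 'M[C]_n) :
  (blk z s \in unitmx) = (z \in unitmx) && (s \in unitmx).
Proof. by rewrite !unitmxE det_ublock unitrM. Qed.

Lemma invmx_blk (z : 'M[C]_m) (s : 'M[C]_n) : z \in unitmx -> s \in unitmx ->
  invmx (blk z s) = blk (invmx z) (invmx s).
Proof.
move=> uz us; have u : blk z s \in unitmx by rewrite blk_unit uz us.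
rewrite -[RHS](mulKmx u) blkM (mulmxV uz) (mulmxV us) blk1.
by rewrite mulmx1.
Qed.

Lemma prod_in z s : Z z -> S s -> G (blk z s).
Proof. by move=> Zz Ss; exists z => //; exists s. Qed.

Lemma subgroup_prod : is_subgroup G.
Proof.
split.
- move=> _ [z Zz [s Ss <-]]; rewrite /GL /= blk_unit.
  by rewrite (subgroup_unit sZ Zz) (subgroup_unit sS Ss).
- by rewrite -blk1; apply: prod_in; exact: subgroup1.
- move=> _ _ [z Zz [s Ss <-]] [z' Zz' [s' Ss' <-]]; rewrite blkM.
  by apply: prod_in; exact: subgroupM.
- move=> _ [z Zz [s Ss <-]].
  rewrite (invmx_blk (subgroup_unit sZ Zz) (subgroup_unit sS Ss)).
  by apply: prod_in; exact: subgroupV.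
Qed.

(** Regular functions on a factor extend to the product, as the inverse of
    [\det z] is that of the whole determinant times [\det s]. *)
Lemma regular_blk h : regular_GL h -> exists2 k : 'M[C]_(m + n) -> C, regular_GL k &
  forall (z : 'M[C]_m) (s : 'M[C]_n), s \in unitmx -> k (blk z s) = h z.
Proof.
elim=> {h} [h|c|f g _ [k rk ek] _ [l rl el]|f g _ [k rk ek] _ [l rl el]].
- case=> [[i [j ->]]|->].
    exists (entry (lshift n i) (lshift n j)); first exact: regular_GL_entry.
    by move=> z s _; rewrite /entry block_mxEul.
  exists (fun g => (\det g)^-1 * \det (drsubmx g)).
    apply: gen_alg_mul; first exact: regular_GL_invdet.
    apply: (gen_alg_det (A := fun g : 'M[C]_(m + n) => drsubmx g)) => i j.
    have -> : (fun g : 'M[C]_(m + n) => drsubmx g i j) =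
        entry (rshift m i) (rshift m j) by apply/funext => g; rewrite !mxE.
    exact: regular_GL_entry.
  move=> z s; rewrite unitmxE unitfE block_mxKdr det_ublock => s0.
  by rewrite invfM mulfVK.
- by exists (fun=> c) => //; exact: gen_alg_cst.
- exists (fun x => k x + l x); first exact: gen_alg_add.
  by move=> z s us; rewrite ek // el.
- exists (fun x => k x * l x); first exact: gen_alg_mul.
  by move=> z s us; rewrite ek // el.
Qed.

Lemma regular_blkr h : regular_GL h -> exists2 k : 'M[C]_(m + n) -> C, regular_GL k &
  forall (z : 'M[C]_m) (s : 'M[C]_n), z \in unitmx -> k (blk z s) = h s.
Proof.
elim=> {h} [h|c|f g _ [k rk ek] _ [l rl el]|f g _ [k rk ek] _ [l rl el]].
- case=> [[i [j ->]]|->].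
    exists (entry (rshift m i) (rshift m j)); first exact: regular_GL_entry.
    by move=> z s _; rewrite /entry block_mxEdr.
  exists (fun g => (\det g)^-1 * \det (ulsubmx g)).
    apply: gen_alg_mul; first exact: regular_GL_invdet.
    apply: (gen_alg_det (A := fun g : 'M[C]_(m + n) => ulsubmx g)) => i j.
    have -> : (fun g : 'M[C]_(m + n) => ulsubmx g i j) =
        entry (lshift n i) (lshift n j) by apply/funext => g; rewrite !mxE.
    exact: regular_GL_entry.
  move=> z s; rewrite unitmxE unitfE block_mxKul det_ublock => z0.
  by rewrite mulrC invfM mulVKf.
- by exists (fun=> c) => //; exact: gen_alg_cst.
- exists (fun x => k x + l x); first exact: gen_alg_add.
  by move=> z s us; rewrite ek // el.
- exists (fun x => k x * l x); first exact: gen_alg_mul.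
  by move=> z s us; rewrite ek // el.
Qed.

Lemma alg_group_prod : alg_group G.
Proof.
split; first exact: subgroup_prod.
have [_ [E rE eZ]] := aZ; have [_ [F rF eS]] := aS.
pose off := [set f : 'M[C]_(m + n) -> C | (exists i j, f = entry (lshift n i) (rshift m j))
   \/ (exists i j, f = entry (rshift m i) (lshift n j))].
pose E' := [set k : 'M[C]_(m + n) -> C | regular_GL k /\ exists2 f, E f &
  forall (z : 'M[C]_m) (s : 'M[C]_n), z \in unitmx -> s \in unitmx -> k (blk z s) = f z].
pose F' := [set k : 'M[C]_(m + n) -> C | regular_GL k /\ exists2 f, F f &
  forall (z : 'M[C]_m) (s : 'M[C]_n), z \in unitmx -> s \in unitmx -> k (blk z s) = f s].
exists (off `|` (E' `|` F')).
  move=> f [[[i [j ->]]|[i [j ->]]]|[[rf _]|[rf _]]]; try exact: regular_on_GL.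
  - exact: regular_on_entry.
  - exact: regular_on_entry.
apply/seteqP; split=> g.
  move=> Gg; split; first by have [GU _ _ _] := subgroup_prod; exact: GU.
  move: Gg => [z Zz [s Ss <-]].
  have uz := subgroup_unit sZ Zz; have us := subgroup_unit sS Ss.
  move=> f [[[i [j ->]]|[i [j ->]]]|[[_ [h Eh e]]|[_ [h Fh e]]]].
  - by rewrite /entry block_mxEur mxE.
  - by rewrite /entry block_mxEdl mxE.
  - by rewrite e //; move: Zz; rewrite eZ => -[_]; apply.
  - by rewrite e //; move: Ss; rewrite eS => -[_]; apply.
move=> [ug hg].
have eg : g = blk (ulsubmx g) (drsubmx g).
  rewrite -[LHS]submxK; congr block_mx; apply/matrixP => i j; rewrite !mxE.
    by apply: (hg (entry (lshift n i) (rshift m j))); left; left; exists i, j.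
  by apply: (hg (entry (rshift m i) (lshift n j))); left; right; exists i, j.
move: ug hg; rewrite /GL /= {1}eg blk_unit => /andP[uz us] hg.
rewrite eg; apply: prod_in.
- rewrite eZ; split=> // f Ef; have [h rh fh] := rE f Ef.
  have [k rk ek] := regular_blk rh.
  rewrite fh // -(ek _ (drsubmx g)) // -eg; apply: hg; right; left.
  by split=> //; exists f => // z s uz' us'; rewrite ek // fh.
- rewrite eS; split=> // f Ff; have [h rh fh] := rF f Ff.
  have [k rk ek] := regular_blkr rh.
  rewrite fh // -(ek (ulsubmx g)) // -eg; apply: hg; right; right.
  by split=> //; exists f => // z s uz' us'; rewrite ek // fh.
Qed.

Lemma center_prod x : Defs.center G x ->
  exists z s, [/\ Z z, Defs.center S s & x = blk z s].
Proof.
move=> [[z Zz [s Ss <-]] hc]; exists z, s; split=> //; split=> // t St.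
have := hc _ (prod_in (subgroup1 sZ) St).
by rewrite !blkM => /blk_inj[].
Qed.

Lemma prod_center z s : (forall w, Z w -> z *m w = w *m z) -> Z z ->
  Defs.center S s -> Defs.center G (blk z s).
Proof.
move=> cz Zz [Ss cs]; split; first exact: prod_in.
by move=> _ [w Zw [t St <-]]; rewrite !blkM cz // cs.
Qed.

End Product.

(** Only the components of the extended fixed group modulo the centre matter, since
    the centre acts trivially. *)
Definition finitely_many_components (R : realType) n (G : set 'M[R[i]]_n)
    (theta : 'M[R[i]]_n -> 'M[R[i]]_n) : Prop :=
  let Ath := extended_fixed_group G theta (Defs.center G) in
  exists N (gs : nat -> 'M[R[i]]_n),
  (forall i, Ath (gs i)) /\ forall g, Ath g -> exists2 i, (i < N)%N &
    exists h z, [/\ fixed_group G theta h, Defs.center G z & g = gs i *m h *m z].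

Section FiniteComponents.
Context {R : realType} {m n : nat}.
Local Notation C := R[i].
Variables (Z : set 'M[C]_m) (S : set 'M[C]_n)
  (theta : 'M[C]_(m + n) -> 'M[C]_(m + n)).
Hypotheses (tZ : torus Z) (ssS : semisimple S).
Local Notation G := (prod_group Z S).
Hypothesis inv : alg_involution G theta.
Local Notation blk z s := (block_mx z 0 0 s : 'M[C]_(m + n)).
Local Notation Ath := (extended_fixed_group G theta (Defs.center G)).

Let aZ : alg_group Z. Proof. by case: tZ. Qed.
Let aS : alg_group S. Proof. by case: ssS. Qed.
Let aG : alg_group G. Proof. exact: alg_group_prod. Qed.
Let sZ : is_subgroup Z. Proof. by case: aZ. Qed.
Let sG : is_subgroup G. Proof. by case: aG. Qed.
Let I := mx_involutive aG inv.

Let centerZ z : Z z -> Defs.center G (blk z 1%:M).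
Proof.
move=> Zz; apply: prod_center => //; first by move=> w Zw; exact: (torus_comm tZ Zz Zw).
by apply: subgroup1; apply: subgroup_center; case: aS.
Qed.

Lemma center_sqrt_finite y : finite_set [set x | Defs.center G x /\ x *m x = y].
Proof.
apply: (@sub_finite_set _ _
  ((fun p : 'M[C]_m * 'M[C]_n => blk p.1 p.2) @`
     ([set z | Z z /\ z *m z = ulsubmx y] `*` Defs.center S))).
  move=> x [/(center_prod aZ)[z [s [Zz cs ->]]] e]; exists (z, s) => //; split=> //=.
  by split=> //; rewrite -e blkM block_mxKul.
apply/finite_image/finite_setX; first exact: torus_sqrt_finite.
exact: semisimple_center_finite.
Qed.

(** Modulo the centre every extended fixed element has its defect in a finite
    set: multiplying [g] by a square root in the torus of the torus part of
    [defect g] gives a defect whose square depends only on the semisimple part. *)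
Lemma finite_defects : exists2 D : set 'M[C]_(m + n), finite_set D &
  forall g, Ath g -> exists2 w, Defs.center G w &
    D (invmx (g *m w) *m theta (g *m w)).
Proof.
pose y (s : 'M[C]_n) := blk 1%:M s *m invmx (theta (blk 1%:M s)).
exists (\bigcup_(s in Defs.center S) [set x | Defs.center G x /\ x *m x = y s]).
  apply: bigcup_finite; first exact: semisimple_center_finite.
  by move=> s _; exact: center_sqrt_finite.
move=> g Ag; have [Gg cd] := Ag.
have [d dE] : exists d, d = invmx g *m theta g by exists (invmx g *m theta g).
rewrite -dE in cd.
have [t [s [Zt cs ed]]] := center_prod aZ cd.
have [w Zw ww] := torus_sqrt tZ Zt.
have cw := centerZ Zw; exists (blk w 1%:M); first exact: cw.
exists s; first exact: cs.
have Acw : Ath (blk w 1%:M) := ext_center I cw.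
split; first exact: (extM I Ag Acw).2.
have [e eE] : exists e, e = invmx (blk w 1%:M) *m theta (blk w 1%:M).
  by exists (invmx (blk w 1%:M) *m theta (blk w 1%:M)).
rewrite (ext_defectM I Ag Acw) -dE -eE.
have ce : Defs.center G e by rewrite eE; exact: Acw.2.
have c1s : Defs.center G (blk 1%:M s).
  apply: prod_center => //; last exact: subgroup1.
  by move=> u _; rewrite mul1mx mulmx1.
have Gs := centerG c1s; have Gd : G d := centerG cd.
(* [(d * e) * (d * e) = d * d * (e * e)], and [e * e] is the defect of [w * w]. *)
have ct := centerZ Zt; have Gt := centerG ct; have Gw := centerG cw.
have wsq : blk w 1%:M *m blk w 1%:M = blk t 1%:M :> 'M[C]_(m + n).
  by rewrite blkM ww mulmx1.
have dts : d = blk t 1%:M *m blk 1%:M s.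
  by rewrite blkM mulmx1 mul1mx; exact: ed.
have Aw : Ath (blk w 1%:M) by [].
have ee : e *m e = invmx (blk t 1%:M) *m theta (blk t 1%:M).
  by rewrite eE -(ext_defectM I Acw Acw) wsq.
have tht : theta (blk t 1%:M) = invmx d *m invmx (theta (blk 1%:M s)).
  rewrite dE -(theta_defect I Gg) -dE dts (ig_thetaM I Gt Gs) -mulmxA.
  by rewrite (ig_mulVr I (ig_theta I Gs)) mulmx1.
have -> : d *m e *m (d *m e) = (d *m d) *m (e *m e).
  have [_ /(_ _ Gd) ec] := ce.
  by rewrite !mulmxA -(mulmxA d e) ec mulmxA.
rewrite ee tht /y.
have eS : d *m invmx (blk t 1%:M) = blk 1%:M s.
  have [_ /(_ _ Gs) tS] := ct.
  by rewrite dts tS -mulmxA (ig_mulVr I Gt) mulmx1.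
have [_ /(_ _ Gs) dS] := cd.
move: (theta (blk 1%:M s)) => X.
rewrite -!mulmxA (mulmxA d (invmx _)) eS.
by rewrite (mulmxA d) dS -!mulmxA (mulmxA d) (ig_mulVr I Gd) mul1mx.
Qed.

Lemma finite_components : finitely_many_components G theta.
Proof.
have [D /finite_seqP[l eD] hD] := finite_defects.
have rep d : exists g, (exists2 g, Ath g & invmx g *m theta g = d) ->
    Ath g /\ invmx g *m theta g = d.
  have [[g Ag ed]|nex] := pselect (exists2 g, Ath g & invmx g *m theta g = d).
    by exists g.
  by exists 1%:M => /nex.
have [r rP] := choice rep.
pose gs i := if pselect (Ath (r (nth 0 l i))) then r (nth 0 l i) else 1%:M.
exists (size l), gs; split.
  by move=> i; rewrite /gs; case: pselect => [h|h] /=; [exact: h|exact: (ext1 I)].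
move=> g Ag; have [w cw Dw] := hD g Ag; have Aw : Ath w := ext_center I cw.
have Agw : Ath (g *m w) := extM I Ag Aw.
have [d dE] : exists d, d = invmx (g *m w) *m theta (g *m w).
  by exists (invmx (g *m w) *m theta (g *m w)).
have [Ar er] := rP d (ex_intro2 _ _ (g *m w) Agw (esym dE)).
rewrite -dE in Dw; have dl : d \in l by rewrite eD in Dw.
exists (index d l); first by rewrite index_mem.
have eg : gs (index d l) = r d by rewrite /gs (nth_index 0 dl); case: pselect => [h //|h]; case: (h Ar).
exists (invmx (r d) *m (g *m w)), (invmx w); split.
- by apply: (defect_eq_fixed I Ar Agw); rewrite er.
- exact: (centerV I).
- rewrite eg (group_mulKV I _ Ar.1) -mulmxA (ig_mulVr I (centerG cw)).
  by rewrite mulmx1.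
Qed.

End FiniteComponents.

(** * Componentwise regularity controls every intermediate component group *)
Section ComponentRegularity.
Context {R : realType} {n : nat}.
Local Notation C := R[i].
Variables (G : set 'M[C]_n) (theta : 'M[C]_n -> 'M[C]_n).
Hypotheses (aG : alg_group G) (inv : alg_involution G theta).
Local Notation Ath := (extended_fixed_group G theta (Defs.center G)).
Local Notation L := (datum_L G theta).
Local Notation J := (datum_J G theta).
Let I := mx_involutive aG inv.

Hypothesis fin : finitely_many_components G theta.

Lemma component_representatives : exists N (js : nat -> subvs_of (datum_V G theta) ->
    subvs_of (datum_V G theta)), (forall i, J (js i)) /\
  forall j, J j -> exists2 i, (i < N)%N & exists2 l, L l & j = js i \o l.
Proof.
have [N [gs [Ags cov]]] := fin.
exists N, (fun i => Ad_on (gs i)); split; first by move=> i; exists (gs i).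
move=> _ [g /cov[i iN [h [z [Hh cz ->]]]] <-]; exists i => //.
have Ah := fixed_ext I Hh; exists (Ad_on h); first by exists h.
rewrite (Ad_on_center aG inv (extM I (Ags i) Ah) cz).
exact: (Ad_onM aG inv (Ags i) Ah).
Qed.

Variable B : set (set (subvs_of (datum_V G theta) -> subvs_of (datum_V G theta))).
Hypothesis hreg : componentwise_regular G theta.

(** A distribution that is not invariant under [a] would, by [eigendistribution]
    and componentwise regularity, produce one on the complement of the null cone
    that is invariant under [B] and changes sign under [a]. *)
Lemma component_regularity a : datum_A G theta a ->
  sdist_LB G theta (Rset L) B `<=` sdist_comp G theta (Rset L) a ->
  sdist_LB G theta setT B `<=` sdist_comp G theta setT a.
Proof.
move=> [j0 Jj0 <-] hR T [LT [sT BT]].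
exists j0; first by exists j0 => //; exists id => //; exact: L_id.
split=> // _ ->; apply: contrapT => nT.
have [N [js [Jjs cov]]] := component_representatives.
have [lam [T' [LT' T'0 pT' [lam0 lam1 lamL lamM]]]] :=
  eigendistribution (L_id aG inv) (L_comp aG inv) (L_sub_J aG inv)
    (@J_linear _ _ G theta) (J_comp aG inv) (J_inv aG inv) (J_comm aG inv)
    (J_sqr aG inv) Jjs cov Jj0 LT nT.
apply: T'0; apply: (hreg (lam := lam)) => //.
- by split=> // _ _ [j Jj <-] [k Jk <-]; exact: lamM.
- exists (left_coset L j0); first by exists j0.
  by rewrite lam0 eq_sym -addr_eq0 -mulr2n pnatr_eq0.
- move=> _ [h Hh <-]; have Lh : L (Ad_on h) by exists h.
  by apply: lam1; [exact: (L_sub_J aG inv)|exact: LT.2].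
move=> S [LS pS] f sf.
have : sdist_LB G theta (Rset L) B S.
  split=> //; split; first exact: LS.1.
  move=> j [Jj Bj]; have <- : lam (left_coset L j) = 1; last exact: pS.
  by apply: lam1 => //; exact: BT.
move=> /hR[_ [_ -> [l Ll <-]] [_ /(_ _ erefl f sf)]].
have Jk : J (j0 \o l) by apply: (J_comp aG inv) => //; exact: (L_sub_J aG inv).
rewrite (pS _ Jk f sf) (coset_L aG inv _ Ll) lam0 mul1r mulN1r => /eqP.
by rewrite eq_sym -addr_eq0 -mulr2n mulrn_eq0 => /eqP.
Qed.

End ComponentRegularity.

(** * The extended fixed group acts trivially on [p / V] *)
Lemma mulr2n_inj (R : realType) (x y : R[i]) : x *+ 2 = y *+ 2 -> x = y.
Proof.
move=> /eqP; rewrite -subr_eq0 -mulrnBl mulrn_eq0 /= subr_eq0.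
by move=> /eqP.
Qed.

Lemma AdN (R : realType) n (g X : 'M[R[i]]_n) : Ad g (- X) = - Ad g X.
Proof. by rewrite /Ad mulmxN mulNmx. Qed.

Section MatrixDerivation.
Context {R : realType} {n : nat}.
Local Notation C := R[i].
Variables (G : set 'M[C]_n) (d : ('M[C]_n -> C) -> C).
Hypotheses (sG : is_subgroup G) (hd : point_derivation G d).

Definition pd_mx k l (A : 'M[C]_n -> 'M[C]_(k, l)) : 'M[C]_(k, l) :=
  \matrix_(i, j) d (fun y => A y i j).

Definition regular_mx k l (A : 'M[C]_n -> 'M[C]_(k, l)) : Prop :=
  forall i j, regular_on G (fun y => A y i j).

Lemma regular_mulmx k l r (A : 'M[C]_n -> 'M[C]_(k, l)) (B : 'M[C]_n -> 'M[C]_(l, r)) :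
  regular_mx A -> regular_mx B -> regular_mx (fun y => A y *m B y).
Proof.
move=> rA rB i j; apply: (@regular_on_ext _ _ _ _
  (fun y => \sum_h A y i h * B y h j)) => [y _|]; first by rewrite mxE.
by apply: regular_on_sum => h; exact: regular_on_mul.
Qed.

Lemma regular_mx_cst k l (M : 'M[C]_(k, l)) : regular_mx (fun=> M).
Proof. by move=> i j; exact: regular_on_cst. Qed.

Lemma regular_mx_id : regular_mx (fun y => y : 'M[C]_n).
Proof. by move=> i j; exact: regular_on_entry. Qed.

Lemma regular_mx_inv : regular_mx (fun y => invmx y : 'M[C]_n).
Proof. by move=> i j; apply: regular_on_inv; case: sG. Qed.

Lemma pd_mulmx k l r (A : 'M[C]_n -> 'M[C]_(k, l)) (B : 'M[C]_n -> 'M[C]_(l, r)) :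
  regular_mx A -> regular_mx B ->
  pd_mx (fun y => A y *m B y) = pd_mx A *m B 1%:M + A 1%:M *m pd_mx B.
Proof.
move=> rA rB; apply/matrixP => i j; rewrite !mxE.
transitivity (d (fun y => \sum_h A y i h * B y h j)).
  by congr d; apply/funext => y; rewrite mxE.
rewrite (pd_sum hd); last by move=> h; exact: regular_on_mul.
rewrite -big_split /=; apply: eq_bigr => h _.
by rewrite (pd_mul hd (rA i h) (rB h j)) !mxE.
Qed.

Lemma pd_mx_cst k l (M : 'M[C]_(k, l)) : pd_mx (fun=> M) = 0.
Proof. by apply/matrixP => i j; rewrite !mxE (pd_cst hd). Qed.

Definition tangent_mx : 'M[C]_n := \matrix_(i, j) d (entry i j).

Lemma pd_mx_id : pd_mx (fun y => y) = tangent_mx.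
Proof. by apply/matrixP => i j; rewrite !mxE. Qed.

Lemma pd_mx_ext k l (A B : 'M[C]_n -> 'M[C]_(k, l)) : regular_mx B ->
  (forall y, G y -> A y = B y) -> pd_mx A = pd_mx B.
Proof.
move=> rB e; apply/matrixP => i j; rewrite !mxE.
by apply: (pd_ext hd (rB i j)) => y Gy; rewrite e.
Qed.

Lemma pd_mx_inv : pd_mx (fun y => invmx y) = - tangent_mx.
Proof.
have : pd_mx (fun y => y *m invmx y) = 0.
  rewrite -(pd_mx_cst (1%:M : 'M[C]_n)); apply: pd_mx_ext; first exact: regular_mx_cst.
  by move=> y /(subgroup_unit sG) uy; exact: (mulmxV uy).
rewrite (pd_mulmx regular_mx_id regular_mx_inv) pd_mx_id invmx1 mulmx1 mul1mx.
by move=> /eqP; rewrite addrC addr_eq0 => /eqP.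
Qed.

Lemma regular_Ad (M : 'M[C]_n) : regular_mx (fun y => Ad y M).
Proof.
apply: regular_mulmx regular_mx_inv.
exact: regular_mulmx regular_mx_id (regular_mx_cst _).
Qed.

Lemma pd_Ad (M : 'M[C]_n) : pd_mx (fun y => Ad y M) = tangent_mx *m M - M *m tangent_mx.
Proof.
rewrite /Ad pd_mulmx; [|exact: regular_mulmx regular_mx_id (regular_mx_cst _)|
  exact: regular_mx_inv].
rewrite (pd_mulmx regular_mx_id (regular_mx_cst M)) pd_mx_id pd_mx_cst pd_mx_inv.
by rewrite invmx1 mulmx1 !mul1mx addr0 mulmxN.
Qed.

Lemma linear_form_expand k l (lam : {linear 'M[C]_(k, l) -> C^o}) M :
  lam M = \sum_i \sum_j lam (delta_mx i j) * M i j.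
Proof.
rewrite {1}(matrix_sum_delta M) linear_sum; apply: eq_bigr => i _.
by rewrite linear_sum; apply: eq_bigr => j _; rewrite linearZ mulrC.
Qed.

Lemma regular_linear_form k l (lam : {linear 'M[C]_(k, l) -> C^o}) A :
  regular_mx A -> regular_on G (fun y => lam (A y)).
Proof.
move=> rA; apply: (@regular_on_ext _ _ _ _
  (fun y => \sum_i \sum_j lam (delta_mx i j) * A y i j)) => [y _|].
  exact: linear_form_expand.
by do 2 (apply: regular_on_sum => ?); apply: regular_on_scale.
Qed.

Lemma pd_linear_form k l (lam : {linear 'M[C]_(k, l) -> C^o}) A :
  regular_mx A -> d (fun y => lam (A y)) = lam (pd_mx A).
Proof.
move=> rA; transitivity (d (fun y => \sum_i \sum_j lam (delta_mx i j) * A y i j)).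
  by congr d; apply/funext => y; exact: linear_form_expand.
rewrite (pd_sum hd); last first.
  by move=> i; apply: regular_on_sum => j; apply: regular_on_scale.
rewrite [RHS]linear_form_expand; apply: eq_bigr => i _.
rewrite (pd_sum hd); last by move=> j; apply: regular_on_scale.
by apply: eq_bigr => j _; rewrite (pd_scale hd) // mxE.
Qed.

End MatrixDerivation.

Section Pullback.
Context {R : realType} {k n : nat}.
Local Notation C := R[i].
Variables (G : set 'M[C]_k) (G' : set 'M[C]_n) (u : 'M[C]_k -> 'M[C]_n).
Hypotheses (hu : alg_hom G G' u) (u1 : u 1%:M = 1%:M).

Lemma pd_pullback d : point_derivation G d -> point_derivation G' (fun f => d (f \o u)).
Proof.
have [uG _ ru] := hu; move=> hd; split.
- by move=> f h rf rh fh; apply: (pd_ext hd); [exact: ru|move=> x Gx; exact/fh/uG].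
- by move=> a f h rf rh; case: hd => _ lin _; rewrite -lin //; exact: ru.
- by move=> f h rf rh; have := pd_mul hd (ru _ rf) (ru _ rh); rewrite /= u1.
Qed.

End Pullback.

Section TrivialAction.
Context {R : realType} {n : nat}.
Local Notation C := R[i].
Variables (G : set 'M[C]_n) (theta : 'M[C]_n -> 'M[C]_n).
Hypotheses (aG : alg_group G) (inv : alg_involution G theta).
Local Notation Ath := (extended_fixed_group G theta (Defs.center G)).
Local Notation p := (minus_eigenspace G theta).
Local Notation V := (datum_V G theta).
Let I := mx_involutive aG inv.
Let sG : is_subgroup G. Proof. by case: aG. Qed.

(** Connectedness of the group modulo its centre, as a property of functions. *)
Definition constant_mod_center : Prop := forall f, regular_on G f ->
  (forall z x, Defs.center G z -> G x -> f (z *m x) = f x) ->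
  (forall d, point_derivation G d -> forall x, G x -> d (fun y => f (y *m x)) = 0) ->
  forall x, G x -> f x = f 1%:M.

Hypothesis conn : constant_mod_center.

Let tbar d : ('M[C]_n -> C) -> C := fun f => d (f \o theta).

Let pd_tbar d : point_derivation G d -> point_derivation G (tbar d).
Proof. by apply: pd_pullback; [case: inv|exact: (theta1 I)]. Qed.

Let tbarK d f : point_derivation G d -> regular_on G f -> tbar d (f \o theta) = d f.
Proof.
move=> hd rf; apply: (pd_ext hd rf) => x Gx.
by rewrite /= (ig_thetaK I Gx).
Qed.

Section LinearForm.
Variable lam : {linear 'M[C]_n -> C^o}.
Hypothesis lamV : forall x, x \in V -> lam x = 0.

Let bracket (X Y : 'M[C]_n) : C := lam (X *m Y - Y *m X).

(** [lam] kills [[h, p]] because [e] is tangent to the fixed group, along which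
    [lam (Ad y X)] is constant. *)
Let bracket_fixed_p e X : point_derivation G e ->
  (forall f, regular_on G f -> tbar e f = e f) -> X \in p ->
  bracket (tangent_mx e) X = 0.
Proof.
move=> he te pX; rewrite /bracket -(pd_Ad sG he) -(pd_linear_form he); last exact: regular_Ad.
have rA : regular_on G (fun y => lam (Ad y X)) by apply: regular_linear_form; exact: regular_Ad.
have : e (fun y => lam (Ad y X) - lam X) = 0.
  apply: (derivation_fixed_group sG he _ inv te).
  - by case: aG.
  - by apply: regular_on_sub => //; exact: regular_on_cst.
  - move=> h Hh; rewrite -linearB lamV //; apply: mem_linear_span.
    by exists (Ad h), X; split=> //; exists h.
by rewrite (pd_sub he) ?(pd_cst he) ?subr0 //; exact: regular_on_cst.
Qed.

(** Applying [theta] to both arguments only changes the sign of the brackets of [h]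
    with [p], which [lam] kills. *)
Let bracket_theta e d : point_derivation G e -> point_derivation G d ->
  bracket (tangent_mx e) (tangent_mx d) =
  bracket (tangent_mx (tbar e)) (tangent_mx (tbar d)).
Proof.
move=> he hd.
have key e1 d1 : point_derivation G e1 -> point_derivation G d1 ->
    bracket (tangent_mx e1 + tangent_mx (tbar e1))
            (tangent_mx d1 - tangent_mx (tbar d1)) = 0.
  move=> he1 hd1; have ht := pd_tbar he1; have htd := pd_tbar hd1.
  have -> : tangent_mx e1 + tangent_mx (tbar e1) =
      tangent_mx (fun f => 1 * e1 f + tbar e1 f).
    by apply/matrixP => i j; rewrite !mxE mul1r.
  apply: bracket_fixed_p; first exact: pd_combine.
    move=> f rf; transitivity (1 * tbar e1 f + tbar e1 (f \o theta)) => //.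
    by rewrite (tbarK he1 rf) !mul1r addrC.
  apply/mem_p; exists (fun f => (-1) * tbar d1 f + d1 f); split.
  - exact: pd_combine.
  - move=> f rf; transitivity (-1 * tbar d1 (f \o theta) + tbar d1 f) => //.
    by rewrite (tbarK hd1 rf); ring.
  - by move=> i j; rewrite !mxE mulN1r addrC.
have := key e d he hd; have := key d e hd he.
rewrite /bracket; move: (tangent_mx e) (tangent_mx d) (tangent_mx (tbar e)) (tangent_mx (tbar d)).
move=> E D E' D' h1 h2.
apply: mulr2n_inj; apply/eqP; rewrite -subr_eq0 -!linearMn -linearB; apply/eqP.
transitivity (lam ((E + E') *m (D - D') - (D - D') *m (E + E')) -
  lam ((D + D') *m (E - E') - (E - E') *m (D + D'))).
  rewrite -linearB; congr (lam _).
  rewrite !mulmxDl !mulmxDr !mulmxN !mulNmx !mulr2n.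
  move: (E *m D) (E *m D') (E' *m D) (E' *m D') (D *m E) (D *m E') (D' *m E) (D' *m E').
  move=> a b c d0 a' b' c' d'; apply/matrixP => i j; rewrite !mxE; ring.
exact: (etrans (f_equal2 (fun x y => x - y) h2 h1) (subr0 0)).
Qed.

(** [lam (Ad y X)] for [X] tangent, where [lam] is first antisymmetrized by [theta],
    that is, twice its restriction to [p] extended by zero to [h]. *)
Let orbit_fun d (y : 'M[C]_n) : C :=
  lam (Ad y (tangent_mx d)) - lam (Ad (theta y) (tangent_mx (tbar d))).

Let regular_orbit_fun d : regular_on G (orbit_fun d).
Proof.
apply: regular_on_sub.
  by apply: regular_linear_form; exact: regular_Ad.
apply: (@regular_theta _ _ _ _ inv (fun y => lam (Ad y (tangent_mx (tbar d))))).
by apply: regular_linear_form; exact: regular_Ad.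
Qed.

Let derivation_orbit_fun e d : point_derivation G e -> point_derivation G d ->
  e (orbit_fun d) = 0.
Proof.
move=> he hd; have r1 := regular_linear_form lam (regular_Ad sG (tangent_mx d)).
have r2 := regular_linear_form lam (regular_Ad sG (tangent_mx (tbar d))).
rewrite /orbit_fun (pd_sub he r1 (regular_theta inv r2)).
rewrite (pd_linear_form he lam (regular_Ad sG _)) (pd_Ad sG he).
have := pd_linear_form (pd_tbar he) lam (regular_Ad sG (tangent_mx (tbar d))).
rewrite (pd_Ad sG (pd_tbar he)) => e2.
apply/eqP; rewrite subr_eq0; apply/eqP.
by rewrite -[RHS]/(tbar e (fun y => lam (Ad y (tangent_mx (tbar d))))) e2; exact: bracket_theta.
Qed.

(** [orbit_fun] has no derivative, hence is constant; on an extended fixed element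
    its two terms agree up to sign, since [Ad (theta g) = Ad g]. *)
Lemma linear_form_Ad g X : Ath g -> X \in p -> lam (Ad g X) = lam X.
Proof.
move=> Ag /mem_p[d [hd td dX]]; have [Gg cg] := Ag.
have Xd : X = tangent_mx d by apply/matrixP => i j; rewrite dX mxE.
have tdX : tangent_mx (tbar d) = - X.
  by apply/matrixP => i j; rewrite !mxE dX /tbar td //; exact: regular_on_entry.
have tX : tangent G X by exists d.
have tAd y : G y -> tangent G (Ad y X) by move=> Gy; exact: tangent_Ad.
have fE y : orbit_fun d y = lam (Ad y X) + lam (Ad (theta y) X).
  by rewrite /orbit_fun -Xd tdX AdN linearN opprK.
have conjE y : G y -> exists2 e, point_derivation G e &
    Ad y X = tangent_mx e /\ Ad (theta y) (- X) = tangent_mx (tbar e).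
  move=> Gy; have Gt := ig_theta I Gy.
  exists (fun f => d (f \o (fun z => y *m z *m invmx y))); first exact: pd_conj.
  split; apply/matrixP => i j.
    by rewrite (Ad_entry Gy hd dX) mxE.
  have tE i' j' : tangent_mx (tbar d) i' j' = tbar d (entry i' j') by rewrite mxE.
  rewrite -tdX (Ad_entry Gt (pd_tbar hd) tE).
  rewrite mxE /tbar; apply: (pd_ext hd).
    apply: (regular_conj aG Gy (f := entry i j \o theta)).
    by apply: (regular_theta inv); exact: regular_on_entry.
  move=> z Gz; have GV := subgroupV sG Gy; have GM := subgroupM sG Gy Gz.
  by rewrite /= (ig_thetaM I GM GV) (ig_thetaM I Gy Gz) (thetaV I Gy).
have : orbit_fun d g = orbit_fun d 1%:M.
  apply: conn Gg; first exact: regular_orbit_fun.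
  - move=> z y cz Gy; rewrite !fE; have Gz := centerG cz.
    have ct := center_theta I cz; have Gtz := centerG ct; have Gty := ig_theta I Gy.
    rewrite (ig_thetaM I Gz Gy) (AdM aG inv _ Gz Gy) (AdM aG inv _ Gtz Gty).
    by rewrite (Ad_center aG cz (tAd _ Gy)) (Ad_center aG ct (tAd _ Gty)).
  - move=> e he x Gx; have [e' he' [e1 e2]] := conjE x Gx.
    rewrite -(derivation_orbit_fun he he').
    apply: (pd_ext he) => [|y Gy]; first exact: regular_orbit_fun.
    have Gt := ig_theta I Gx; have Gty := ig_theta I Gy.
    rewrite fE /orbit_fun -e1 -e2 (ig_thetaM I Gy Gx).
    by rewrite (AdM aG inv _ Gy Gx) (AdM aG inv _ Gty Gt) !AdN linearN opprK.
rewrite !fE (theta1 I) (theta_defectE I Gg) (AdM aG inv _ Gg (centerG cg)).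
by rewrite (Ad_center aG cg tX) Ad1 -!mulr2n; exact: mulr2n_inj.
Qed.

End LinearForm.

(** A linear form on [p / V] kills [[h, p]], and [[p, p]] and [[h, h]] lie in [h];
    so, extended by zero to [h], it kills the derived algebra and is invariant
    under the connected group. Here it is applied to a coordinate of the
    projection along [V]. *)
Lemma Ad_ext_sub_V g X : Ath g -> X \in p -> Ad g X - X \in V.
Proof.
move=> Ag pX; pose w := Ad g X - X.
suff : w - projv V w = 0.
  by move=> /eqP; rewrite subr_eq0 => /eqP e; rewrite -/w e memv_proj.
apply/matrixP => i j; rewrite [RHS]mxE.
have lf : linear (fun M : 'M[C]_n => (M - projv V M) i j : C^o).
  by move=> a x y; rewrite linearP /= !mxE; rewrite -[RHS]/(a * _ + _); ring.
have [lam elam] := linear_pack lf.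
have lamV x : x \in V -> lam x = 0.
  by move=> Vx; rewrite elam projv_id // subrr mxE.
have := linear_form_Ad lamV Ag pX; move=> /eqP; rewrite -subr_eq0 -linearB elam => /eqP.
exact.
Qed.

End TrivialAction.

(** * Tangent vectors of a quotient by a finite central subgroup *)
Section FiniteQuotient.
Context {R : realType} {n k : nat}.
Local Notation C := R[i].
Variables (G F : set 'M[C]_n) (G' : set 'M[C]_k) (q : 'M[C]_n -> 'M[C]_k).
Hypotheses (sG : is_subgroup G) (sG' : is_subgroup G').
Hypotheses (sF : is_subgroup F) (finF : finite_set F) (FG : F `<=` G).
Hypotheses (qh : alg_hom G G' q) (qG : q @` G = G') (kerq : ker_on G q = F).
Hypothesis qreg : forall f, regular_on G' f <-> regular_on G (f \o q).
Implicit Types (h u v : 'M[C]_n -> C).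

Let qin x : G x -> G' (q x). Proof. by case: qh => + _ _; apply. Qed.
Let qM x y : G x -> G y -> q (x *m y) = q x *m q y.
Proof. by case: qh => _ + _; apply. Qed.

Lemma quotient1 : q 1%:M = 1%:M.
Proof.
have G1 := subgroup1 sG; have u := subgroup_unit sG' (qin G1).
by rewrite -[LHS](mulKmx u) -qM // mulmx1 (mulVmx u).
Qed.

Lemma quotient_ker z : F z -> q z = 1%:M.
Proof. by rewrite -kerq => -[]. Qed.

Lemma quotientV x : G x -> q (invmx x) = invmx (q x).
Proof.
move=> Gx; have u := subgroup_unit sG' (qin Gx).
rewrite -[LHS](mulKmx u) -(qM Gx (subgroupV sG Gx)) (mulmxV (subgroup_unit sG Gx)).
by rewrite quotient1 mulmx1.
Qed.

Lemma quotient_eq x y : G x -> G y -> q x = q y -> F (invmx x *m y).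
Proof.
move=> Gx Gy e; have GV := subgroupV sG Gx; rewrite -kerq; split.
  exact: subgroupM.
by rewrite (qM GV Gy) (quotientV Gx) e (mulVmx (subgroup_unit sG' (qin Gy))).
Qed.

Let lift_pt (y : 'M[C]_k) : 'M[C]_n := xget 0 [set x | G x /\ q x = y].

Let lift_ptP y : G' y -> G (lift_pt y) /\ q (lift_pt y) = y.
Proof.
rewrite -qG => -[x Gx qx]; rewrite /lift_pt.
by case: xgetP => [z _ []//|/(_ x)[]].
Qed.

Let descend (f : 'M[C]_n -> C) : 'M[C]_k -> C := f \o lift_pt.

Definition deck_invariant (f : 'M[C]_n -> C) : Prop := forall x z, G x -> F z -> f (x *m z) = f x.

Let descendE f x : deck_invariant f -> G x -> descend f (q x) = f x.
Proof.
move=> df Gx; have [Gl ql] := lift_ptP (qin Gx).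
have Fz := quotient_eq Gx Gl (esym ql).
by rewrite /descend /= -[RHS](df x _ Gx Fz) (mulKVmx (subgroup_unit sG Gx)).
Qed.

Let regular_descend f : deck_invariant f -> regular_on G f -> regular_on G' (descend f).
Proof.
move=> df rf; apply/qreg; apply: regular_on_ext rf => x Gx.
exact: descendE.
Qed.

(** [F] acts on the fibres of [q] as the group of deck transformations. *)
Definition deck : seq 'M[C]_n := undup (sval (cid ((finite_seqP F).1 finF))).

Let mem_deck z : (z \in deck) <-> F z.
Proof. by rewrite mem_undup; case: cid => s /= ->. Qed.

Definition deck_trace (f : 'M[C]_n -> C) x : C := \sum_(z <- deck) f (x *m z).

Lemma deck_trace_inv f : deck_invariant (deck_trace f).
Proof.
move=> x z Gx Fz; have uz := subgroup_unit sF Fz.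
rewrite /deck_trace [RHS](perm_big [seq z *m w | w <- deck]).
  by rewrite big_map; apply: eq_bigr => w _; rewrite mulmxA.
apply: uniq_perm; first exact: undup_uniq.
  by rewrite map_inj_uniq ?undup_uniq //; exact: can_inj (mulKmx uz).
move=> w; apply/idP/mapP => [/mem_deck Fw|[v /mem_deck Fv ->]]; last first.
  by apply/mem_deck; exact: subgroupM.
exists (invmx z *m w); last by rewrite (mulKVmx uz).
by apply/mem_deck; apply: subgroupM => //; exact: subgroupV.
Qed.

Lemma regular_deck_trace f : regular_on G f -> regular_on G (deck_trace f).
Proof.
move=> rf; rewrite /deck_trace.
have : forall z, z \in deck -> F z by move=> z /mem_deck.
elim: (deck) => [|z s ih] hs.
  under [X in regular_on _ X]funext do rewrite big_nil; exact: regular_on_cst.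
under [X in regular_on _ X]funext do rewrite big_cons.
apply: regular_on_add; last by apply: ih => w ws; apply: hs; rewrite inE ws orbT.
by apply: regular_on_mulr => //; apply/FG/hs; rewrite inE eqxx.
Qed.

Lemma deck_separating : exists c : 'M[C]_n -> C, [/\ regular_GL c, c 1%:M = 1
  & forall z, F z -> z <> 1%:M -> c z = 0].
Proof.
have [c [rc c1 c0]] : exists c : 'M[C]_n -> C, [/\ regular_GL c, c 1%:M = 1
    & forall z, z \in deck -> z <> 1%:M -> c z = 0].
  elim: (deck) => [|z s [c [rc c1 c0]]]; first by exists (fun=> 1); split=> //; exact: gen_alg_cst.
  have [z1|nz1] := pselect (z = 1%:M).
    exists c; split=> // w; rewrite inE => /orP[/eqP -> //|]; exact: c0.
  have [i [j zij]] : exists i j, z i j != (1%:M : 'M[C]_n) i j.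
    apply: contrapT => h; apply: nz1; apply/matrixP => i j; apply/eqP.
    by apply: contraT => zij; case: h; exists i, j.
  pose b (x : 'M[C]_n) := ((1%:M : 'M[C]_n) i j - z i j)^-1 * (entry i j x + - z i j).
  exists (fun x => b x * c x); split.
  - apply: gen_alg_mul => //; apply: gen_alg_mul; first exact: gen_alg_cst.
    by apply: gen_alg_add; [exact: regular_GL_entry|exact: gen_alg_cst].
  - by rewrite c1 mulr1 /b /entry mulVf // subr_eq0 eq_sym.
  - move=> w; rewrite inE => /orP[/eqP ->|ws] w1.
      by rewrite /b /entry subrr mulr0 mul0r.
    by rewrite c0 ?mulr0.
by exists c; split=> // z /mem_deck; exact: c0.
Qed.

(** A dual basis of [C[G]] over the invariants of [F]: the translates of a
    function separating [1] from the rest of [F]. *)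
Lemma deck_dual_basis : exists (I : finType) (a b : I -> 'M[C]_n -> C),
  [/\ forall i, regular_on G (a i), forall i, regular_on G (b i)
    & forall h x, G x -> h x = \sum_i deck_trace (fun y => h y * a i y) x * b i x].
Proof.
have [c [rc c1 c0]] := deck_separating.
have [I [a [b [ra rb e]]]] := regular_GL_mul rc.
exists I, (fun i => a i \o (fun g => invmx g)), b; split.
- by move=> i; apply: regular_inv => //; exact: regular_on_GL.
- by move=> i; exact: regular_on_GL.
move=> h x Gx; have ux := subgroup_unit sG Gx.
transitivity (\sum_(z <- deck) h (x *m z) * c (invmx (x *m z) *m x)).
  have one : 1%:M \in deck by apply/mem_deck; exact: subgroup1.
  rewrite (bigD1_seq 1%:M) ?undup_uniq //= mulmx1 (mulVmx ux) c1 mulr1.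
  rewrite big_seq_cond big1 ?addr0 // => z /andP[/mem_deck Fz z1].
  have Gz := FG Fz; have uz := subgroup_unit sG Gz.
  have e1 : invmx (x *m z) *m x = invmx z.
    have uxz := subgroup_unit sG (subgroupM sG Gx Gz).
    by rewrite -{2}(mulmxK uz x) (mulKmx uxz).
  rewrite e1 c0 ?mulr0 //; first exact: subgroupV.
  move=> zV; move/eqP: z1; apply; rewrite -(mulmxV uz) zV mulmx1 //.
under eq_bigr do rewrite e mulr_sumr.
rewrite exchange_big /=; apply: eq_bigr => i _.
by rewrite mulr_suml; apply: eq_bigr => z _; rewrite /= mulrA.
Qed.

Let vanishes_on_deck u := forall z, F z -> u z = 0.

Let trace_vanish u v : vanishes_on_deck u -> deck_trace (fun y => u y * v y) 1%:M = 0.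
Proof.
move=> u0; rewrite /deck_trace big_seq big1 // => z /mem_deck Fz.
by rewrite mul1mx u0 ?mul0r.
Qed.

(** After multiplication by the separating function, [h - h 1] vanishes on [F]; its
    coefficients in the dual basis are then invariants that vanish at [1]. *)
Lemma tangent_quotient_inj d e : point_derivation G d -> point_derivation G e ->
  (forall f, regular_on G' f -> d (f \o q) = e (f \o q)) ->
  forall h, regular_on G h -> d h = e h.
Proof.
move=> hd he de.
suff zero d0 : point_derivation G d0 -> (forall f, regular_on G' f -> d0 (f \o q) = 0) ->
    forall h, regular_on G h -> d0 h = 0.
  move=> h rh; apply/eqP; rewrite eq_sym -subr_eq0 -mulN1r addrC; apply/eqP.
  apply: (zero (fun f => -1 * d f + e f)) => // [|f rf]; first exact: pd_combine.
  by rewrite de // mulN1r addNr.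
move=> hd0 d00 h rh.
have [c [rc c1 c0]] := deck_separating.
have [I [a [b [ra rb dual]]]] := deck_dual_basis.
pose u x := (h x - h 1%:M) * c x.
have ru : regular_on G u.
  apply: regular_on_mul; last exact: regular_on_GL.
  by apply: regular_on_sub => //; exact: regular_on_cst.
have u0 : vanishes_on_deck u.
  move=> z Fz; rewrite /u; have [->|z1] := pselect (z = 1%:M).
    by rewrite subrr mul0r.
  by rewrite c0 ?mulr0.
have rc' : regular_on G c by exact: regular_on_GL.
have rh' : regular_on G (fun x => h x - h 1%:M).
  by apply: regular_on_sub => //; exact: regular_on_cst.
have -> : d0 h = d0 u.
  rewrite /u (pd_mul hd0) // subrr mul0r addr0 c1 mulr1 (pd_sub hd0) //; last exact: regular_on_cst.
  by rewrite (pd_cst hd0) subr0.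
have rt i : regular_on G (deck_trace (fun y => u y * a i y)).
  by apply: regular_deck_trace; exact: regular_on_mul.
transitivity (d0 (fun x => \sum_i deck_trace (fun y => u y * a i y) x * b i x)).
  apply: (pd_ext hd0) => [|x Gx]; last exact: dual.
  by apply: regular_on_sum => i; exact: regular_on_mul.
rewrite (pd_sum hd0); last by move=> i; exact: regular_on_mul.
rewrite big1 // => i _; rewrite (pd_mul hd0) // trace_vanish // mul0r addr0.
have di := deck_trace_inv (fun y => u y * a i y).
rewrite -(pd_ext hd0 (rt i) (f := descend (deck_trace (fun y => u y * a i y)) \o q)).
  by rewrite d00 ?mul0r //; exact: regular_descend.
by move=> x Gx; exact: descendE.
Qed.

(** With [c] separating [1] from the rest of [F],
    [d' (Tr (c ^ 2 h)) - h 1 * d' (Tr (c ^ 2))] extends the derivation [d'] of the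
    invariants. For the Leibniz rule, a product of two functions vanishing on [F]
    has a trace in the square of the maximal ideal, by the dual basis. *)
Lemma tangent_quotient_lift d' : point_derivation G' d' ->
  exists2 d, point_derivation G d & forall f, regular_on G' f -> d (f \o q) = d' f.
Proof.
move=> hd'; have [c [rc c1 c0]] := deck_separating.
have [I [a [b [ra rb dual]]]] := deck_dual_basis.
have rc' : regular_on G c by exact: regular_on_GL.
pose t h := descend (deck_trace (fun x => c x * c x * h x)).
have rcc h : regular_on G h -> regular_on G (fun x => c x * c x * h x).
  by move=> rh; do 2 apply: regular_on_mul => //.
have rt h : regular_on G h -> regular_on G' (t h).
  by move=> rh; apply: regular_descend; [exact: deck_trace_inv|exact/regular_deck_trace/rcc].
pose d h := d' (t h) - h 1%:M * d' (t (fun=> 1)).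
have dlin a0 f h : regular_on G f -> regular_on G h ->
    d (fun x => a0 * f x + h x) = a0 * d f + d h.
  move=> rf rh; rewrite /d.
  have -> : t (fun x => a0 * f x + h x) = fun y => a0 * t f y + t h y.
    apply/funext => y; rewrite /t /descend /= /deck_trace mulr_sumr -big_split.
    by apply: eq_bigr => z _ /=; ring.
  case: hd' => _ lin' _; rewrite lin'; [by ring|exact: rt|exact: rt].
have dext f h : (forall x, G x -> f x = h x) -> regular_on G h -> d f = d h.
  move=> fh rh; rewrite /d fh; last exact: subgroup1.
  congr (_ - _); apply: (pd_ext hd'); first exact: rt.
  move=> y /lift_ptP[Gl _]; rewrite /t /descend /= /deck_trace big_seq [RHS]big_seq.
  apply: eq_bigr => z /mem_deck Fz; rewrite fh //.
  by apply: subgroupM => //; exact: FG.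
have q1 := quotient1; have G1 := subgroup1 sG.
have t1 f : t f 1%:M = f 1%:M.
  rewrite /t -q1 (descendE (deck_trace_inv _) G1).
  rewrite /deck_trace (bigD1_seq 1%:M) ?undup_uniq //=; last by apply/mem_deck; exact: subgroup1.
  rewrite mulmx1 c1 !mul1r big_seq_cond big1 ?addr0 // => z /andP[/mem_deck Fz /eqP z1].
  by rewrite mul1mx c0 // !mul0r.
have dprod f h : regular_on G f -> regular_on G h -> f 1%:M = 0 -> h 1%:M = 0 ->
    d (fun x => f x * h x) = 0.
  move=> rf rh f1 h1; rewrite /d f1 !mul0r subr0.
  pose u x := c x * f x; pose v x := c x * h x.
  have ru : regular_on G u by exact: regular_on_mul.
  have rv : regular_on G v by exact: regular_on_mul.
  have van w : w 1%:M = 0 -> vanishes_on_deck (fun x => c x * w x).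
    move=> w0 z Fz; have [->|z1] := pselect (z = 1%:M); first by rewrite w0 mulr0.
    by rewrite c0 ?mul0r.
  pose A i := deck_trace (fun y => u y * a i y).
  pose B j := deck_trace (fun y => v y * a j y).
  pose D i j := deck_trace (fun y => b i y * b j y).
  have rA i : regular_on G (A i) by apply: regular_deck_trace; exact: regular_on_mul.
  have rB i : regular_on G (B i) by apply: regular_deck_trace; exact: regular_on_mul.
  have rD i j : regular_on G (D i j) by apply: regular_deck_trace; exact: regular_on_mul.
  have dA i : deck_invariant (A i) by exact: deck_trace_inv.
  have dB i : deck_invariant (B i) by exact: deck_trace_inv.
  have dD i j : deck_invariant (D i j) by exact: deck_trace_inv.
  pose S i j y := descend (A i) y * descend (B j) y * descend (D i j) y.
  have rS i j : regular_on G' (S i j).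
    by do 2 (apply: regular_on_mul; last exact: regular_descend); exact: regular_descend.
  transitivity (d' (fun y => \sum_i \sum_j S i j y)).
    apply: (pd_ext hd').
      by do 2 apply: regular_on_sum => ?.
    move=> y G'y; have [Gl ql] := lift_ptP G'y; rewrite -ql.
    rewrite /t descendE //; last exact: deck_trace_inv.
    move: (lift_pt y) Gl => x Gx.
    transitivity (\sum_i \sum_j A i x * B j x * D i j x); last first.
      apply: eq_bigr => i _; apply: eq_bigr => j _.
      by rewrite /S !descendE.
    rewrite /deck_trace.
    transitivity (\sum_(z <- deck) \sum_i \sum_j A i x * B j x * (b i (x *m z) * b j (x *m z))).
      rewrite big_seq [RHS]big_seq; apply: eq_bigr => z /mem_deck Fz.
      have Gxz : G (x *m z) by apply: subgroupM => //; exact: FG.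
      transitivity (u (x *m z) * v (x *m z)); first by rewrite /u /v; ring.
      rewrite (dual u _ Gxz) (dual v _ Gxz) big_distrlr /=.
      apply: eq_bigr => i _; apply: eq_bigr => j _.
      by rewrite -/(A i (x *m z)) -/(B j (x *m z)) dA // dB //; ring.
    rewrite exchange_big; apply: eq_bigr => i _.
    rewrite exchange_big; apply: eq_bigr => j _.
    by rewrite -mulr_sumr.
  have dA1 i : descend (A i) 1%:M = 0.
    by rewrite -q1 descendE // /A trace_vanish //; exact: van.
  have dB1 i : descend (B i) 1%:M = 0.
    by rewrite -q1 descendE // /B trace_vanish //; exact: van.
  rewrite (pd_sum hd'); last by move=> i; apply: regular_on_sum => j.
  rewrite big1 // => i _; rewrite (pd_sum hd') // big1 // => j _.
  have rAd : regular_on G' (descend (A i)) by exact: regular_descend.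
  have rBd : regular_on G' (descend (B j)) by exact: regular_descend.
  have rDd : regular_on G' (descend (D i j)) by exact: regular_descend.
  rewrite /S (pd_mul hd' (regular_on_mul rAd rBd) rDd) (pd_mul hd' rAd rBd).
  by rewrite dA1 dB1 !(mul0r, mulr0, addr0).
have d1 c' : d (fun=> c') = 0.
  have z0 : d (fun=> 0) = 0.
    rewrite /d mul0r subr0; transitivity (d' (fun=> 0)); last exact: (pd_cst hd').
    congr d'; apply/funext => y.
    by rewrite /t /descend /= /deck_trace big1 // => z _; rewrite mulr0.
  have z1 : d (fun=> 1) = 0 by rewrite /d mul1r subrr.
  transitivity (c' * d (fun=> 1) + d (fun=> 0)); last by rewrite z0 z1 mulr0 addr0.
  rewrite -(dlin c' _ _ (regular_on_cst G 1) (regular_on_cst G 0)).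
  by congr d; apply/funext => x; rewrite mulr1 addr0.
exists d; first split.
- by move=> f h rf rh fh; exact: dext.
- exact: dlin.
- move=> f h rf rh; pose f0 x := f x - f 1%:M; pose h0 x := h x - h 1%:M.
  have rf0 : regular_on G f0 by apply: regular_on_sub => //; exact: regular_on_cst.
  have rh0 : regular_on G h0 by apply: regular_on_sub => //; exact: regular_on_cst.
  have rf0h0 := regular_on_mul rf0 rh0.
  have -> : (fun x => f x * h x) = (fun x => 1 * (f0 x * h0 x) +
     (f 1%:M * h x + (h 1%:M * f x + (- (f 1%:M * h 1%:M))))).
    by apply/funext => x; rewrite /f0 /h0; ring.
  have r3 : regular_on G (fun x => h 1%:M * f x + (- (f 1%:M * h 1%:M))).
    by apply: regular_on_add; [exact: regular_on_scale|exact: regular_on_cst].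
  have r2 : regular_on G (fun x => f 1%:M * h x + (h 1%:M * f x + (- (f 1%:M * h 1%:M)))).
    by apply: regular_on_add => //; exact: regular_on_scale.
  rewrite (dlin _ _ _ rf0h0 r2) (dlin _ _ _ rh r3) (dlin _ _ _ rf (regular_on_cst _ _)).
  by rewrite d1 dprod // /f0 /h0 ?subrr //; ring.
- move=> f rf; rewrite /d /= q1.
  have r1 := rt _ (regular_on_cst G 1).
  have -> : d' (t (f \o q)) = d' (fun y => f y * t (fun=> 1) y).
    apply: (pd_ext hd'); first exact: regular_on_mul.
    move=> y /lift_ptP[Gl ql]; rewrite /t /descend /= /deck_trace.
    rewrite big_seq [X in _ = _ * X]big_seq mulr_sumr; apply: eq_bigr => z /mem_deck Fz.
    by rewrite (qM Gl (FG Fz)) (quotient_ker Fz) mulmx1 ql; ring.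
  by rewrite (pd_mul hd' rf r1) t1 mulr1 addrK.
Qed.

End FiniteQuotient.

Section TangentUnique.
Context {R : realType} {n : nat}.
Local Notation C := R[i].
Variable G : set 'M[C]_n.
Hypothesis sG : is_subgroup G.

Lemma tangent_mx_combine a (d e : ('M[C]_n -> C) -> C) :
  tangent_mx (fun f => a * d f + e f) = a *: tangent_mx d + tangent_mx e.
Proof. by apply/matrixP => i j; rewrite !mxE. Qed.

(** The value on the inverse of the determinant is forced by the Leibniz rule. *)
Lemma tangent_mx_inj d e : point_derivation G d -> point_derivation G e ->
  tangent_mx d = tangent_mx e -> forall h, regular_on G h -> d h = e h.
Proof.
move=> hd he ede h [k rk hk].
rewrite (pd_ext hd (regular_on_GL G rk) hk) (pd_ext he (regular_on_GL G rk) hk).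
have gen gens f : (forall f, gens f -> regular_GL f /\ d f = e f) ->
    gen_alg gens f -> regular_GL f /\ d f = e f.
  move=> hg; elim=> {f} [f /hg//|c|f g _ [rf df] _ [rg dg]|f g _ [rf df] _ [rg dg]].
  - by split; [exact: gen_alg_cst|rewrite (pd_cst hd) (pd_cst he)].
  - split; first exact: gen_alg_add.
    have rf' := regular_on_GL G rf; have rg' := regular_on_GL G rg.
    by rewrite (pd_add hd rf' rg') (pd_add he rf' rg') df dg.
  - split; first exact: gen_alg_mul.
    have rf' := regular_on_GL G rf; have rg' := regular_on_GL G rg.
    by rewrite (pd_mul hd rf' rg') (pd_mul he rf' rg') df dg.
have ent i j : regular_GL (@entry R n i j) /\ d (entry i j) = e (entry i j).
  split; first exact: regular_GL_entry.
  by move/matrixP: ede => /(_ i j); rewrite !mxE.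
have [rdet ddet] : regular_GL (fun g : 'M[C]_n => \det g) /\
    d (fun g => \det g) = e (fun g => \det g).
  apply: (gen [set f | exists i j, f = entry i j]).
    by move=> _ [i [j ->]]; exact: ent.
  by apply: (gen_alg_det (A := id)) => i j; apply: gen_alg_gen; exists i, j.
apply: (gen _ _ _ rk).2 => f [[i [j ->]]|->]; first exact: ent.
split; first exact: regular_GL_invdet.
by rewrite (pd_invdet hd sG) (pd_invdet he sG) ddet.
Qed.

End TangentUnique.

(** * The symmetric pair of a central quotient *)
Section CentralQuotient.
Context {R : realType} {n k : nat}.
Local Notation C := R[i].
Variables (G : set 'M[C]_n) (theta : 'M[C]_n -> 'M[C]_n).
Hypotheses (aG : alg_group G) (inv : alg_involution G theta)
  (conn : constant_mod_center G).
Variables (F : set 'M[C]_n) (G' : set 'M[C]_k)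
    (theta' : 'M[C]_k -> 'M[C]_k) (q : 'M[C]_n -> 'M[C]_k).
Hypothesis cq : central_quotient G theta F G' theta' q.
Local Notation Ath := (extended_fixed_group G theta (Defs.center G)).
Local Notation p := (minus_eigenspace G theta).
Local Notation p' := (minus_eigenspace G' theta').
Local Notation V := (datum_V G theta).
Local Notation V' := (pair_Q G' theta').
Local Notation HF := (extended_fixed_group G theta F).
Local Notation H' := (fixed_group G' theta').
Let I := mx_involutive aG inv.
Let sG : is_subgroup G. Proof. by case: aG. Qed.

Let sF : is_subgroup F. Proof. by case: cq => -[]. Qed.
Let finF : finite_set F. Proof. by case: cq => -[]. Qed.
Let Fc : F `<=` Defs.center G. Proof. by case: cq => -[]. Qed.
Let FG : F `<=` G. Proof. by move=> z /Fc[]. Qed.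
Let aG' : alg_group G'. Proof. by case: cq => _ [[]]. Qed.
Let sG' : is_subgroup G'. Proof. by case: aG'. Qed.
Let qh : alg_hom G G' q. Proof. by case: cq => _ [[]]. Qed.
Let qG : q @` G = G'. Proof. by case: cq => _ [[]]. Qed.
Let kerq : ker_on G q = F. Proof. by case: cq => _ [[]]. Qed.
Let qreg f : regular_on G' f <-> regular_on G (f \o q).
Proof. by case: cq => _ [[_ _ _ _]]. Qed.
Let qtheta g : G g -> theta' (q g) = q (theta g).
Proof. by case: cq => _ [_]; apply. Qed.
Let qin x : G x -> G' (q x). Proof. by case: qh => + _ _; apply. Qed.
Let qM x y : G x -> G y -> q (x *m y) = q x *m q y.
Proof. by case: qh => _ + _; apply. Qed.
Let q1 : q 1%:M = 1%:M. Proof. exact: (quotient1 sG sG' qh). Qed.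
Let qV x : G x -> q (invmx x) = invmx (q x).
Proof. exact: (quotientV sG sG' qh). Qed.

Lemma quotient_involution : alg_involution G' theta'.
Proof.
split; last by rewrite -qG => _ [g Gg <-]; rewrite (qtheta Gg) (qtheta (ig_theta I Gg)) (ig_thetaK I Gg).
split.
- by rewrite -qG => _ [g Gg <-]; rewrite (qtheta Gg); exists (theta g) => //; exact: (ig_theta I).
- rewrite -qG => _ _ [g Gg <-] [h Gh <-].
  have Gtg := ig_theta I Gg; have Gth := ig_theta I Gh.
  rewrite -(qM Gg Gh) (qtheta (subgroupM sG Gg Gh)) (qtheta Gg) (qtheta Gh).
  by rewrite (ig_thetaM I Gg Gh) (qM Gtg Gth).
- move=> f rf; apply/qreg; apply: (regular_on_ext _ (regular_theta inv ((qreg f).1 rf))).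
  by move=> x Gx; rewrite /= (qtheta Gx).
Qed.

Let HF_ext g : HF g -> Ath g.
Proof. by move=> [Gg Fg]; split=> //; exact: Fc. Qed.

Lemma quotient_fixed g : HF g -> H' (q g).
Proof.
move=> [Gg Fg]; split; first exact: qin.
rewrite (qtheta Gg) (theta_defectE I Gg) (qM Gg (FG Fg)).
by rewrite (quotient_ker kerq Fg) mulmx1.
Qed.

Lemma quotient_fixed_lift h : H' h -> exists2 g, HF g & q g = h.
Proof.
move=> [+ th]; rewrite -qG => -[g Gg qg]; exists g => //; split=> //.
apply: (quotient_eq sG sG' qh kerq Gg (ig_theta I Gg)).
by rewrite -(qtheta Gg) qg th.
Qed.

Lemma fixed_HF h : fixed_group G theta h -> HF h.
Proof.
move=> [Gh th]; split=> //; rewrite th (mulVmx (subgroup_unit sG Gh)).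
exact: subgroup1.
Qed.

Let push d : ('M[C]_k -> C) -> C := fun f => d (f \o q).

Let pd_push d : point_derivation G d -> point_derivation G' (push d).
Proof. exact: (pd_pullback qh q1). Qed.

(** Tangent vectors are matrices, so a derivation with this matrix is chosen;
    [dquotientE] shows that the choice does not matter. *)
Definition dquotient (X : 'M[C]_n) : 'M[C]_k :=
  tangent_mx (push (xget (fun=> 0) [set d | point_derivation G d /\ tangent_mx d = X])).
Local Notation dq := dquotient.

Let is_tangent X := exists2 d, point_derivation G d & X = tangent_mx d.

Lemma dquotientE d : point_derivation G d -> dq (tangent_mx d) = tangent_mx (push d).
Proof.
move=> hd; rewrite /dquotient; case: xgetP => [e _ [he ee]|/(_ d)[]//].
apply/matrixP => i j; rewrite !mxE /push; apply: (tangent_mx_inj sG he hd ee).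
by apply/qreg; exact: regular_on_entry.
Qed.

Let tangent_lin a X Y : is_tangent X -> is_tangent Y -> is_tangent (a *: X + Y).
Proof.
move=> [d hd ->] [e he ->]; rewrite -tangent_mx_combine.
by exists (fun f => a * d f + e f) => //; exact: pd_combine.
Qed.

Lemma dquotient_linear a X Y : is_tangent X -> is_tangent Y ->
  dq (a *: X + Y) = a *: dq X + dq Y.
Proof.
move=> [d hd ->] [e he ->]; rewrite -tangent_mx_combine.
by rewrite !dquotientE //; [rewrite -tangent_mx_combine|exact: pd_combine].
Qed.

Let tangent_sub X Y : is_tangent X -> is_tangent Y -> is_tangent (X - Y).
Proof.
by move=> tX tY; have := tangent_lin (-1) tY tX; rewrite scaleN1r addrC.
Qed.

Let dquotient_sub X Y : is_tangent X -> is_tangent Y -> dq (X - Y) = dq X - dq Y.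
Proof.
move=> tX tY; rewrite addrC -[- Y]scaleN1r (dquotient_linear _ tY tX).
by rewrite scaleN1r addrC.
Qed.

Let p_tangent X : X \in p -> is_tangent X.
Proof. by move=> /mem_p[d [hd _ dX]]; exists d => //; apply/matrixP => i j; rewrite mxE dX. Qed.

Let V_tangent X : X \in V -> is_tangent X.
Proof. by move=> VX; apply: p_tangent; exact: (subvP (V_sub_p aG inv)). Qed.

Lemma dquotient_Ad g X : G g -> is_tangent X ->
  is_tangent (Ad g X) /\ dq (Ad g X) = Ad (q g) (dq X).
Proof.
move=> Gg [d hd ->].
have tE i j : tangent_mx d i j = d (entry i j) by rewrite mxE.
have tE' i j : tangent_mx (push d) i j = push d (entry i j) by rewrite mxE.
have hdg := pd_conj aG Gg hd.
have e1 : Ad g (tangent_mx d) =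
    tangent_mx (fun f => d (f \o (fun y => g *m y *m invmx g))).
  by apply/matrixP => i j; rewrite (Ad_entry Gg hd tE) mxE.
rewrite e1; split; first by eexists; [exact: hdg|].
rewrite !dquotientE //; apply/matrixP => i j.
rewrite (Ad_entry (qin Gg) (pd_push hd) tE') mxE /push.
have rc := regular_conj aG' (qin Gg) (regular_on_entry G' i j).
apply: (pd_ext hd); first exact: (qreg _).1 rc.
move=> y Gy /=; have GV := subgroupV sG Gg; have GM := subgroupM sG Gg Gy.
by rewrite (qM GM GV) (qM Gg Gy) (qV Gg).
Qed.

Lemma dquotient_p X : X \in p -> dq X \in p'.
Proof.
move=> /mem_p[d [hd td dX]].
have -> : X = tangent_mx d by apply/matrixP => i j; rewrite mxE dX.
rewrite (dquotientE hd); apply/mem_p; exists (push d); split.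
- exact: pd_push.
- move=> f rf; rewrite -td; last exact/qreg.
  apply: (pd_ext hd); first exact/(regular_theta inv)/qreg.
  by move=> x Gx; rewrite /= (qtheta Gx).
- by move=> i j; rewrite mxE.
Qed.

Lemma dquotient_p_surj Y : Y \in p' -> exists2 X, X \in p & dq X = Y.
Proof.
move=> /mem_p[d' [hd' td' dY]].
have [d hd dd'] := tangent_quotient_lift sG sG' sF finF FG qh qG kerq qreg hd'.
exists (tangent_mx d); last first.
  rewrite (dquotientE hd); apply/matrixP => i j; rewrite mxE dY; apply: dd'.
  exact: regular_on_entry.
apply/mem_p; exists d; split=> //; last by move=> i j; rewrite mxE.
have hdt : point_derivation G (fun f => d (f \o theta)).
  by apply: pd_pullback hd; [case: inv|exact: (theta1 I)].
have hN : point_derivation G (fun f => -1 * d f + (fun=> 0) f).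
  by apply: pd_combine => //; exact: pd_zero.
move=> f rf; rewrite -[RHS]addr0 -mulN1r.
apply: (tangent_quotient_inj sG sG' sF finF FG qh qG kerq qreg hdt hN) => // h rh.
rewrite dd' // addr0 mulN1r -td' // -dd'; last first.
  by have [[_ _ r] _] := quotient_involution; exact: r.
apply: (pd_ext hd) => [|x Gx]; last by rewrite /= (qtheta Gx).
by apply/qreg; have [[_ _ r] _] := quotient_involution; exact: r.
Qed.

Lemma dquotient_inj X : is_tangent X -> dq X = 0 -> X = 0.
Proof.
move=> [d hd ->]; rewrite (dquotientE hd) => e0.
have z : point_derivation G (fun=> 0) by exact: pd_zero.
have pz : point_derivation G' (fun=> 0) by exact: pd_zero.
have tz : tangent_mx (fun=> 0) = 0 :> 'M[C]_k by apply/matrixP => i j; rewrite !mxE.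
apply/matrixP => i j; rewrite !mxE.
apply: (tangent_quotient_inj sG sG' sF finF FG qh qG kerq qreg hd z) => [f rf|].
  by apply: (tangent_mx_inj sG' (pd_push hd) pz) => //; rewrite e0 tz.
exact: regular_on_entry.
Qed.

Lemma dquotient0 : dq 0 = 0.
Proof.
have z : point_derivation G (fun=> 0) by exact: pd_zero.
have -> : 0 = tangent_mx (fun=> 0) :> 'M[C]_n by apply/matrixP => i j; rewrite !mxE.
by rewrite (dquotientE z); apply/matrixP => i j; rewrite !mxE.
Qed.

Lemma dquotient_V X : X \in V -> dq X \in V'.
Proof.
move=> VX; suff [] : is_tangent X /\ dq X \in V' by [].
move: X VX; apply: linear_span_ind.
- split; last by rewrite dquotient0 mem0v.
  exists (fun=> 0); first exact: pd_zero.
  by apply/matrixP => i j; rewrite !mxE.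
- move=> a x y [tx hx] [ty hy]; split; first exact: tangent_lin.
  by rewrite dquotient_linear // memvD ?memvZ.
move=> _ [_ [u [[h Hh <-] pu ->]]]; have tu := p_tangent pu.
have Gh : G h by case: Hh.
have [tA eA] := dquotient_Ad Gh tu; split; first exact: tangent_sub.
rewrite (dquotient_sub tA tu) eA; apply: mem_linear_span.
exists (Ad (q h)), (dq u); split=> //; last exact: dquotient_p.
by exists (q h) => //; apply: quotient_fixed; exact: fixed_HF.
Qed.

(** [V'] is spanned by differences under the image of [HF], which may be larger
    than the fixed group: this is where [Ad_ext_sub_V] is needed. *)
Lemma dquotient_V_surj Y : Y \in V' -> exists2 X, X \in V & dq X = Y.
Proof.
apply: (@linear_span_ind R _ _ (fun Y => exists2 X, X \in V & dq X = Y)).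
- by exists 0; [exact: mem0v|exact: dquotient0].
- move=> a _ _ [x Vx <-] [y Vy <-]; exists (a *: x + y).
    by rewrite memvD ?memvZ.
  by rewrite dquotient_linear //; exact: V_tangent.
move=> _ [_ [u' [[h' Hh' <-] pu' ->]]].
have [g HFg <-] := quotient_fixed_lift Hh'; have [u pu <-] := dquotient_p_surj pu'.
have tu := p_tangent pu; have Gg : G g by case: HFg.
have [tA eA] := dquotient_Ad Gg tu.
exists (Ad g u - u); first exact: (Ad_ext_sub_V aG inv conn (HF_ext HFg) pu).
by rewrite (dquotient_sub tA tu) eA.
Qed.

Definition quotient_iso (x : subvs_of V) : subvs_of V' := vsproj V' (dq (vsval x)).
Local Notation Phi := quotient_iso.

Let PhiE x : vsval (Phi x) = dq (vsval x).
Proof. by rewrite /quotient_iso vsprojK //; exact/dquotient_V/subvsP. Qed.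

Lemma quotient_iso_linear : linear Phi.
Proof.
move=> a x y; apply: val_inj; rewrite /= PhiE linearP /= dquotient_linear.
- by rewrite -!PhiE.
- exact/V_tangent/subvsP.
- exact/V_tangent/subvsP.
Qed.

Lemma quotient_iso_inverse : exists phi : {linear subvs_of V -> subvs_of V'},
  exists psi : {linear subvs_of V' -> subvs_of V},
  [/\ phi = Phi :> (subvs_of V -> subvs_of V'), cancel phi psi & cancel psi phi].
Proof.
have [phi ephi] := linear_pack quotient_iso_linear.
have inj x y : phi x = phi y -> x = y.
  move=> e; apply: val_inj; apply/eqP; rewrite -subr_eq0; apply/eqP.
  have tx := V_tangent (subvsP x); have ty := V_tangent (subvsP y).
  apply: dquotient_inj; first exact: tangent_sub.
  rewrite (dquotient_sub tx ty) -!PhiE -ephi e; exact: subrr.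
have surj y : exists x, phi x = y.
  have [X VX dX] := dquotient_V_surj (subvsP y).
  exists (vsproj V X); rewrite ephi; apply: val_inj.
  by rewrite [LHS]PhiE vsprojK.
have [psi psiK] := choice surj.
have lpsi : linear psi.
  by move=> a x y; apply: inj; rewrite linearP !psiK.
have [psi' epsi] := linear_pack lpsi.
exists phi, psi'; split=> // x; rewrite epsi ?psiK //.
by apply: inj; rewrite psiK.
Qed.

Lemma quotient_iso_Ad g : Ath g -> Phi \o Ad_on g = Ad_on (q g) \o Phi.
Proof.
move=> Ag; have [Gg _] := Ag; apply/funext => x.
have tx := V_tangent (subvsP x); have [tA eA] := dquotient_Ad Gg tx.
rewrite /comp /Ad_on /restrict_to [in RHS]PhiE -eA /quotient_iso.
by rewrite vsprojK //; exact/(Ad_V aG inv Ag)/subvsP.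
Qed.

End CentralQuotient.

(** * Null cones and components *)
Section NullCone.
Context {R : realType} {n : nat}.
Local Notation C := R[i].
Variables (G : set 'M[C]_n) (theta : 'M[C]_n -> 'M[C]_n).
Hypotheses (aG : alg_group G) (inv : alg_involution G theta).
Hypothesis fin : finitely_many_components G theta.
Local Notation L := (datum_L G theta).
Local Notation J := (datum_J G theta).
Local Notation W := (subvs_of (datum_V G theta)).

Let polyfun_J j (f : W -> C) : J j -> polyfun f -> polyfun (f \o j).
Proof.
move=> Jj; have [phi <-] := linear_pack (J_linear Jj).
exact: polyfun_comp.
Qed.

(** Finitely many components do not change the null cone: if [f 0 = 0] and [j] has
    order two modulo a group leaving [f] invariant, then [f + f \o j] and
    [f * (f \o j)] are invariant under [j] too, and if both vanish at [x] so does
    [f]. *)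
Lemma Gamma_components x :
  (forall f, invariants L f -> (forall j, J j -> f \o j = f) -> f x = f 0) ->
  Gamma L x.
Proof.
move=> hx; have [N [js [Jjs cov]]] := component_representatives aG inv fin.
pose fixed m (f : W -> C) := invariants L f /\ forall i, (i < m)%N -> f \o js i = f.
have top f : fixed N f -> f x = f 0.
  move=> [iLf fj]; apply: hx => // j /cov[i iN [l Ll ->]].
  by rewrite compA fj //; case: iLf => _; apply.
have step m f : (forall f, fixed m.+1 f -> f x = f 0) -> fixed m f -> f x = f 0.
  move=> IH [[pf Lf] fj]; pose j := js m; have Jj : J j := Jjs m.
  pose g y := f y - f 0.
  have pg : polyfun g by exact: gen_alg_add pf (gen_alg_cst _ _).
  have pgj : polyfun (g \o j) by exact: polyfun_J.
  have j0 : j 0 = 0 by have [phi e] := linear_pack (J_linear Jj); rewrite -e linear0.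
  have gE h : f \o h = f -> g \o h = g.
    by move=> e; apply/funext => y; rewrite /g /= -[f (h y)]/((f \o h) y) e.
  have gL l : L l -> g \o l = g by move=> /Lf; exact: gE.
  have gjk h : J h -> g \o h = g -> (g \o j) \o h = g \o j.
    move=> Jh e; have [l Ll e'] := J_comm aG inv Jj Jh.
    rewrite -[LHS]/(g \o (j \o h)) e' -[LHS]/(((g \o h) \o j) \o l) e.
    have [l' Ll' e4] := J_normal aG inv Jj Ll.
    by rewrite -[LHS]/(g \o (j \o l)) e4 -[LHS]/((g \o l') \o j) gL.
  have gjj : (g \o j) \o j = g.
    by rewrite -[LHS]/(g \o (j \o j)) gL //; exact: (J_sqr aG inv Jj).
  have fixS h1 :
      (forall h, (J h /\ g \o h = g) \/ h = j -> h1 \o h = h1) -> polyfun h1 -> fixed m.+1 h1.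
    move=> e ph1; split; first split=> //.
    - by move=> l Ll; apply: e; left; split; [exact: (L_sub_J aG inv)|exact: gL].
    - move=> i; rewrite ltnS leq_eqVlt => /orP[/eqP ->|im]; apply: e; first by right.
      by left; split=> //; apply: gE; exact: fj.
  have s1 : g x + g (j x) = 0.
    have -> : g x + g (j x) = g 0 + g (j 0).
      apply: (IH (fun y => g y + g (j y))); apply: fixS => [h|].
        move=> [[Jh gh]|->]; apply/funext => y /=.
          by rewrite -[g (h y)]/((g \o h) y) gh -[g (j (h y))]/(((g \o j) \o h) y) gjk.
        by rewrite -[g (j (j y))]/(((g \o j) \o j) y) gjj addrC.
      exact: gen_alg_add pg pgj.
    by rewrite j0 /g subrr addr0.
  have s2 : g x * g (j x) = 0.
    have -> : g x * g (j x) = g 0 * g (j 0).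
      apply: (IH (fun y => g y * g (j y))); apply: fixS => [h|].
        move=> [[Jh gh]|->]; apply/funext => y /=.
          by rewrite -[g (h y)]/((g \o h) y) gh -[g (j (h y))]/(((g \o j) \o h) y) gjk.
        by rewrite -[g (j (j y))]/(((g \o j) \o j) y) gjj mulrC.
      exact: gen_alg_mul pg pgj.
    by rewrite j0 /g subrr mul0r.
  have gx0 : g x = 0.
    move/eqP: s2; rewrite mulf_eq0 => /orP[/eqP //|/eqP gj0].
    by rewrite -s1 gj0 addr0.
  by apply/eqP; rewrite -subr_eq0 -/(g x) gx0.
have down m : (m <= N)%N -> forall f, fixed (N - m)%N f -> f x = f 0.
  elim: m => [_|m ih mN] f; first by rewrite subn0; exact: top.
  by apply: step => f'; rewrite subnSK //; apply: ih; exact: ltnW.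
by move=> f iLf; apply: (down N (leqnn N)); rewrite subnn; split.
Qed.

End NullCone.

(** * Regularity of the central quotients *)
Section RegularQuotient.
Context {R : realType} {n k : nat}.
Local Notation C := R[i].
Variables (G : set 'M[C]_n) (theta : 'M[C]_n -> 'M[C]_n).
Hypotheses (aG : alg_group G) (inv : alg_involution G theta)
  (conn : constant_mod_center G) (fin : finitely_many_components G theta).
Variables (F : set 'M[C]_n) (G' : set 'M[C]_k)
    (theta' : 'M[C]_k -> 'M[C]_k) (q : 'M[C]_n -> 'M[C]_k).
Hypothesis cq : central_quotient G theta F G' theta' q.
(** Elements of [G] that become central in the quotient are central. *)
Hypothesis central_lift : forall z, G z ->
  (forall x, G x -> F (invmx (x *m z) *m (z *m x))) -> Defs.center G z.
Hypothesis hreg : componentwise_regular G theta.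

Local Notation Ath := (extended_fixed_group G theta (Defs.center G)).
Local Notation HF := (extended_fixed_group G theta F).
Local Notation L := (datum_L G theta).
Local Notation J := (datum_J G theta).
Local Notation K' := (@pair_HQ R k G' theta').
Local Notation B := (component_image G theta HF).
Let I := mx_involutive aG inv.
Let sG : is_subgroup G. Proof. by case: aG. Qed.
Let Fc : F `<=` Defs.center G. Proof. by case: cq => -[]. Qed.
Let HF_ext g : HF g -> Ath g.
Proof. by move=> [Gg Fg]; split=> //; exact: Fc. Qed.
Let qh : alg_hom G G' q. Proof. by case: cq => _ [[]]. Qed.
Let qM x y : G x -> G y -> q (x *m y) = q x *m q y.
Proof. by case: qh => _ + _; apply. Qed.
Let sG' : is_subgroup G'. Proof. by case: cq => _ [[[]]]. Qed.

Let central_quotient_lift z : G z -> Defs.center G' (q z) -> Defs.center G z.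
Proof.
move=> Gz [_ cz]; apply: central_lift => // x Gx.
have [[_ _ _ _] [[_ _ _ kerq _] _]] := cq.
apply: (quotient_eq sG sG' qh kerq (subgroupM sG Gx Gz) (subgroupM sG Gz Gx)).
rewrite (qM Gx Gz) (qM Gz Gx) cz //.
by case: qh => h _ _; exact: h.
Qed.

(** The differential of [q] transports distributions between the two pairs; the
    components in [B] account for the difference of [HF] and the fixed group. *)
Lemma regular_quotient : regular_pair G' theta'.
Proof.
move=> g' [Gg' cg' _ _ _] /= hX T' LT'.
have [phi [psi [ephi phiK psiK]]] := quotient_iso_inverse aG inv conn cq.
have [_ [[_ _ qG kerq qreg] qth]] := cq.
have [g Gg qg] : exists2 g, G g & q g = g' by move: Gg'; rewrite -qG => -[g Gg <-]; exists g.
have GV := subgroupV sG Gg; have Gt := ig_theta I Gg.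
have Ag : Ath g.
  split=> //; apply: central_quotient_lift; first exact: subgroupM.
  by rewrite (qM GV Gt) (quotientV sG sG' qh Gg) -(qth g Gg) qg.
have inter h : Ath h -> phi \o Ad_on h = Ad_on (q h) \o phi.
  by move=> Ah; rewrite ephi; exact: (quotient_iso_Ad aG inv cq Ah).
have inter' h : Ath h -> psi \o Ad_on (q h) = Ad_on h \o psi.
  move=> Ah; apply/funext => y; apply: (can_inj phiK).
  by rewrite /= psiK -[RHS]/((phi \o Ad_on h) (psi y)) (inter h Ah) /= psiK.
have JHF h : HF h -> @J_of R n G theta B (Ad_on h).
  by move=> Hh; split; [exists h; [exact: HF_ext|]|exists h; [exact: Hh|]].
have K'E kk : K' kk -> exists2 h, HF h & kk = Ad_on (q h).
  move=> [h' /(quotient_fixed_lift aG inv cq)[h Hh <-] <-]; by exists h.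
have HFK' h : HF h -> K' (Ad_on (q h)).
  by move=> Hh; exists (q h); [|by []]; exact: (quotient_fixed aG inv cq).
have L_HF l : L l -> exists2 h, HF h & l = Ad_on h.
  by move=> [h Hh <-]; exists h; [exact: (fixed_HF aG cq Hh)|].
(* [L]-invariant functions need not be invariant under [HF]: [Gamma_components]. *)
have XX x : Rset L x <-> Rset K' (phi x).
  suff e : Gamma L x <-> Gamma K' (phi x) by split=> h1 h2; apply: h1; exact/e.
  split=> hx.
    move=> f [pf Kf]; have := hx (f \o phi); rewrite /= linear0; apply; split.
      exact: polyfun_comp.
    move=> l /L_HF[h Hh ->]; rewrite -[LHS]/(f \o (phi \o Ad_on h)).
    rewrite (inter _ (HF_ext Hh)) -[LHS]/((f \o Ad_on (q h)) \o phi).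
    by rewrite (Kf _ (HFK' _ Hh)).
  apply: (Gamma_components aG inv fin) => f [pf Lf] fJ.
  have := hx (f \o psi); rewrite /= phiK linear0; apply; split.
    exact: polyfun_comp.
  move=> _ /K'E[h Hh ->]; rewrite -[LHS]/(f \o (psi \o Ad_on (q h))).
  rewrite (inter' _ (HF_ext Hh)) -[LHS]/((f \o Ad_on h) \o psi).
  have Jh : J (Ad_on h) by exists h; [exact: HF_ext|].
  by rewrite (fJ _ Jh).
have XX' y : Rset K' y <-> Rset L (psi y) by rewrite XX psiK.
have TT y : [set: subvs_of (pair_Q G' theta')] y <-> [set: subvs_of (datum_V G theta)] (psi y) by [].
have TT' x : [set: subvs_of (datum_V G theta)] x <-> [set: subvs_of (pair_Q G' theta')] (phi x) by [].
pose T := fun f => T' (f \o psi).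
have [sT' kT'] := LT'.
have TK h : HF h -> pushes_to setT (Ad_on h) 1 T.
  move=> Hh f sf; rewrite mul1r /T.
  have -> : (f \o Ad_on h) \o psi = (f \o psi) \o Ad_on (q h).
    by rewrite -[LHS]/(f \o (Ad_on h \o psi)) -(inter' _ (HF_ext Hh)).
  rewrite (kT' _ (HFK' _ Hh)) ?mul1r //.
  exact: (schwartz_comp psiK phiK TT).
have sT : sdist setT T by exact: (sdist_comp_linear psiK phiK TT).
have TB : sdist_LB G theta setT B T.
  have TL : sdist_inv setT L T.
    by split=> // _ /L_HF[h Hh ->]; exact: TK.
  split=> //; split=> // j [Jj [h Hh eh]].
  have : left_coset L j j.
    by exists j; [|exists id; [exact: (L_id aG inv)|]].
  rewrite -eh => -[_ -> [l Ll <-]] f sf.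
  have sfh : schwartz setT (f \o Ad_on h).
    by apply: (schwartz_compJ (J_linear (theta := theta)) (J_inv aG inv)) => //; exact: (JHF h Hh).1.
  rewrite -[f \o _]/((f \o Ad_on h) \o l) (TL.2 l Ll _ sfh) mul1r.
  exact: TK.
have Ja : J (Ad_on g) by exists g.
have hR : sdist_LB G theta (Rset L) B `<=`
    sdist_comp G theta (Rset L) (left_coset L (Ad_on g)).
  move=> S [[sS LS] [_ BS]].
  have : sdist_inv (Rset K') K' (fun f => S (f \o phi)).
    split; first exact: (sdist_comp_linear phiK psiK XX).
    move=> _ /K'E[h Hh ->] f sf.
    have -> : (f \o Ad_on (q h)) \o phi = (f \o phi) \o Ad_on h.
      by rewrite -[RHS]/(f \o (phi \o Ad_on h)) (inter _ (HF_ext Hh)).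
    by apply: BS; [exact: JHF|exact: (schwartz_comp phiK psiK XX)].
  move=> /hX[_ /(_ _ erefl) gS].
  exists (Ad_on g).
    by exists (Ad_on g); [|exists id; [exact: (L_id aG inv)|]].
  split=> // _ -> f sf; have sf' := schwartz_comp psiK phiK XX' sf.
  have := gS _ sf'; rewrite -qg.
  have -> : ((f \o psi) \o Ad_on (q g)) \o phi = f \o Ad_on g.
    by rewrite -[LHS]/((f \o (psi \o Ad_on (q g))) \o phi) (inter' _ Ag);
      apply/funext => x; rewrite /= phiK.
  by have -> : (f \o psi) \o phi = f by apply/funext => x; rewrite /= phiK.
have Aa : datum_A G theta (left_coset L (Ad_on g)) by exists (Ad_on g).
have [kk [_ -> [l Ll <-]] [_ /(_ _ erefl) gT]] :=
  component_regularity aG inv fin hreg Aa hR TB.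
split=> // _ -> f sf; have sf' := schwartz_comp phiK psiK TT' sf.
have := gT _ sf'; have := TB.1.2 l Ll ((f \o phi) \o Ad_on g).
rewrite -[(f \o phi) \o (Ad_on g \o l)]/(((f \o phi) \o Ad_on g) \o l) => ->; last first.
  exact: (schwartz_compJ (J_linear (theta := theta)) (J_inv aG inv) Ja).
rewrite mul1r /T => e.
have e1 : ((f \o phi) \o Ad_on g) \o psi = f \o Ad_on g'.
  rewrite -qg -[LHS]/((f \o (phi \o Ad_on g)) \o psi) (inter _ Ag).
  by apply/funext => y; rewrite /= psiK.
by rewrite e1 in e; rewrite e; congr (_ * T' _); apply/funext => y; rewrite /= psiK.
Qed.

End RegularQuotient.

(** * The product of a torus and a semisimple group *)
Lemma det_commutator (K : fieldType) n (a b : 'M[K]_n) : a \in unitmx -> b \in unitmx ->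
  \det (invmx (a *m b) *m (b *m a)) = 1.
Proof.
move=> ua ub; rewrite det_mulmx det_inv !det_mulmx (mulrC (\det b)) mulVf // mulf_neq0 //.
  by rewrite -unitfE -unitmxE.
by rewrite -unitfE -unitmxE.
Qed.

Section ProductGroup.
Context {R : realType} {m n : nat}.
Local Notation C := R[i].
Variables (Z : set 'M[C]_m) (S : set 'M[C]_n).
Hypotheses (tZ : torus Z) (ssS : semisimple S).
Local Notation G := (prod_group Z S).
Local Notation blk z s := (block_mx z 0 0 s : 'M[C]_(m + n)).
Let aZ : alg_group Z. Proof. by case: tZ. Qed.
Let aS : alg_group S. Proof. by case: ssS. Qed.
Let cS : zconnected S. Proof. by case: ssS. Qed.
Let sZ : is_subgroup Z. Proof. by case: aZ. Qed.
Let sS : is_subgroup S. Proof. by case: aS. Qed.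
Let sG : is_subgroup G. Proof. exact: subgroup_prod. Qed.
Let iota (s : 'M[C]_n) : 'M[C]_(m + n) := blk 1%:M s.

Let iotaM s t : iota (s *m t) = iota s *m iota t.
Proof. by rewrite /iota blkM mulmx1. Qed.

Let iota_in s : S s -> G (iota s).
Proof. by move=> Ss; apply: prod_in => //; exact: subgroup1. Qed.

Let regular_mx_iota : regular_mx S iota.
Proof.
move=> i j; case: (split_ordP i) => i' ->; case: (split_ordP j) => j' ->.
- by under [X in regular_on _ X]funext do rewrite block_mxEul; exact: regular_on_cst.
- by under [X in regular_on _ X]funext do rewrite block_mxEur; exact: regular_on_cst.
- by under [X in regular_on _ X]funext do rewrite block_mxEdl; exact: regular_on_cst.
- by under [X in regular_on _ X]funext do rewrite block_mxEdr; exact: regular_on_entry.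
Qed.

Let iota_hom : alg_hom S G iota.
Proof.
split=> [s|s t _ _|f]; [exact: iota_in|exact: iotaM|].
apply: regular_on_comp; [exact: iota_in|exact: regular_mx_iota|].
apply: (@regular_on_ext _ _ _ _ (fun g => (\det g)^-1)) => [s _|].
  by rewrite /iota det_ublock det1 mul1r.
by apply: regular_on_GL; exact: regular_GL_invdet.
Qed.

Let center_torus z : Z z -> Defs.center G (blk z 1%:M).
Proof.
move=> Zz; apply: prod_center => //; first by move=> w Zw; exact: (torus_comm tZ).
by apply: subgroup1; exact: subgroup_center.
Qed.

(** The torus factor is central, and the other one is connected. *)
Lemma prod_constant_mod_center : constant_mod_center G.
Proof.
move=> f rf fz df.
have hc s : S s -> f (iota s) = f (iota 1%:M).
  have [_ _ ri] := iota_hom.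
  apply: (zconnected_constant sS (f := f \o iota) cS (ri _ rf)) => d hd x Sx.
  have := df _ (pd_pullback iota_hom blk1 hd) _ (iota_in Sx).
  by move=> <-; congr d; apply/funext => y; rewrite /= iotaM.
move=> _ [z Zz [s Ss <-]].
have -> : blk z s = blk z 1%:M *m iota s by rewrite /iota blkM mulmx1 mul1mx.
by rewrite fz ?hc /iota ?blk1 //; [exact: center_torus|exact: iota_in].
Qed.

(** The commutators of [z] with the connected factor form a connected set
    containing [1], so they are trivial if they lie in a finite group. *)
Lemma prod_central_lift F z : finite_set F -> F `<=` G -> G z ->
  (forall x, G x -> F (invmx (x *m z) *m (z *m x))) -> Defs.center G z.
Proof.
move=> finF FG [z1 Zz1 [z2 Sz2 <-]] hF.
have Gz : G (blk z1 z2) by exact: prod_in.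
have uz := subgroup_unit sG Gz.
pose c s := invmx (iota s *m blk z1 z2) *m (blk z1 z2 *m iota s).
have [e [re e1 e0]] := deck_separating finF.
have rc : regular_mx S c.
  have rz := @regular_mx_cst R n S _ _ (blk z1 z2).
  have re1 : regular_mx S (fun s => iota s *m blk z1 z2) by exact: regular_mulmx.
  have ec s : S s -> c s = invmx (blk z1 z2) *m iota (invmx s) *m (blk z1 z2 *m iota s).
    move=> Ss; rewrite /c; congr (_ *m _); have Gs := iota_in Ss.
    have us := subgroup_unit sS Ss.
    have us1 := subgroup_unit sG (subgroupM sG Gs Gz).
    apply: (can_inj (mulKmx us1)); rewrite (mulmxV us1).
    rewrite !mulmxA -(mulmxA _ (blk z1 z2)) (mulmxV uz) mulmx1 -iotaM (mulmxV us).
    by rewrite /iota blk1.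
  move=> i j; apply: (@regular_on_ext _ _ _ _ (fun s => (invmx (blk z1 z2) *m
    iota (invmx s) *m (blk z1 z2 *m iota s)) i j)) => [s Ss|]; first by rewrite ec.
  apply: (regular_mulmx (A := fun s => invmx (blk z1 z2) *m iota (invmx s))
    (B := fun s => blk z1 z2 *m iota s)).
    apply: (regular_mulmx (A := fun=> invmx (blk z1 z2))); first exact: regular_mx_cst.
    by move=> i' j'; exact: (regular_inv sS (regular_mx_iota i' j')).
  by apply: (regular_mulmx (A := fun=> blk z1 z2)).
have Fcs s : S s -> F (c s) by move=> Ss; exact/hF/iota_in.
have rec : regular_on S (e \o c).
  apply: (@regular_on_comp _ _ _ _ G) (regular_on_GL _ re) => //.
    by move=> s /Fcs /FG.
  apply: (@regular_on_ext _ _ _ _ (fun=> 1)) => [s Ss|]; last exact: regular_on_cst.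
  have us := subgroup_unit sG (iota_in Ss).
  by rewrite /c (det_commutator us uz) invr1.
have eE s : S s -> c s = 1%:M \/ c s <> 1%:M /\ e (c s) = 0.
  move=> Ss; have [->|ne] := pselect (c s = 1%:M); first by left.
  by right; split=> //; apply: e0 => //; exact: Fcs.
pose Y1 := [set s | S s /\ c s = 1%:M].
pose Y2 := [set s | S s /\ e (c s) = 0].
have c1 : c 1%:M = 1%:M.
  by rewrite /c /iota blk1 mul1mx mulmx1 (mulVmx uz).
have [||||h|h] := cS (Y1 := Y1) (Y2 := Y2).
- exists [set (fun s => (e \o c) s - 1)].
    by move=> _ ->; apply: regular_on_sub => //; exact: regular_on_cst.
  apply/seteqP; split=> s [Ss].
    by move=> cs; split=> // _ ->; rewrite /= cs e1 subrr.
  move=> /(_ _ erefl) ec; split; first exact: Ss.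
  case: (eE s Ss) => [//|[_ es]].
  have e1s : e (c s) = 1 by apply/eqP; rewrite -subr_eq0; apply/eqP; exact: ec.
  by have := oner_neq0 C; rewrite -e1s es eqxx.
- exists [set e \o c]; first by move=> _ ->.
  apply/seteqP; split=> s [Ss]; first by move=> cs; split=> // _ ->.
  by move=> /(_ _ erefl).
- apply/seteqP; split=> [s [[]|[]]//|s Ss].
  by case: (eE s Ss) => [cs|[_ es]]; [left|right].
- apply/seteqP; split=> // s [[Ss cs] [_]].
  by rewrite cs e1 => /eqP; rewrite oner_eq0.
- have : Y1 1%:M by split=> //; exact: subgroup1.
  by rewrite h.
apply: prod_center => //; first by move=> w Zw; exact: (torus_comm tZ).
split=> // s Ss; have [cs|[_ es]] := eE s Ss; last first.
  have : Y2 s by [].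
  by rewrite h.
have us := subgroup_unit sG (subgroupM sG (iota_in Ss) Gz).
have e2 : blk z1 z2 *m iota s = iota s *m blk z1 z2.
  by rewrite -[LHS](mulKVmx us) -/(c s) cs mulmx1.
by move: e2; rewrite /iota !blkM => /blk_inj[].
Qed.

End ProductGroup.

Theorem proposition3p10 (R : realType) (m n : nat)
    (Z : set 'M[R[i]]_m) (Gss : set 'M[R[i]]_n)
    (theta : 'M[R[i]]_(m + n) -> 'M[R[i]]_(m + n))
    (hZ : torus Z) (hss : semisimple Gss) (hsc : simply_connected Gss)
    (htheta : alg_involution (prod_group Z Gss) theta)
    (hreg : componentwise_regular (prod_group Z Gss) theta)
    (B : set (set (subvs_of (datum_V (prod_group Z Gss) theta) ->
                   subvs_of (datum_V (prod_group Z Gss) theta))))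
    (hB : subgroup_of_A (prod_group Z Gss) theta B)
    (hB0 : datum_B0 (prod_group Z Gss) theta `<=` B) :
  let G := prod_group Z Gss in
  (forall a, datum_A G theta a -> B (mul_set a a) ->
     sdist_LB G theta (Rset (datum_L G theta)) B `<=`
       sdist_comp G theta (Rset (datum_L G theta)) a ->
     sdist_LB G theta setT B `<=` sdist_comp G theta setT a)
  /\
  (forall (F : set 'M[R[i]]_(m + n)) (k : nat) (G' : set 'M[R[i]]_k)
      (theta' : 'M[R[i]]_k -> 'M[R[i]]_k) (q : 'M[R[i]]_(m + n) -> 'M[R[i]]_k),
     central_quotient G theta F G' theta' q ->
     component_image G theta (extended_fixed_group G theta F) = B ->
     regular_pair G' theta').
Proof.
move=> G.
have aG : alg_group G by apply: alg_group_prod; [case: hZ|case: hss].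
have fin : finitely_many_components G theta by exact: finite_components.
split=> [a Aa _|F k G' theta' q cq _]; first exact: component_regularity.
apply: (regular_quotient aG htheta _ fin cq) => //.
- exact: prod_constant_mod_center.
- have [[_ finF FZ _] _] := cq => z; apply: prod_central_lift => //.
  by move=> w /FZ[].
Qed.
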